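(* Let $A\in\mathbb{R}^{d\times d}$ be an invertible matrix with $\rho(A)<1$, let $C=(I-A)^{-1}$, and let $P\in\mathbb{R}^{d\times d}$ be a (row-)stochastic matrix with $P_{i,j}>0$ if and only if $A_{i,j}\neq 0$, such that the Markov chain on $[d]=\{1,\dots,d\}$ with transition matrix $P$ is irreducible and aperiodic and such that $\rho(\widehat H)<1$, where $\widehat H_{i,j}=A_{i,j}^2/P_{i,j}$ if $P_{i,j}\ne 0$ and $\widehat H_{i,j}=0$ otherwise. Let $\Sigma^K$ and $\Gamma^K$ be the $d\times d$ random matrices produced after $K$ iterations of the regenerative Ulam-von Neumann recursion described in the context, and let $$\widehat C^K_{i,j}=\frac{\Sigma^K_{i,j}}{\Gamma^K_{i,j}}\,D^K_j+\mathbb{1}_{[i=j]},\qquad D^K_j=\frac{\Gamma^K_{j,j}}{\Gamma^K_{j,j}-\Sigma^K_{j,j}},\qquad i,j\in[d].$$ Then there exists a symmetric positive semi-definite $d^2\times d^2$ matrix $M_C$ such that, as $K\to\infty$, the random matrix with entries $\left\{\sqrt K\left(\widehat C^K_{i,j}-C_{i,j}\right)\right\}_{1\le i,j\le d}$ (viewed as a vector in $\mathbb{R}^{d^2}$) converges in distribution to a $d^2$-variate normal variable with mean zero and covariance matrix $M_C$.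
   Context: $\rho(\cdot)$ denotes the spectral radius, and $\mathbb{1}_{[\cdot]}$ is the indicator. Regenerative Ulam-von Neumann recursion. Maintain three $d\times d$ matrices $\Lambda,\Sigma$ (real) and $\Gamma$ (nonnegative integers), all initialized to zero, and a Markov chain on $[d]$ with transition matrix $P$, started at some (random) state $i\in[d]$. One iteration, with current state $i$, does the following in order: (a) for all $k\in[d]$: if $\Lambda_{i,k}=0$, set $\Lambda_{i,k}=1$ (otherwise leave it unchanged); (b) sample the next state $j$ of the chain with probabilities $P_{i,\cdot}$; (c) multiply the whole matrix $\Lambda$ by the scalar $A_{i,j}/P_{i,j}$; (d) for all $k\in[d]$: if $\Lambda_{k,j}\ne0$, increase $\Gamma_{k,j}$ by $1$; (e) for all $k\in[d]$: replace $\Sigma_{k,j}$ by $\Sigma_{k,j}+\Lambda_{k,j}$; (f) for all $k\in[d]$: set $\Lambda_{k,j}=0$; (g) set the current state to $j$. The iteration is repeated; $\Sigma^K,\Gamma^K$ denote the matrices $\Sigma,\Gamma$ after $K$ iterations (Markov transitions). The quantities $\widehat C^K_{i,j}$ may be undefined for small $K$ (when a denominator vanishes); the assertion is asymptotic as $K\to\infty$. *)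

(* Defs.v *)
From HB Require Import structures.
From mathcomp Require Import all_boot all_order all_algebra.
From mathcomp Require Import complex.
From mathcomp Require Import all_classical all_reals all_analysis.

Set Implicit Arguments.
Unset Strict Implicit.
Unset Printing Implicit Defensive.

Import Order.TTheory GRing.Theory Num.Theory.
Import numFieldNormedType.Exports.

Local Open Scope classical_set_scope.
Local Open Scope ring_scope.

(* Largest modulus of a complex eigenvalue of the real matrix A. *)
Definition spectral_radius (R : realType) (d : nat) (A : 'M[R]_d) : R :=
  sup [set ComplexField.Normc.normc z |
       z in [set z : R[i] | eigenvalue (map_mx (real_complex R) A) z]].

Definition stochastic (R : realType) (d : nat) (P : 'M[R]_d) : Prop :=
  (forall i j, 0 <= P i j) /\ (forall i, \sum_j P i j = 1).

Definition irreducible_mx (R : realType) (d : nat) (P : 'M[R]_d) : Prop :=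
  forall i j, exists n : nat, 0 < (P ^+ n) i j.

(* Every state has period gcd {n >= 1 | (P ^+ n) i i > 0} equal to 1. *)
Definition aperiodic_mx (R : realType) (d : nat) (P : 'M[R]_d) : Prop :=
  forall (i : 'I_d) (g : nat),
    (forall n : nat, (0 < n)%N -> 0 < (P ^+ n) i i -> (g %| n)%N) -> g = 1%N.

(* The law of X 0 is arbitrary.  The transition rule is the equality
   Pr(X_{n+1} = x_{n+1} | X_0 = x_0, ..., X_n = x_n) = P x_n x_{n+1},
   multiplied out so that null histories need no separate treatment. *)
Definition markov_chain (R : realType) (disp : measure_display)
    (T : measurableType disp) (Pr : probability T R) (d : nat)
    (P : 'M[R]_d) (X : nat -> T -> 'I_d) : Prop :=
  (forall n i, measurable (X n @^-1` [set i])) /\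
  (forall (n : nat) (x : nat -> 'I_d),
     Pr [set w | forall m, (m <= n.+1)%N -> X m w = x m] =
     (Pr [set w | forall m, (m <= n)%N -> X m w = x m] *
      (P (x n) (x n.+1))%:E)%E).

Definition Hhat (R : realType) (d : nat) (A P : 'M[R]_d) : 'M[R]_d :=
  \matrix_(i, j) (if P i j != 0 then A i j ^+ 2 / P i j else 0).

Record uvn_state (R : realType) (d : nat) := UvnState {
  uvn_Lambda : 'M[R]_d;
  uvn_Sigma : 'M[R]_d;
  uvn_Gamma : 'M[nat]_d
}.

(* One iteration in which the chain moves from i to j. *)
Definition uvn_step (R : realType) (d : nat) (A P : 'M[R]_d) (i j : 'I_d)
    (s : uvn_state R d) : uvn_state R d :=
  let L1 := \matrix_(k, l)
    (if (k == i) && (uvn_Lambda s k l == 0) then 1 else uvn_Lambda s k l) in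
  let L2 := (A i j / P i j) *: L1 in
  let G := \matrix_(k, l)
    (if (l == j) && (L2 k l != 0) then (uvn_Gamma s k l).+1
     else uvn_Gamma s k l) in
  let S := \matrix_(k, l)
    (if l == j then uvn_Sigma s k l + L2 k l else uvn_Sigma s k l) in
  let L3 := \matrix_(k, l) (if l == j then 0 else L2 k l) in
  UvnState L3 S G.

Fixpoint uvn (R : realType) (d : nat) (A P : 'M[R]_d) (x : nat -> 'I_d)
    (K : nat) : uvn_state R d :=
  if K is K'.+1 then uvn_step A P (x K') (x K'.+1) (uvn A P x K')
  else UvnState 0 0 (const_mx 0%N).

(* Where a denominator vanishes, the convention x / 0 = 0 applies. *)
Definition uvn_estimator (R : realType) (d : nat) (S : 'M[R]_d)
    (G : 'M[nat]_d) : 'M[R]_d :=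
  let D (j : 'I_d) : R := (G j j)%:R / ((G j j)%:R - S j j) in
  \matrix_(i, j) (S i j / (G i j)%:R * D j + (i == j)%:R).

Definition Chat (R : realType) (d : nat) (A P : 'M[R]_d) (x : nat -> 'I_d)
    (K : nat) : 'M[R]_d :=
  uvn_estimator (uvn_Sigma (uvn A P x K)) (uvn_Gamma (uvn A P x K)).

Definition symmetric_psd (R : realType) (n : nat) (M : 'M[R]_n) : Prop :=
  M^T = M /\ (forall u : 'rV[R]_n, 0 <= (u *m M *m u^T) 0 0).

(* R^n with its Borel sigma-algebra. *)
Definition borel_rV (R : realType) (n : nat) :=
  g_sigma_algebraType (@open 'rV[R]_n).

(* N(m, v) with variance v; normal_prob takes a standard deviation and is not
   the Dirac mass when that deviation is 0. *)
Definition normal_law (R : realType) (m v : R) (B : set R) : \bar R :=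
  if v == 0 then \d_m B else normal_prob m (Num.sqrt v) B.

(* N(m, M) on R^n, with M possibly singular: every linear form <., u> has law
   N(<m, u>, u M u^T). *)
Definition multivariate_normal (R : realType) (n : nat)
    (m : 'rV[R]_n) (M : 'M[R]_n)
    (mu : probability (borel_rV R n) R) : Prop :=
  forall (u : 'rV[R]_n) (B : set R), measurable B ->
    mu [set y : 'rV[R]_n | B ((y *m u^T) 0 0)] =
    normal_law ((m *m u^T) 0 0) ((u *m M *m u^T) 0 0) B.

Definition cvg_in_distribution (R : realType) (disp : measure_display)
    (T : measurableType disp) (Pr : probability T R) (n : nat)
    (Y : nat -> T -> 'rV[R]_n) (mu : probability (borel_rV R n) R) : Prop :=
  (forall K, measurable_fun setT (Y K : T -> borel_rV R n)) /\
  (forall f : 'rV[R]_n -> R, continuous f ->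
     (exists c : R, forall y, `|f y| <= c) ->
     ('E_Pr[f \o Y K])%E @[K --> \oo] --> (\int[mu]_y (f y)%:E)%E).

(* Main.v *)
(* Let G y j = C y j / C j j and F = A G, so that F i j = G i j off the diagonal
   and 1 - F j j = 1 / C j j. Adding to Sigma - F Gamma the expected value of the
   pending weights gives a matrix M of martingales, whose increments along a
   transition from x to y are L i j (A x y / P x y G y j - F x j), L being Lambda
   after step (a). The condition rho(Hhat) < 1 bounds the second moments of L, and
   column j of L is reset at each visit to j, so that the pair (state, L) forgets
   its past geometrically. Hence the conditional variances of M average out, which
   yields a central limit theorem for M, and Gamma / K converges to a positive
   constant. As Chat - C is a smooth function of (Sigma - F Gamma) / K and Gamma / K,
   the delta method concludes.
   Expectations along the chain are iterates of a finite averaging operator, and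
   weak convergence is deduced from characteristic functions and tightness by
   approximating continuous functions on cubes by trigonometric polynomials. *)

Require Import Defs.
From mathcomp Require Import all_boot all_order all_algebra.
From mathcomp Require Import complex.
From mathcomp Require Import ring lra zify.
From mathcomp Require Import all_classical all_reals all_analysis.
From mathcomp Require Import measurable_realfun.

Set Implicit Arguments.
Unset Strict Implicit.
Unset Printing Implicit Defensive.

Import Order.TTheory GRing.Theory Num.Theory.
Import numFieldNormedType.Exports.

Local Open Scope classical_set_scope.
Local Open Scope ring_scope.

(** * Nonnegative and stochastic matrices *)

(** With weights multiplied along the chain, F i j is the expected weight of a path from i stopped
    at its first arrival in j after at least one step; G is the same with zero steps allowed. A
    cycle of the recursion for the pair (i, j) adds one such weight to Sigma and 1 to Gamma, so
    Sigma / Gamma estimates F. Splitting paths at their visits to j gives C i j = F i j * C j j +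
    [i = j], which explains the form of the estimator, provided that C j j is nonzero. The cycles of
    one fixed pair are independent, but a visit to j resets column j only, so the d^2 entries are
    not sums over common i.i.d. blocks. This is why martingales are used, together with a coupling
    argument made column by column. Two drift functions make it quantitative: one for [Hhat]
    contracts the squared weights, and one for the chain killed at j controls the time to the next
    visit to j. Only second moments of the weights are under control, so the central limit theorem
    rests on uniform integrability and truncation, not on higher moments. *)

Section NonnegativeMatrices.
Variable R : realType.

Lemma le_term_sum (I : finType) (F : I -> R) i : (forall k, 0 <= F k) -> F i <= \sum_k F k.
Proof. by move=> F0; rewrite (bigD1 i) //= lerDl sumr_ge0. Qed.

Lemma sum_indicator (I : finType) (F : I -> R) i : \sum_k (k == i)%:R * F k = F i.
Proof.
rewrite (bigD1 i) //= eqxx mul1r big1 ?addr0 // => k /negbTE ->.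
by rewrite mul0r.
Qed.

Lemma cvg_bigsum (T I : Type) (F : set_system T) (FF : Filter F) (r : seq I)
    (P : pred I) (f : I -> T -> R) (a : I -> R) :
  (forall i, P i -> f i x @[x --> F] --> a i) ->
  \sum_(i <- r | P i) f i x @[x --> F] --> \sum_(i <- r | P i) a i.
Proof. by move=> h; apply: cvg_big => // x; exact: add_continuous. Qed.

Lemma continuous_det (n : nat) (M : R -> 'M[R]_n) (t : R) :
  (forall i j, {for t, continuous (fun s => M s i j)}) ->
  {for t, continuous (fun s => \det (M s))}.
Proof.
move=> h; apply: cvg_bigsum => s _; apply: cvgM; first exact: cvg_cst.
apply: cvg_big => [x|i _]; first exact: mul_continuous.
exact: h.
Qed.

Lemma continuous_adj (n : nat) (M : R -> 'M[R]_n) (t : R) i j :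
  (forall i j, {for t, continuous (fun s => M s i j)}) ->
  {for t, continuous (fun s => \adj (M s) i j)}.
Proof.
move=> h.
have -> : (fun s => \adj (M s) i j) = (fun s => cofactor (M s) j i).
  by apply/funext => s; rewrite mxE.
apply: cvgM; first exact: cvg_cst.
apply: continuous_det => k l.
have -> : (fun s => row' j (col' i (M s)) k l) =
          (fun s => M s (lift j k) (lift i l)).
  by apply/funext => s; rewrite !mxE.
exact: h.
Qed.

(* With w_t = (1 - tH)^-1 1, the number min(1, min_i w_t(i)) is continuous in
   t, starts at 1, and never lies in [0,1[ since w_t = 1 + t H w_t. *)
Lemma lyapunov_of_unitmx (n : nat) (H : 'M[R]_n) :
  (forall i j, 0 <= H i j) ->
  (forall t, 0 <= t <= 1 -> 1%:M - t *: H \in unitmx) ->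
  exists w : 'I_n -> R, (forall i, 1 <= w i) /\
    forall i, \sum_j H i j * w j = w i - 1.
Proof.
move=> H0 Hu.
pose M t : 'M[R]_n := 1%:M - t *: H.
pose w t i := (\det (M t))^-1 * \sum_j \adj (M t) i j.
have wE t : 0 <= t <= 1 -> forall i, w t i = 1 + t * \sum_j H i j * w t j.
  move=> t01 i.
  have [v [vE]] : exists v : 'cV[R]_n, (forall j, w t j = v j 0) /\
      M t *m v = const_mx 1.
    exists (invmx (M t) *m const_mx 1); split; last by rewrite mulKVmx // Hu.
    move=> j; rewrite mxE /w mulr_sumr /invmx (Hu t t01).
    by apply: eq_bigr => k _; rewrite !mxE mulr1.
  move=> /matrixP/(_ i 0); rewrite /M mulmxBl mul1mx -scalemxAl !mxE -vE.
  under eq_bigr do rewrite -vE.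
  lra.
have Mc t : forall i j, {for t, continuous (fun s => M s i j)}.
  move=> i j.
  have -> : (fun s => M s i j) = (fun s => (1%:M : 'M[R]_n) i j - s * H i j).
    by apply/funext => s; rewrite !mxE.
  apply: cvgB; first exact: cvg_cst.
  by apply: cvgM; [exact: cvg_id|exact: cvg_cst].
pose m t := \big[Num.min/1]_(i < n) w t i.
have m1 t : 0 <= t <= 1 -> 0 <= m t -> forall i, 1 <= w t i.
  move=> t01 /bigmin_geP[_ wge0] i; rewrite wE // lerDl mulr_ge0 //.
    by case/andP: t01.
  by apply: sumr_ge0 => j _; rewrite mulr_ge0 ?H0 ?wge0.
have m2 t : 0 <= t <= 1 -> 0 <= m t -> m t = 1.
  move=> t01 /(m1 t t01) h; apply/eqP; rewrite eq_le bigmin_le_id /=.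
  by apply/bigmin_geP; split.
have t0 : (0:R) <= (0:R) <= 1 by rewrite lexx ler01.
have t1 : (0:R) <= (1:R) <= 1 by rewrite lexx ler01.
have m0 : m 0 = 1.
  apply: m2 => //; apply/bigmin_geP; split => // i _.
  by rewrite (wE 0 t0) mul0r addr0.
have mc : {within `[0, 1], continuous m}.
  apply: continuous_in_subspaceT => t; rewrite inE /= in_itv /= => t01.
  apply: cvg_big => [x|i _].
    apply: (@continuous_min R _ fst snd x); [exact: cvg_fst|exact: cvg_snd].
  apply: cvgM.
    apply: cvgV; last exact: continuous_det (Mc t).
    by have := Hu _ t01; rewrite unitmxE unitfE.
  by apply: cvg_bigsum => j _; exact: continuous_adj (Mc t).
have m1ge0 : 0 <= m 1.
  rewrite leNgt; apply/negP => m1lt0.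
  have [|c] := @IVT R m 0 1 (2^-1) ler01 mc.
    by rewrite m0 ge_min le_max; apply/andP; split; apply/orP; [right|left]; lra.
  rewrite in_itv /= => c01 mcE.
  by have := m2 c c01; rewrite mcE => /(_ _) E; have := E ltac:(lra); lra.
exists (w 1); split; first exact: m1.
by move=> i; rewrite [in RHS](wE 1 t1) mul1r addrC addKr.
Qed.

(** Subtracting 1 from [w] removes at least the fraction 1/W of it, where W bounds [w]. *)
Lemma lyapunov_contract (n : nat) (H : 'M[R]_n) (w : 'I_n -> R) :
  (forall i, 1 <= w i) -> (forall i, \sum_j H i j * w j = w i - 1) ->
  exists q, 0 <= q < 1 /\ forall i, \sum_j H i j * w j <= q * w i.
Proof.
move=> w1 wE.
pose W := 1 + \sum_i w i.
have wW i : w i <= W.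
  by have := le_term_sum i (fun j => le_trans ler01 (w1 j)); rewrite /W; lra.
have W1 : 1 <= W.
  rewrite /W lerDl; apply: sumr_ge0 => j _; by rewrite (le_trans _ (w1 j)).
have W0 : 0 < W by lra.
exists (1 - W^-1); split.
  rewrite subr_ge0 invf_le1 // W1 /=.
  by rewrite ltrBlDr ltrDl invr_gt0.
move=> i; rewrite wE mulrBl mul1r lerD2l lerN2.
by rewrite ler_pdivrMl // mulr1 wW.
Qed.

(** If 1 - tH were singular, 1/t would be an eigenvalue of H, and 1/t >= 1. *)
Lemma unitmx_of_spectral_radius (n : nat) (H : 'M[R]_n) :
  spectral_radius H < 1 ->
  forall t, 0 <= t <= 1 -> 1%:M - t *: H \in unitmx.
Proof.
move=> rho t /andP[t0 t1]; apply/negPn/negP => nu.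
have tn0 : t != 0.
  by apply: contraNneq nu => ->; rewrite scale0r subr0 unitmx1.
have tgt0 : 0 < t by rewrite lt_neqAle eq_sym tn0.
have eigR : eigenvalue H t^-1.
  rewrite /eigenvalue kermx_eq0; apply: contra nu => fr.
  have -> : 1%:M - t *: H = (- t) *: (H - t^-1%:M).
    rewrite scalerBr scale_scalar_mx mulNr divff //.
    by rewrite [(- 1)%:M]raddfN /= opprK scaleNr addrC.
  by rewrite unitmxZ ?unitfE ?oppr_eq0 // -row_free_unit.
have eigC : eigenvalue (map_mx (real_complex R) H) (real_complex R t^-1).
  move: eigR; rewrite !eigenvalue_root_char -map_char_poly.
  by rewrite fmorph_root.
suff : t^-1 <= spectral_radius H.
  have : 1 <= t^-1 by rewrite invf_ge1.
  by move: rho; lra.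
set E := [set z : R[i] | eigenvalue (map_mx (real_complex R) H) z].
have -> : t^-1 = ComplexField.Normc.normc (real_complex R t^-1).
  by rewrite /= expr0n /= addr0 sqrtr_sqr ger0_norm // invr_ge0.
apply: ub_le_sup; last by exists (real_complex R t^-1).
have [r rE] := closed_field_poly_normal (char_poly (map_mx (real_complex R) H)).
(* [sup] dominates its members only when the set is bounded above; the sum of the moduli of all
   roots of the characteristic polynomial is such a bound. *)
exists (\sum_(z <- r) ComplexField.Normc.normc z) => _ [z /= Ez <-].
have zr : z \in r.
  move: Ez; rewrite eigenvalue_root_char rE rootZ ?lead_coef_eq0 ?root_prod_XsubC //.
  by rewrite monic_neq0 // char_poly_monic.
have nge0 (y : R[i]) : 0 <= ComplexField.Normc.normc y.
  by case: y => a b /=; exact: sqrtr_ge0.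
rewrite (perm_big _ (perm_to_rem zr)) big_cons lerDl.
by apply: sumr_ge0 => y _; exact: nge0.
Qed.

(** Comparison principle: the least m >= 0 with v <= m w satisfies m <= q m, hence is 0. *)
Lemma lyapunov_le0 (n : nat) (H : 'M[R]_n) (w : 'I_n -> R) (q : R) :
  (forall i j, 0 <= H i j) -> (forall i, 1 <= w i) -> 0 <= q < 1 ->
  (forall i, \sum_j H i j * w j <= q * w i) ->
  forall v : 'I_n -> R, (forall i, v i <= \sum_j H i j * v j) ->
  forall i, v i <= 0.
Proof.
move=> H0 w1 /andP[q0 q1] Hw v Hv.
have w0 i : 0 < w i by rewrite (lt_le_trans _ (w1 i)).
pose m := \big[Num.max/0]_(i < n) (v i / w i).
have vm i : v i <= m * w i by rewrite -ler_pdivrMr //; exact: le_bigmax.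
have m0 : 0 <= m by exact: bigmax_ge_id.
have mq : m <= q * m.
  apply/bigmax_leP; split; first by rewrite mulr_ge0.
  move=> i _; rewrite ler_pdivrMr //; apply: (le_trans (Hv i)).
  apply: (@le_trans _ _ (\sum_j H i j * (m * w j))).
    by apply: ler_sum => j _; rewrite ler_wpM2l.
  rewrite -mulrA mulrCA [X in X <= _](_ : _ = m * \sum_j H i j * w j).
    by rewrite ler_wpM2l.
  by rewrite mulr_sumr; apply: eq_bigr => j _; rewrite mulrCA.
have m00 : m = 0 by nra.
by move=> i; have := vm i; rewrite m00 mul0r.
Qed.

End NonnegativeMatrices.

Section StochasticMatrices.
Variables (R : realType) (d : nat) (P : 'M[R]_d).
Hypothesis Pst : stochastic P.

Lemma stoch_pow_ge0 n i j : 0 <= (P ^+ n) i j.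
Proof.
elim: n i j => [|n IH] i j; first by rewrite expr0 mxE ler0n.
rewrite exprS -mulmxE mxE; apply: sumr_ge0 => k _.
by rewrite mulr_ge0 ?IH //; case: Pst.
Qed.

Lemma stoch_pow_sum n i : \sum_j (P ^+ n) i j = 1.
Proof.
elim: n i => [|n IH] i.
  rewrite (bigD1 i) //= big1 ?expr0 ?mxE ?eqxx ?addr0 // => j ji.
  by rewrite mxE eq_sym (negbTE ji).
under eq_bigr do rewrite exprS -mulmxE mxE.
rewrite exchange_big /=.
under eq_bigr do rewrite -mulr_sumr IH mulr1.
by case: Pst.
Qed.

Lemma stoch_pow_le1 n i j : (P ^+ n) i j <= 1.
Proof.
by rewrite -(stoch_pow_sum n i); exact: (le_term_sum j (stoch_pow_ge0 n i)).
Qed.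

Lemma stoch_powD_gt0 m n i k j :
  0 < (P ^+ m) i k -> 0 < (P ^+ n) k j -> 0 < (P ^+ (m + n)) i j.
Proof.
move=> h1 h2; rewrite exprD -mulmxE mxE (bigD1 k) //= ltr_pwDl ?mulr_gt0 //.
by apply: sumr_ge0 => l _; rewrite mulr_ge0 ?stoch_pow_ge0.
Qed.

Lemma stoch_powS_gt0 n i j : 0 < (P ^+ n.+1) i j ->
  exists2 k, 0 < P i k & 0 < (P ^+ n) k j.
Proof.
rewrite exprS -mulmxE mxE => h; apply: contrapT => hn.
move: h; rewrite big1 ?ltxx // => k _.
have P0 : 0 <= P i k by case: Pst.
have Q0 := stoch_pow_ge0 n k j.
move: P0; rewrite le_eqVlt => /orP[/eqP <-|Pk]; first by rewrite mul0r.
move: Q0; rewrite le_eqVlt => /orP[/eqP <-|Qk]; first by rewrite mulr0.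
by case: hn; exists k.
Qed.

Definition killed_mx (j : 'I_d) : 'M[R]_d :=
  \matrix_(x, y) (if y == j then 0 else P x y).

(* Maximum principle: a fixed vector of t * killed_mx j has constant modulus
   on a set of states that is closed under P and does not contain j. *)
Lemma killed_unitmx (j : 'I_d) : irreducible_mx P ->
  forall t, 0 <= t <= 1 -> 1%:M - t *: killed_mx j \in unitmx.
Proof.
move=> irr t /andP[t0 t1]; rewrite unitmxE unitfE -det_tr.
apply/negP => /det0P[u un0 uE].
pose v i := u 0 i.
have vE x : v x = t * \sum_y (if y == j then 0 else P x y) * v y.
  move/matrixP/(_ 0 x): uE; rewrite linearB /= trmx1 mulmxBr mulmx1 !mxE => /eqP.
  rewrite subr_eq0 => /eqP uxE; rewrite /v uxE mulr_sumr.
  by apply: eq_bigr => y _; rewrite !mxE mulrC mulrA.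
have /rV0Pn[i0 vi0] := un0.
pose x0 := [arg max_(i > i0) `|v i|]%O.
pose m := `|v x0|.
have vm y : `|v y| <= m.
  by rewrite /m /x0; case: arg_maxP => // x _ /(_ y isT).
have m0 : 0 < m by rewrite (lt_le_trans _ (vm i0)) // normr_gt0.
have step x y : `|v x| = m -> 0 < P x y -> y != j /\ `|v y| = m.
  move=> vx Pxy.
  pose g z := if z == j then 0 else `|v z|.
  have gm z : g z <= m by rewrite /g; case: ifP => // _; exact: ltW.
  have h1 : m <= \sum_z P x z * g z.
    rewrite -{1}vx vE normrM ger0_norm //.
    apply: (@le_trans _ _ (1 * `|\sum_z (if z == j then 0 else P x z) * v z|)).
      by rewrite ler_wpM2r.
    rewrite mul1r; apply: (le_trans (ler_norm_sum _ _ _)).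
    apply: ler_sum => z _; rewrite /g; case: ifP => _.
      by rewrite mul0r normr0 mulr0.
    by rewrite normrM ger0_norm //; case: Pst.
  have h2 : \sum_z P x z * (m - g z) = 0.
    apply/eqP; rewrite eq_le; apply/andP; split.
      under eq_bigr do rewrite mulrBr.
      rewrite sumrB -mulr_suml; case: Pst => _ ->; by rewrite mul1r subr_le0.
    apply: sumr_ge0 => z _; rewrite mulr_ge0 ?subr_ge0 //; by case: Pst.
  have : P x y * (m - g y) = 0.
    apply: (psumr_eq0P _ h2) => // z _.
    by rewrite mulr_ge0 ?subr_ge0 //; case: Pst.
  move/eqP; rewrite mulf_eq0 (gt_eqF Pxy) /= subr_eq0 /g => /eqP.
  case: eqP => [_ mE|/eqP yj ->]; last by [].
  by move: m0; rewrite mE ltxx.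
(* Started off j at a state of maximal modulus, the chain can never meet j. *)
have clo n x y : x != j -> `|v x| = m -> 0 < (P ^+ n) x y -> y != j.
  elim: n x => [|n IH] x xj vx.
    rewrite expr0 mxE; case: eqP => [<- //|_]; by rewrite ltxx.
  by move=> /stoch_powS_gt0[k /(step _ _ vx)[kj vk]]; exact: IH.
(* [x0] may be j itself, but by [step] its successors are not; irreducibility is therefore
   contradicted from a successor. *)
have [y1 Py1] : exists y, 0 < P x0 y.
  apply/not_existsP => h; case: Pst => P0 /(_ x0).
  rewrite big1 => [/esym/eqP|y _]; first by rewrite oner_eq0.
  by apply/eqP; rewrite eq_le P0 andbT leNgt; apply/negP; exact: h.
have [y1j vy1] := step x0 y1 erefl Py1.
by have [n /(clo n _ _ y1j vy1)/eqP] := irr y1 j.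
Qed.

End StochasticMatrices.

(** The least positive difference k of two elements of S divides every element of S, so it is 1.
    With b and b + 1 in S, any n >= b^2, written n = q b + r with r < b <= q, equals (q - r) b + r
    (b + 1). *)
Lemma semigroup_eventually (S : nat -> Prop) :
  S 0%N -> (forall m n, S m -> S n -> S (m + n)%N) ->
  (forall g, (forall n, (0 < n)%N -> S n -> (g %| n)%N) -> g = 1%N) ->
  exists N, forall n, (N <= n)%N -> S n.
Proof.
move=> S0 SD Sg.
have SM q n : S n -> S (q * n)%N.
  by move=> Sn; elim: q => [|q IH]; rewrite ?mul0n // mulSn; exact: SD.
pose D k := (0 < k)%N && `[< exists b, S b /\ S (b + k)%N >].
have exD : exists k, D k.
  apply/not_existsP => h.
  suff : 2%N = 1%N by [].
  apply: Sg => n n0 Sn; exfalso; apply: (h n); rewrite /D n0 /=.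
  by apply/asboolP; exists 0%N.
case: (ex_minnP exD) => k /andP[k0 /asboolP[b [Sb Sbk]]] kmin.
have k1 : k = 1%N.
  apply: Sg => n n0 Sn; rewrite /dvdn; apply/negPn/negP => r0.
  (* A nonzero remainder of n modulo k is again a difference: it separates (n %/ k) (b + k) from n +
     (n %/ k) b. *)
  suff : (k <= n %% k)%N by rewrite leqNgt ltn_mod k0.
  apply: kmin; rewrite /D lt0n r0 /=; apply/asboolP.
  exists (n %/ k * (b + k))%N; split; first exact: SM.
  rewrite (_ : (_ + _)%N = (n + n %/ k * b)%N); first by apply: SD => //; exact: SM.
  by rewrite mulnDr -addnA -divn_eq addnC.
exists (b * b)%N => n bn.
have [b0|b0] := posnP b.
  by rewrite -(muln1 n); apply: SM; move: Sbk; rewrite b0 k1.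
have rb : (n %% b < b)%N by rewrite ltn_mod.
have qb : (b <= n %/ b)%N by rewrite leq_divRL.
have -> : n = ((n %/ b - n %% b) * b + n %% b * (b + k))%N.
  rewrite k1 mulnDr muln1 addnA -mulnDl subnK; first exact: divn_eq.
  exact: leq_trans (ltnW rb) qb.
by apply: SD; exact: SM.
Qed.

Lemma primitive_of_aperiodic (R : realType) (d : nat) (P : 'M[R]_d) :
  stochastic P -> irreducible_mx P -> aperiodic_mx P ->
  exists N, forall n, (N <= n)%N -> forall i j, 0 < (P ^+ n) i j.
Proof.
move=> Pst irr aper.
have H (p : 'I_d * 'I_d) :
    exists N, forall n, (N <= n)%N -> 0 < (P ^+ n) p.1 p.2.
  case: p => i j /=.
  have [N HN] : exists N, forall n, (N <= n)%N -> 0 < (P ^+ n) i i.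
    apply: semigroup_eventually => [|m n|g hg].
    - by rewrite expr0 mxE eqxx ltr01.
    - exact: stoch_powD_gt0.
    - exact: aper hg.
  have [k hk] := irr i j.
  exists (N + k)%N => n Nn.
  have -> : n = ((n - k) + k)%N by lia.
  apply: (stoch_powD_gt0 Pst _ hk); apply: HN; lia.
have [f hf] := choice H.
exists (\max_p f p) => n hn i j.
by apply: (hf (i, j)); apply: leq_trans hn; exact: leq_bigmax.
Qed.

(** Schur complement: subtracting v^T v, with v the i-th row divided by sqrt (M i i), keeps the
    matrix positive semi-definite and clears the i-th diagonal entry without creating new nonzero
    ones. The induction is on the number of nonzero diagonal entries. *)
Lemma psd_sum_rank1 (R : realType) (n : nat) (M : 'M[R]_n) :
  symmetric_psd M -> exists s : seq 'rV[R]_n, M = \sum_(v <- s) v^T *m v.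
Proof.
pose B (M : 'M[R]_n) (u v : 'rV[R]_n) := (u *m M *m v^T) 0 0.
have Bd (N : 'M[R]_n) i j : B N (delta_mx 0 i) (delta_mx 0 j) = N i j.
  by rewrite /B -rowE trmx_delta -colE !mxE.
have BDl N u v w : B N (u + v) w = B N u w + B N v w by rewrite /B !mulmxDl mxE.
have BDr N u v w : B N u (v + w) = B N u v + B N u w.
  by rewrite /B linearD /= mulmxDr mxE.
have BZl N a u v : B N (a *: u) v = a * B N u v by rewrite /B -!scalemxAl mxE.
have BZr N a u v : B N u (a *: v) = a * B N u v.
  by rewrite /B linearZ /= -scalemxAr mxE.
have Bsym N u v : N^T = N -> B N u v = B N v u.
  move=> NT; rewrite /B; set x := LHS.
  have -> : x = (u *m N *m v^T)^T 0 0 by rewrite [RHS]mxE.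
  by rewrite !trmx_mul trmxK NT mulmxA.
have [k] := ubnP #|[pred i | M i i != 0]|.
elim: k M => // k IH M Mk [MT Mpsd].
have Mq u : 0 <= B M u u by exact: Mpsd.
have [i Mi|Mz] := pickP [pred i | M i i != 0]; last first.
  exists [::]; rewrite big_nil; apply/matrixP => i j; rewrite mxE.
  have M0 l : M l l = 0 by apply/eqP; have := Mz l; rewrite /= => /negbFE.
  (* With a zero diagonal the form at e_i + a e_j is 2 a M i j, which changes sign with a. *)
  have h a : 0 <= 2 * (a * M i j).
    have := Mq (delta_mx 0 i + a *: delta_mx 0 j).
    rewrite BDl !BDr !BZl !BZr !Bd !M0.
    have -> : M j i = M i j by rewrite -[in LHS]MT mxE.
    lra.
  have := h 1; have := h (-1); lra.
have Mii : 0 < M i i.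
  by rewrite lt_neqAle eq_sym; apply/andP; split; [exact: Mi|rewrite -Bd Mq].
pose v := (Num.sqrt (M i i))^-1 *: row i M.
pose M' := M - v^T *m v.
have M'E u w : B M' u w = B M u w - (M i i)^-1 * B M u (delta_mx 0 i) * B M w (delta_mx 0 i).
  rewrite /B /M' mulmxBr mulmxBl mxE; congr (_ + _); rewrite mxE; congr (- _).
  rewrite mulmxA -mulmxA mxE big_ord1.
  have E x : (x *m v^T) 0 0 = (Num.sqrt (M i i))^-1 * B M x (delta_mx 0 i).
    rewrite /v linearZ /= -scalemxAr mxE; congr (_ * _).
    by rewrite /B rowE trmx_mul MT mulmxA.
  rewrite E.
  have -> : (v *m w^T) 0 0 = (w *m v^T) 0 0.
    transitivity ((v *m w^T)^T 0 0); first by rewrite [RHS]mxE.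
    by rewrite trmx_mul trmxK.
  rewrite E mulrACA -invfM -expr2 sqr_sqrtr ?ltW // ; by rewrite !mulrA.
have M'T : M'^T = M' by rewrite /M' linearB /= MT trmx_mul trmxK.
have M'q u : 0 <= B M' u u.
  rewrite M'E.
  (* The form of M' at u is the form of M at the component of u that is M-orthogonal to e_i. *)
  have := Mq (u - ((M i i)^-1 * B M u (delta_mx 0 i)) *: delta_mx 0 i).
  rewrite -scaleNr BDl !BDr !BZl !BZr (Bsym M (delta_mx 0 i)) // !Bd.
  set b := B M u (delta_mx 0 i); set c := (M i i)^-1.
  have cM : c * M i i = 1 by rewrite /c mulVf // gt_eqF.
  have cM2 : c * b * b * (c * M i i) = c * b * b by rewrite cM mulr1.
  lra.
have M'd l : M l l = 0 -> M' l l = 0.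
  move=> Ml; have := M'q (delta_mx 0 l); rewrite Bd => h.
  have := M'E (delta_mx 0 l) (delta_mx 0 l); rewrite !Bd Ml => E.
  have : 0 <= (M i i)^-1 * (M l i * M l i) 
    by apply: mulr_ge0; [rewrite invr_ge0 ltW|rewrite -expr2 sqr_ge0].
  by move: h E; set a := M' l l; rewrite -mulrA; lra.
have M'i : M' i i = 0.
  rewrite -Bd M'E !Bd mulVf ?gt_eqF // mul1r subrr //.
have [||s sE] := IH M'.
- rewrite -ltnS (leq_trans _ Mk) // ltnS; apply: proper_card; apply/properP; split.
    apply/fintype.subsetP => l; rewrite !inE; apply: contra => /eqP Ml.
    by apply/eqP; exact: M'd.
  by exists i; [exact: Mi|rewrite inE /= M'i eqxx].
- by split.
exists (v :: s); rewrite big_cons -sE /M' addrC subrK //.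
Qed.

(** * Averaging along a Markov chain *)

Section TaylorCosine.
Variable R : realType.
Implicit Types x s : R.

Lemma mvt0 (f df : R -> R) x (b : R) : 0 <= x ->
  (forall y, is_derive y (1:R) f (df y)) -> f 0 = 0 ->
  (forall c, 0 <= c <= x -> `|df c| <= b) -> `|f x| <= b * x.
Proof.
move=> x0 fdf f0 hb.
have [c] := @MVT_segment R f df 0 x x0 (fun y _ => fdf y)
  (derivable_within_continuous (fun y _ => @ex_derive _ _ _ _ _ _ _ (fdf y))).
rewrite in_itv /= => cx; rewrite f0 !subr0 => ->.
by rewrite normrM (ger0_norm x0) ler_wpM2r // hb.
Qed.

Lemma sin_bound_nneg x : 0 <= x -> `|sin x| <= x.
Proof.
move=> x0; rewrite -[leRHS]mul1r; apply: (mvt0 (df := cos)) => //.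
- exact: sin0.
- by move=> c _; exact: cos_max.
Qed.

Lemma cos_bound x : 0 <= 1 - cos x <= x ^+ 2 / 2.
Proof.
have -> : 1 - cos x = 2 * sin (x / 2) ^+ 2.
  have {1}-> : x = x / 2 + x / 2 by lra.
  by rewrite cosD; have := cos2Dsin2 (x / 2); rewrite !expr2; lra.
rewrite mulr_ge0 ?sqr_ge0 //=.
have -> : x ^+ 2 / 2 = 2 * (x / 2) ^+ 2 by field.
rewrite ler_wpM2l // -real_normK ?num_real // -[leRHS]real_normK ?num_real //.
rewrite lerXn2r ?nnegrE //.
have [h|h] := leP 0 (x / 2); first by rewrite (ger0_norm h) sin_bound_nneg.
have h' : 0 <= - (x / 2) by lra.
by rewrite -normrN -sinN (ltr0_norm h) sin_bound_nneg.
Qed.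

Lemma sin_taylor x : `|sin x - x| <= `|x| ^+ 3 /\ `|sin x - x| <= 2 * x ^+ 2.
Proof.
wlog x0 : x / 0 <= x => [hw|].
  have [|h] := leP 0 x; first exact: hw.
  have := hw (- x); rewrite sinN normrN sqrrN.
  have -> : - sin x - - x = - (sin x - x) by ring.
  rewrite normrN => H; apply: H; lra.
rewrite (ger0_norm x0).
have h : `|sin x - x| <= x ^+ 2 / 2 * x.
  apply: (mvt0 (f := fun x => sin x - x) (df := fun x => cos x - 1)) => //.
  - by rewrite sin0 subrr.
  - move=> c /andP[c0 cx]; rewrite distrC.
    have /andP[h1 h2] := cos_bound c.
    rewrite ger0_norm //; apply: le_trans h2 _.
    by rewrite ler_pM2r ?invr_gt0 // lerXn2r.
have h2 : `|sin x - x| <= 2 * x.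
  by have := ler_normB (sin x) x; have := sin_bound_nneg x0; rewrite (ger0_norm x0); lra.
split; first by apply: (le_trans h); rewrite (exprS _ 2) !expr2; nra.
have [x1|x1] := leP x 1; first by apply: (le_trans h); nra.
by apply: (le_trans h2); nra.
Qed.

Lemma cos_taylor x : `|cos x - 1 + x ^+ 2 / 2| <= `|x| ^+ 3 /\
  `|cos x - 1 + x ^+ 2 / 2| <= x ^+ 2.
Proof.
wlog x0 : x / 0 <= x => [hw|].
  have [|h] := leP 0 x; first exact: hw.
  have := hw (- x); rewrite cosN normrN sqrrN => H; apply: H; lra.
rewrite (ger0_norm x0).
have /andP[c1 c2] := cos_bound x.
have h0 : `|cos x - 1 + x ^+ 2 / 2| <= x ^+ 2 / 2.
  by rewrite ger0_norm; lra.
have h : `|cos x - 1 + x ^+ 2 / 2| <= x ^+ 3 * x.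
  apply: (mvt0 (f := fun x => cos x - 1 + x ^+ 2 / 2) (df := fun x => - sin x + x)) => //.
  - move=> y; apply: is_derive_eq.
    by rewrite oppr0 addr0 !scaler0 add0r /GRing.scale /=; field.
  - by rewrite cos0 subrr expr0n /= mul0r addr0.
  - move=> c /andP[d0 cx]; rewrite addrC distrC.
    have [+ _] := sin_taylor c; rewrite (ger0_norm d0) => /le_trans; apply.
    by rewrite lerXn2r.
split; last by apply: (le_trans h0); nra.
have [x1|x1] := leP x 1; first by apply: (le_trans h); rewrite ler_piMr // exprn_ge0.
apply: (le_trans h0); rewrite (exprS _ 2) !expr2; nra.
Qed.

(** The cubic bound serves where the increment is bounded, the quadratic one on the truncated part,
    where only second moments are controlled. *)
Lemma cos_taylor2 s x (c := `|cos (s + x) - cos s + x * sin s + x ^+ 2 / 2 * cos s|) :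
  c <= 2 * `|x| ^+ 3 /\ c <= 3 * x ^+ 2.
Proof.
have cE : c <= `|cos x - 1 + x ^+ 2 / 2| + `|sin x - x|.
  rewrite /c cosD.
  have -> : cos s * cos x - sin s * sin x - cos s + x * sin s + x ^+ 2 / 2 * cos s =
     cos s * (cos x - 1 + x ^+ 2 / 2) - sin s * (sin x - x) by field.
  apply: (le_trans (ler_normB _ _)); rewrite !normrM.
  by apply: lerD; rewrite ler_piMl // ?cos_max ?sin_max.
have [c1 c2] := cos_taylor x; have [s1 s2] := sin_taylor x.
by split; apply: (le_trans cE); lra.
Qed.

Lemma cos_lip s x : `|cos (s + x) - cos s| <= 2 * `|x|.
Proof.
have sb : `|sin x| <= `|x|.
  have [h|h] := leP 0 x; first by rewrite (ger0_norm h) sin_bound_nneg.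
  have h' : 0 <= - x by lra.
  by rewrite -normrN -sinN (ltr0_norm h) sin_bound_nneg.
have /andP[c1 c2] := cos_bound x.
have cb : `|cos x - 1| <= `|x|.
  rewrite distrC ger0_norm //; have [x1|x1] := leP `|x| 2.
    by apply: (le_trans c2); rewrite -real_normK ?num_real // expr2; have := normr_ge0 x; nra.
  by have := cos_max x; rewrite ler_norml => /andP[]; lra.
have -> : cos (s + x) - cos s = cos s * (cos x - 1) - sin s * sin x.
  by rewrite cosD; ring.
apply: (le_trans (ler_normB _ _)); rewrite !normrM.
have := ler_piMl (normr_ge0 (cos x - 1)) (cos_max s).
have := ler_piMl (normr_ge0 (sin x)) (sin_max s).
lra.
Qed.

Lemma expR_neg_taylor x : 0 <= x -> `|expR (- x) - (1 - x)| <= x ^+ 2.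
Proof.
move=> x0; have h := expR_ge1Dx (- x); rewrite ger0_norm; last lra.
have h2 := expR_ge1Dx x; rewrite expRN lerBlDr.
have e0 : 0 < expR x by exact: expR_gt0.
rewrite -[_^-1]mul1r ler_pdivrMr //.
have : 0 <= (x ^+ 2 + (1 - x)) * (expR x - (1 + x)).
  by rewrite mulr_ge0 ?subr_ge0 // expr2; nra.
have : 0 <= x ^+ 3 by rewrite exprn_ge0.
rewrite (exprS _ 2) !expr2; nra.
Qed.

End TaylorCosine.

Section MarkovOperator.
Variables (R : realType) (d : nat) (S : Type).
Variables (p : S -> 'I_d -> R) (mv : S -> 'I_d -> S).
Hypothesis p_ge0 : forall s y, 0 <= p s y.
Hypothesis p_sum : forall s, \sum_y p s y = 1.

Implicit Types g h : S -> R.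

(** [S] carries no sigma-algebra: a state has at most d successors, so the expectation after one
    step is a finite sum and [E n g s] is the expectation of g after n steps from s. *)
Definition markov_op (g : S -> R) (s : S) : R := \sum_y p s y * g (mv s y).
Local Notation T := markov_op.
Local Notation E n := (iter n markov_op).

Lemma mark_le_supp g h s :
  (forall y, 0 < p s y -> g (mv s y) <= h (mv s y)) -> T g s <= T h s.
Proof.
move=> gh; apply: ler_sum => y _.
have := p_ge0 s y; rewrite le_eqVlt => /orP[/eqP <-|py]; first by rewrite !mul0r.
by rewrite ler_pM2l // gh.
Qed.

Lemma markE_le n g h : (forall s, g s <= h s) -> forall s, E n g s <= E n h s.
Proof.
by move=> gh; elim: n => //= n IH s; apply: mark_le_supp => y _; exact: IH.
Qed.

Lemma markE_eq n g h : (forall s, g s = h s) -> forall s, E n g s = E n h s.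
Proof. by move=> /funext ->. Qed.

Lemma markE_cst n c s : E n (fun=> c) s = c.
Proof.
elim: n s => //= n IH s; rewrite /markov_op.
by under eq_bigr do rewrite IH; rewrite -mulr_suml p_sum mul1r.
Qed.

Lemma markE_lin n a b g h s :
  E n (fun s => a * g s + b * h s) s = a * E n g s + b * E n h s.
Proof.
elim: n s => //= n IH s; rewrite /markov_op.
under eq_bigr do rewrite IH.
by rewrite !mulr_sumr -big_split; apply: eq_bigr => y _ /=; ring.
Qed.

Lemma markE_D n g h s : E n (fun s => g s + h s) s = E n g s + E n h s.
Proof.
rewrite -[E n g s]mul1r -[E n h s]mul1r -markE_lin.
by apply: markE_eq => ?; rewrite !mul1r.
Qed.

Lemma markE_B n g h s : E n (fun s => g s - h s) s = E n g s - E n h s.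
Proof.
rewrite -[E n g s]mul1r -[E n h s]mul1r -mulNr -markE_lin.
by apply: markE_eq => ?; rewrite mul1r mulN1r.
Qed.

Lemma markE_Z n a g s : E n (fun s => a * g s) s = a * E n g s.
Proof.
rewrite -[RHS]addr0 -(mul0r (E n g s)) -markE_lin.
by apply: markE_eq => ?; rewrite mul0r addr0.
Qed.

Lemma markE_sum (I : Type) (r : seq I) (P : pred I) n (g : I -> S -> R) s :
  E n (fun s => \sum_(i <- r | P i) g i s) s = \sum_(i <- r | P i) E n (g i) s.
Proof.
elim: r => [|i r IH]; first by under markE_eq do rewrite big_nil; rewrite markE_cst big_nil.
under markE_eq do rewrite big_cons; rewrite big_cons.
by case: (P i); rewrite ?markE_D ?IH.
Qed.

Lemma markE_ge0 n g s : (forall s, 0 <= g s) -> 0 <= E n g s.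
Proof. by move=> g0; rewrite -[leLHS](markE_cst n 0 s); exact: markE_le. Qed.

Lemma markE_norm n g s : `|E n g s| <= E n (fun s => `|g s|) s.
Proof.
rewrite ler_norml -mulN1r -markE_Z; apply/andP; split; apply: markE_le => s'.
  by rewrite mulN1r lerNl -normrN ler_norm.
exact: ler_norm.
Qed.

Lemma markE_norm_le n g h s :
  (forall s, `|g s| <= h s) -> `|E n g s| <= E n h s.
Proof. by move=> gh; apply: (le_trans (markE_norm _ _ _)); exact: markE_le. Qed.

Lemma markE_comp m n g s : E (m + n) g s = E m (E n g) s.
Proof. by rewrite iterD. Qed.

Lemma markES n g s : E n.+1 g s = E n (T g) s.
Proof. by rewrite iterSr. Qed.

(** A quantity N moving by at most 1 per step stays within n of its start, so g and h need only be
    compared on that range. *)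
Lemma markE_le_reach (N : S -> R) n g h s :
  (forall s y, 0 < p s y -> `|N (mv s y) - N s| <= 1) ->
  (forall s', `|N s' - N s| <= n%:R -> g s' <= h s') -> E n g s <= E n h s.
Proof.
move=> Nlip; elim: n s => [|n IH] s gh /=.
  by apply: gh; rewrite subrr normr0.
apply: mark_le_supp => y py; apply: IH => s' s'n; apply: gh.
have -> : N s' - N s = (N s' - N (mv s y)) + (N (mv s y) - N s) by ring.
by apply: (le_trans (ler_normD _ _)); rewrite -natr1 lerD // Nlip.
Qed.

(** * Martingale central limit theorem: one-step estimates *)

Section CLT.
Variables (M U V : S -> R) (s0 : S) (v C : R).
Let Q s := \sum_y p s y * (M (mv s y) - M s) ^+ 2.
Hypothesis M_mart : forall s, \sum_y p s y * (M (mv s y) - M s) = 0.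
Hypothesis M_inc : forall s y, 0 < p s y -> (M (mv s y) - M s) ^+ 2 <= U s.
Hypothesis U_le : forall s, 0 <= U s <= V s.
Hypothesis V_bnd : forall n, E n V s0 <= C.
Hypothesis Q_mix : forall eps, 0 < eps ->
  exists m, forall s, `|E m Q s - v| <= eps * V s.
Hypothesis U_ui : forall eta, 0 < eta ->
  exists B, 0 <= B /\ forall n, E n (fun s => if B < U s then U s else 0) s0 <= eta.

Let Q_ge0 s : 0 <= Q s.
Proof. by apply: sumr_ge0 => y _; rewrite mulr_ge0 ?sqr_ge0. Qed.

Let Q_le s : Q s <= U s.
Proof.
rewrite -[leRHS]mul1r -[X in _ <= X * _](p_sum s) mulr_suml; apply: ler_sum => y _.
have := p_ge0 s y; rewrite le_eqVlt => /orP[/eqP <-|py]; first by rewrite !mul0r.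
by rewrite ler_pM2l // M_inc.
Qed.

Let C_ge0 : 0 <= C.
Proof.
apply: le_trans (V_bnd 0); apply: markE_ge0 => s.
by have /andP[h1 h2] := U_le s; exact: le_trans h2.
Qed.

Let U_bnd n : E n U s0 <= C.
Proof. by apply: le_trans (V_bnd n); apply: markE_le => s; case/andP: (U_le s). Qed.

Lemma mart_sqr s : T (fun s' => M s' ^+ 2) s = M s ^+ 2 + Q s.
Proof.
rewrite /markov_op /Q.
have -> : M s ^+ 2 = \sum_y p s y * M s ^+ 2 by rewrite -mulr_suml p_sum mul1r.
rewrite -big_split /=.
have E0 : \sum_y (2 * M s) * (p s y * (M (mv s y) - M s)) = 0.
  by rewrite -mulr_sumr M_mart mulr0.
by rewrite -[RHS]addr0 -[X in _ + X]E0 -big_split; apply: eq_bigr => y _ /=; ring.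
Qed.

Lemma mart_var n s : E n (fun s' => (M s' - M s) ^+ 2) s = \sum_(k < n) E k Q s.
Proof.
have h1 k : E k.+1 (fun s' => M s' ^+ 2) s = E k (fun s' => M s' ^+ 2) s + E k Q s.
  by rewrite markES -markE_D; apply: markE_eq => s'; exact: mart_sqr.
have h2 k : E k M s = M s.
  elim: k => // k IH; rewrite markES -[RHS]IH; apply: markE_eq => s'.
  have := M_mart s'; under eq_bigr do rewrite mulrBr.
  by rewrite sumrB -mulr_suml p_sum mul1r => /eqP; rewrite subr_eq0 => /eqP.
have h3 k : E k (fun s' => M s' ^+ 2) s = M s ^+ 2 + \sum_(j < k) E j Q s.
  elim: k => [|k IH]; first by rewrite big_ord0 addr0.
  by rewrite h1 IH big_ord_recr addrA.
rewrite (_ : E n _ s = E n (fun s' => 1 * M s' ^+ 2 + (- (2 * M s)) * M s') s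
   + M s ^+ 2); last first.
  rewrite -[X in _ + X](markE_cst n _ s) -markE_D.
  by apply: markE_eq => s'; ring.
by rewrite markE_lin h2 h3; ring.
Qed.

Lemma mart_var_le n : E n (fun s' => (M s' - M s0) ^+ 2) s0 <= n%:R * C.
Proof.
rewrite mart_var -[n in n%:R]card_ord mulr_natl -sumr_const; apply: ler_sum => k _.
by apply: le_trans (U_bnd k); exact: markE_le.
Qed.

(** First moments are reduced to variances by |x| <= 1 + x^2. *)
Let var_bnd k m : E k (fun s => E m (fun s' => `|M s' - M s|) s) s0 <= 1 + m%:R * C.
Proof.
apply: (@le_trans _ _ (E k (fun s => 1 + \sum_(j < m) E j Q s) s0)).
  apply: markE_le => s; rewrite -mart_var -[1](markE_cst m 1 s) -markE_D.
  apply: markE_le => s'; rewrite -[(_ - _) ^+ 2]real_normK ?num_real // expr2.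
  have := normr_ge0 (M s' - M s); nra.
rewrite markE_D markE_cst lerD2l markE_sum.
rewrite -[m in m%:R]card_ord mulr_natl -sumr_const; apply: ler_sum => j _.
rewrite -markE_comp; apply: le_trans (U_bnd (k + j)); exact: markE_le.
Qed.

Section FixedScale.
Variables (h a : R).
Hypothesis h_ge0 : 0 <= h.
Let f s := cos (h * M s + a).

Let f_le1 s : `|f s| <= 1. Proof. exact: cos_max. Qed.

(** The linear Taylor term averages to 0 by [M_mart]. The remainder is cubic in the increment where
    U <= B, which gains a factor h, and quadratic where U > B, which is small by uniform
    integrability. *)
Let f_step B s : 0 <= B ->
  `|T f s - f s + h ^+ 2 / 2 * (f s * Q s)| <=
  3 * h ^+ 2 * (h * (1 + B) * U s + (if B < U s then U s else 0)).
Proof.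
move=> B0.
pose r y := cos (h * M s + a + h * (M (mv s y) - M s)) - cos (h * M s + a) +
  h * (M (mv s y) - M s) * sin (h * M s + a) +
  (h * (M (mv s y) - M s)) ^+ 2 / 2 * cos (h * M s + a).
have -> : T f s - f s + h ^+ 2 / 2 * (f s * Q s) = \sum_y p s y * r y.
  transitivity (\sum_y (p s y * f (mv s y) - p s y * f s
      + h * sin (h * M s + a) * (p s y * (M (mv s y) - M s))
      + h ^+ 2 / 2 * f s * (p s y * (M (mv s y) - M s) ^+ 2))).
    rewrite !big_split sumrN /= -!mulr_sumr -mulr_suml p_sum mul1r M_mart.
    by rewrite mulr0 addr0 /markov_op /Q mulrA.
  apply: eq_bigr => y _; rewrite /r /f.
  have -> : h * M s + a + h * (M (mv s y) - M s) = h * M (mv s y) + a by ring.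
  by field.
have u0 := U_le s.
apply: (le_trans (ler_norm_sum _ _ _)).
rewrite -[leRHS]mul1r -[X in _ <= X * _](p_sum s) mulr_suml; apply: ler_sum => y _.
rewrite normrM (ger0_norm (p_ge0 s y)).
have := p_ge0 s y; rewrite le_eqVlt => /orP[/eqP <-|py]; first by rewrite !mul0r.
rewrite ler_pM2l //.
have [r1 r2] := cos_taylor2 (h * M s + a) (h * (M (mv s y) - M s)).
have := M_inc py; set D := M (mv s y) - M s in r1 r2 * => DU.
have [h1 _] := andP u0.
case: ltP => BU.
  apply: (le_trans r2); rewrite exprMn.
  have := ler_wpM2l (sqr_ge0 h) DU.
  have : 0 <= h ^+ 2 * (h * (1 + B) * U s).
    by rewrite !mulr_ge0 ?sqr_ge0 //; lra.
  lra.
apply: (le_trans r1); rewrite addr0 normrM exprMn (ger0_norm h_ge0).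
have Dn : `|D| <= 1 + B.
  have : `|D| ^+ 2 <= B by rewrite real_normK ?num_real //; lra.
  by rewrite expr2; have := normr_ge0 D; nra.
have D3 : `|D| ^+ 3 <= (1 + B) * U s.
  rewrite (exprS _ 2); apply: ler_pM => //.
  by rewrite real_normK ?num_real.
have h3 : 0 <= h ^+ 3 by rewrite exprn_ge0.
have D30 : 0 <= `|D| ^+ 3 by rewrite exprn_ge0.
have -> : 3 * h ^+ 2 * (h * (1 + B) * U s) = 3 * (h ^+ 3 * ((1 + B) * U s)) by ring.
have := ler_wpM2l h3 D3.
have := mulr_ge0 h3 D30.
lra.
Qed.

(** Freeze f at time k: over the next m steps Q then averages to v up to eps V. Freezing costs at
    most 2 h |M s' - M s|, hence the factor h, except where U exceeds B. *)
Let f_corr B m eps k : 0 <= B -> (forall s, `|E m Q s - v| <= eps * V s) ->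
  `|E (k + m) (fun s => f s * (Q s - v)) s0| <=
  2 * h * (B + `|v|) * (1 + m%:R * C) +
  2 * E (k + m) (fun s => if B < U s then U s else 0) s0 + `|eps| * C.
Proof.
move=> B0 mix; rewrite markE_comp.
pose UB s := if B < U s then U s else 0.
pose a1 s := E m (fun s' => `|M s' - M s|) s.
have step s : `|E m (fun s => f s * (Q s - v)) s| <=
    2 * h * (B + `|v|) * a1 s + (2 * E m UB s + `|eps| * V s).
  have -> : E m (fun s => f s * (Q s - v)) s =
     E m (fun s' => (f s' - f s) * (Q s' - v)) s + f s * (E m Q s - v).
    rewrite -[X in f s * (_ - X)](markE_cst m v s) -markE_B -markE_Z -markE_D.
    by apply: markE_eq => s'; ring.
  apply: (le_trans (ler_normD _ _)); rewrite addrA; apply: lerD; last first.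
    rewrite normrM; have := ler_piMl (normr_ge0 (E m Q s - v)) (f_le1 s).
    move=> /le_trans; apply; apply: (le_trans (mix s)).
    rewrite ler_wpM2r ?ler_norm //.
    by have /andP[h1 h2] := U_le s; exact: le_trans h2.
  rewrite -markE_lin; apply: markE_norm_le => s'; rewrite normrM /UB.
  have fl : `|f s' - f s| <= 2 * (h * `|M s' - M s|).
    rewrite /f.
    have -> : h * M s' + a = (h * M s + a) + h * (M s' - M s) by ring.
    by apply: (le_trans (cos_lip _ _)); rewrite normrM (ger0_norm h_ge0).
  have fl2 : `|f s' - f s| <= 2.
    by apply: (le_trans (ler_normB _ _)); have := f_le1 s; have := f_le1 s'; lra.
  have Qv : `|Q s' - v| <= U s' + `|v|.
    apply: (le_trans (ler_normB _ _)); rewrite ger0_norm // lerD2r; exact: Q_le.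
  have x0 := normr_ge0 (f s' - f s); have v0 := normr_ge0 v.
  have q0 := normr_ge0 (Q s' - v).
  have /andP[u0 _] := U_le s'.
  have hm0 : 0 <= h * `|M s' - M s| by rewrite mulr_ge0.
  rewrite -[2 * h * _]mulrA [h * (B + _)]mulrC -!mulrA.
  set X := `|f s' - f s| in fl fl2 x0 *; set Y := `|Q s' - v| in Qv q0 *.
  set Z := h * `|M s' - M s| in fl hm0 *; set W := `|v| in Qv v0 *.
  apply: (@le_trans _ _ (X * (U s' + W))); first by rewrite ler_wpM2l.
  have XW : X * W <= 2 * Z * W by rewrite ler_wpM2r.
  have ZB : 0 <= Z * B by rewrite mulr_ge0.
  case: ltP => BU.
    have : X * U s' <= 2 * U s' by rewrite ler_wpM2r.
    lra.
  have : X * U s' <= X * B by rewrite ler_wpM2l.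
  have : X * B <= 2 * Z * B by rewrite ler_wpM2r.
  lra.
apply: (@le_trans _ _ (E k (fun s => 2 * h * (B + `|v|) * a1 s + (2 * E m UB s + `|eps| * V s)) s0)).
  exact: markE_norm_le.
have c0 : 0 <= 2 * h * (B + `|v|) by rewrite !mulr_ge0 // addr_ge0.
rewrite markE_D markE_Z markE_lin addrA -markE_comp; apply: lerD; last by rewrite ler_wpM2l.
by rewrite lerD2r ler_wpM2l //; exact: var_bnd.
Qed.

(** The last term pays for times n < m, which are too early for averaging over m steps. There are
    only m of them, so their total weight is of order h^2. *)
Lemma clt_step B m eps n : 0 <= B -> (forall s, `|E m Q s - v| <= eps * V s) ->
  `|E n.+1 f s0 - (1 - v * h ^+ 2 / 2) * E n f s0| <=
  h ^+ 2 * (h * (3 * (1 + B) * C + (B + `|v|) * (1 + m%:R * C))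
    + 4 * E n (fun s => if B < U s then U s else 0) s0 + `|eps| * C
    + (if (n < m)%N then C + `|v| else 0)).
Proof.
move=> B0 mix.
pose UB s := if B < U s then U s else 0.
have UB0 s : 0 <= UB s by rewrite /UB; case: ifP => // _; case/andP: (U_le s).
rewrite markES.
have -> : E n (T f) s0 - (1 - v * h ^+ 2 / 2) * E n f s0 =
   E n (fun s => T f s - f s + h ^+ 2 / 2 * (f s * Q s)) s0
   - h ^+ 2 / 2 * E n (fun s => f s * (Q s - v)) s0.
  rewrite -[X in _ - X = _]markE_Z -[X in _ = _ - X]markE_Z -!markE_B.
  by apply: markE_eq => s; field.
apply: (le_trans (ler_normB _ _)); rewrite normrM ger0_norm; last first.
  by rewrite divr_ge0 // sqr_ge0.
have H1 : `|E n (fun s => T f s - f s + h ^+ 2 / 2 * (f s * Q s)) s0| <=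
    3 * h ^+ 2 * (h * (1 + B) * C + E n UB s0).
  apply: (le_trans (markE_norm_le _ _ (fun s => f_step s B0))).
  rewrite markE_Z markE_D markE_Z ler_wpM2l ?mulr_ge0 ?sqr_ge0 //.
  by rewrite lerD2r ler_wpM2l // mulr_ge0 //; lra.
have H2 : `|E n (fun s => f s * (Q s - v)) s0| <=
   2 * h * (B + `|v|) * (1 + m%:R * C) + 2 * E n UB s0 + `|eps| * C
    + 2 * (if (n < m)%N then C + `|v| else 0).
  have P1 : 0 <= 2 * h * (B + `|v|) * (1 + m%:R * C).
    by rewrite !mulr_ge0 ?addr_ge0 ?mulr_ge0.
  have P2 : 0 <= E n UB s0 by exact: markE_ge0.
  have P3 : 0 <= `|eps| * C by rewrite mulr_ge0.
  case: ltnP => nm.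
    have : `|E n (fun s => f s * (Q s - v)) s0| <= C + `|v|.
      apply: (@le_trans _ _ (E n (fun s => U s + `|v|) s0)); last first.
        by rewrite markE_D markE_cst lerD2r.
      apply: markE_norm_le => s; rewrite normrM.
      have /le_trans := ler_piMl (normr_ge0 (Q s - v)) (f_le1 s); apply.
      apply: (le_trans (ler_normB _ _)); rewrite ger0_norm // lerD2r; exact: Q_le.
    have := normr_ge0 v; have := C_ge0; lra.
  by rewrite mulr0 addr0 -(subnK nm); exact: f_corr.
have h2 : 0 <= h ^+ 2 / 2 by rewrite divr_ge0 // sqr_ge0.
have := ler_wpM2l h2 H2; move: H1; rewrite -/UB.
set z := if _ then _ else _.
have : 0 <= h ^+ 2 * (`|eps| * C) by rewrite !mulr_ge0 ?sqr_ge0.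
lra.
Qed.

End FixedScale.

End CLT.

End MarkovOperator.

Section Limits.
Variable R : realType.

Lemma inv_sqrt_small (D eps : R) : 0 < eps -> exists K0, (0 < K0)%N /\
  forall K, (K0 <= K)%N -> D * (Num.sqrt K%:R)^-1 <= eps.
Proof.
move=> e0; exists (Num.truncn ((`|D| / eps) ^+ 2)).+1; split => // K hK.
have K0 : 0 < K%:R :> R by rewrite ltr0n; apply: leq_trans hK.
have s0 : 0 < Num.sqrt K%:R :> R by rewrite sqrtr_gt0.
rewrite ler_pdivrMr // mulrC -ler_pdivrMr //.
apply: (@le_trans _ _ (`|D| / eps)).
  by rewrite ler_pM2r ?invr_gt0 // ler_norm.
rewrite -(ger0_norm (_ : 0 <= `|D| / eps)); last by rewrite divr_ge0 // ltW.
rewrite -(sqrtr_sqr (`|D| / eps)) ler_sqrt ?(ltW K0) //.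
have := truncnS_gt ((`|D| / eps) ^+ 2) => h.
by apply: (le_trans (ltW h)); rewrite ler_nat.
Qed.

Lemma inv_small (D eps : R) : 0 < eps -> exists K0, (0 < K0)%N /\
  forall K, (K0 <= K)%N -> D / K%:R <= eps.
Proof.
move=> e0; exists (Num.truncn (`|D| / eps)).+1; split => // K hK.
have K0 : 0 < K%:R :> R by rewrite ltr0n; apply: leq_trans hK.
rewrite ler_pdivrMr // mulrC -ler_pdivrMr //.
apply: (@le_trans _ _ (`|D| / eps)).
  by rewrite ler_pM2r ?invr_gt0 // ler_norm.
have := truncnS_gt (`|D| / eps) => h.
by apply: (le_trans (ltW h)); rewrite ler_nat.
Qed.

Lemma cvg_epsP (u : nat -> R) (l : R) :
  (forall eps, 0 < eps -> exists N, forall n, (N <= n)%N -> `|u n - l| <= eps) <->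
  u n @[n --> \oo] --> l.
Proof.
split=> [H|H e e0].
  apply/cvgrPdist_le => e e0; have [N HN] := H e e0.
  by exists N => // n /= Nn; rewrite distrC HN.
move/cvgrPdist_le: H => /(_ e e0)[N _ HN]; exists N => n Nn.
by rewrite distrC; exact: HN.
Qed.

Lemma cauchy_eps (u : nat -> R) :
  (forall eps, 0 < eps -> exists N, forall m n, (N <= m)%N -> (N <= n)%N ->
     `|u m - u n| <= eps) ->
  exists c, forall eps, 0 < eps -> exists N, forall n, (N <= n)%N -> `|u n - c| <= eps.
Proof.
move=> H; suff /cvg_ex[l /cvg_epsP] : cvg (u n @[n --> \oo]) by move=> ?; exists l.
apply: cauchy_cvg; apply/cauchyP => /= e e0.
have [N HN] := H (e / 2) ltac:(lra).
exists (u N); exists N => // n /= Nn; rewrite /ball /= .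
by apply: (le_lt_trans (HN _ _ (leqnn N) Nn)); lra.
Qed.

Lemma le_of_forall_eps (x y c : R) :
  (forall eps, 0 < eps -> x <= y + eps * c) -> x <= y.
Proof.
move=> H; rewrite leNgt; apply/negP => yx.
have c0 : 0 < `|c| + 1 by have := normr_ge0 c; lra.
have h : 0 < (x - y) / 2 / (`|c| + 1) by rewrite !divr_gt0 //; lra.
have := H _ h; have : (x - y) / 2 / (`|c| + 1) * c <= (x - y) / 2.
  rewrite -mulrA ler_piMr //; first lra.
  by rewrite ler_pdivrMl // mulr1; have := ler_norm c; lra.
lra.
Qed.

Lemma affine_iter (rho : R) (a e : nat -> R) : 0 <= rho <= 1 ->
  (forall n, `|a n.+1 - rho * a n| <= e n) ->
  forall K, `|a K - rho ^+ K * a 0%N| <= \sum_(n < K) e n.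
Proof.
move=> /andP[r0 r1] H; elim=> [|K IH].
  by rewrite expr0 mul1r subrr normr0 big_ord0.
rewrite big_ord_recr /=.
have -> : a K.+1 - rho ^+ K.+1 * a 0%N =
   rho * (a K - rho ^+ K * a 0%N) + (a K.+1 - rho * a K) by rewrite exprS; ring.
apply: (le_trans (ler_normD _ _)); apply: lerD; last exact: H.
by rewrite normrM (ger0_norm r0); apply: le_trans IH; rewrite ler_piMl.
Qed.

End Limits.

Section MarkovLimitTheorems.
Variables (R : realType) (d : nat) (S : Type).
Variables (p : S -> 'I_d -> R) (mv : S -> 'I_d -> S).
Hypothesis p_ge0 : forall s y, 0 <= p s y.
Hypothesis p_sum : forall s, \sum_y p s y = 1.
Local Notation T := (markov_op p mv).
Local Notation E n := (iter n (markov_op p mv)).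

(* The factor cos(h M + a) is an approximate eigenvector of the averaging
   operator: one step multiplies its mean by 1 - v h^2/2 up to o(h^2), because
   the conditional variance Q may be replaced by its limit v after m steps. *)
Lemma markov_clt (M U V : S -> R) (s0 : S) (v C : R)
    (Q := fun s => \sum_y p s y * (M (mv s y) - M s) ^+ 2) :
  (forall s, \sum_y p s y * (M (mv s y) - M s) = 0) ->
  (forall s y, 0 < p s y -> (M (mv s y) - M s) ^+ 2 <= U s) ->
  (forall s, 0 <= U s <= V s) ->
  (forall n, E n V s0 <= C) ->
  (forall eps, 0 < eps -> exists m, forall s, `|E m Q s - v| <= eps * V s) ->
  (forall eta, 0 < eta ->
    exists B, 0 <= B /\ forall n, E n (fun s => if B < U s then U s else 0) s0 <= eta) ->
  0 <= v -> M s0 = 0 ->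
  forall a, E K (fun s => cos ((Num.sqrt K%:R)^-1 * M s + a)) s0 @[K --> \oo]
    --> expR (- (v / 2)) * cos a.
Proof.
move=> Mm Mi UV VC Qm Uui v0 M0 a; apply/cvg_epsP => tau tau0.
have C0 : 0 <= C.
  apply: le_trans (VC 0%N); apply: (markE_ge0 mv p_ge0 p_sum) => s.
  by have /andP[h1 h2] := UV s; exact: le_trans h2.
(* Error budget: 4 * (tau / 16) from truncation and tau / 4 from mixing, each summed over K steps of
   weight h^2 = 1/K, and tau / 4 from the terms of order h collected in [c1] and [c2]. *)
have [B [B0 HB]] := Uui (tau / 16) ltac:(lra).
have eps0 : 0 < tau / (4 * (C + 1)) by rewrite divr_gt0 //; lra.
have [m Hm] := Qm _ eps0.
set eps := tau / (4 * (C + 1)) in eps0 Hm.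
have epsC : `|eps| * C <= tau / 4.
  rewrite gtr0_norm // /eps mulrAC ler_pdivrMr; nra.
pose c1 := 3 * (1 + B) * C + (B + `|v|) * (1 + m%:R * C).
pose c2 := m%:R * (C + `|v|) + (v / 2) ^+ 2.
have [K0 [K0pos HK0]] := inv_sqrt_small (c1 + c2) (ltac:(lra) : 0 < tau / 4).
exists K0 => K hK; have {HK0} := HK0 K hK.
have Kpos : (0 < K)%N by exact: leq_trans hK.
have KR : 0 < K%:R :> R by rewrite ltr0n.
set h := (Num.sqrt K%:R)^-1.
have h0 : 0 < h by rewrite invr_gt0 sqrtr_gt0.
have h2 : h ^+ 2 = K%:R^-1 by rewrite /h exprVn sqr_sqrtr // ltW.
have h1 : h <= 1 by rewrite /h invf_le1 ?sqrtr_gt0 // -[leLHS]sqrtr1 ler_wsqrtr // ler1n.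
have Kh : K%:R * h ^+ 2 = 1 by rewrite h2 divff // gt_eqF.
move=> hc; pose f s := cos (h * M s + a).
(* The exponential replaces 1 - v h^2 / 2 at a cost of order h^4 per step: it lies in [0, 1] for
   every K and its K-th power is exactly the limit. *)
pose rho := expR (- (v * h ^+ 2 / 2)).
have x0 : 0 <= v * h ^+ 2 / 2 by rewrite divr_ge0 // mulr_ge0 // sqr_ge0.
have rhoK : rho ^+ K = expR (- (v / 2)).
  rewrite /rho -expRM_natl; congr expR.
  by transitivity (- (K%:R * h ^+ 2 * (v / 2))); [field|rewrite Kh mul1r].
have f1 n : `|E n f s0| <= 1.
  rewrite -[leRHS](markE_cst mv p_sum n 1 s0); apply: (markE_norm_le mv p_ge0) => s.
  exact: cos_max.
have step n : `|E n.+1 f s0 - rho * E n f s0| <=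
    h ^+ 2 * (h * c1 + tau / 2) + h ^+ 2 * (if (n < m)%N then C + `|v| else 0)
     + (v * h ^+ 2 / 2) ^+ 2.
  have := @clt_step R d S p mv p_ge0 p_sum M U V s0 v C Mm Mi UV VC h a (ltW h0) B m eps n B0 Hm.
  rewrite -/f -/c1 => H.
  have -> : E n.+1 f s0 - rho * E n f s0 =
     (E n.+1 f s0 - (1 - v * h ^+ 2 / 2) * E n f s0)
     - (rho - (1 - v * h ^+ 2 / 2)) * E n f s0 by ring.
  apply: (le_trans (ler_normB _ _)); apply: lerD.
    apply: (le_trans H); rewrite -mulrDr ler_wpM2l ?sqr_ge0 // lerD2r.
    have := HB n; move: epsC; rewrite -!addrA lerD2l; lra.
  rewrite normrM; apply: (@le_trans _ _ (`|rho - (1 - v * h ^+ 2 / 2)|)).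
    by rewrite ler_piMr.
  exact: expR_neg_taylor.
have rho01 : 0 <= rho <= 1.
  by rewrite expR_ge0 /= -expR0 ler_expR; lra.
have := affine_iter rho01 step K; rewrite /= rhoK {2}/f M0 mulr0 add0r => /le_trans; apply.
rewrite !big_split /= !sumr_const card_ord -mulr_sumr.
have S1 : \sum_(i < K) (if (i < m)%N then C + `|v| else 0) <= m%:R * (C + `|v|).
  have Cv : 0 <= C + `|v| by rewrite addr_ge0.
  rewrite -big_mkcond /= sumr_const -[_ *+ #|_|]mulr_natl ler_wpM2r // ler_nat.
  rewrite cardE -(size_map (fun i : 'I_K => i : nat)) -[leqRHS](size_iota 0).
  apply: uniq_leq_size; first by rewrite map_inj_uniq ?enum_uniq //; exact: val_inj.
  move=> x /mapP[y]; rewrite mem_enum => ym ->; by rewrite mem_iota add0n.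
rewrite -[X in X + _ + _]mulr_natl mulrA Kh mul1r.
have -> : (v * h ^+ 2 / 2) ^+ 2 *+ K = h ^+ 2 * (v / 2) ^+ 2.
  rewrite -mulr_natl; transitivity (K%:R * h ^+ 2 * (h ^+ 2 * (v / 2) ^+ 2)); first by field.
  by rewrite Kh mul1r.
have hh : h ^+ 2 <= h by rewrite expr2 ler_piMl // ltW.
have c20 : 0 <= c2 by rewrite addr_ge0 ?sqr_ge0 // mulr_ge0 // addr_ge0.
have := ler_wpM2l (sqr_ge0 h) S1; have := ler_wpM2r c20 hh.
move: hc; rewrite /c2; lra.
Qed.

(** Second-moment method for W n = N - n g. Each step adds a cross term E (W n (G - g)) and at most
    c^2. In the cross term W is frozen m steps back, where G - g averages to eps V, while |W| <= n c
    holds surely; so E (W K)^2 is O(K) + eps O(K^2). *)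
Lemma markov_lln (N V : S -> R) (s0 : S) (g C : R)
    (G := fun s => \sum_y p s y * (N (mv s y) - N s)) :
  (forall s y, 0 < p s y -> `|N (mv s y) - N s| <= 1) ->
  (forall s, 0 <= V s) ->
  (forall n, E n V s0 <= C) ->
  (forall eps, 0 < eps -> exists m, forall s, `|E m G s - g| <= eps * V s) ->
  N s0 = 0 ->
  E K (fun s => (N s / K%:R - g) ^+ 2) s0 @[K --> \oo] --> 0.
Proof.
move=> Ni V0 VC Gm N0; apply/cvg_epsP => tau tau0.
have C0 : 0 <= C.
  by apply: le_trans (VC 0%N); apply: (markE_ge0 mv p_ge0 p_sum).
pose c := 1 + `|g|.
have c1 : 1 <= c by rewrite /c lerDl.
have G1 s : `|G s| <= 1.
  apply: (le_trans (ler_norm_sum _ _ _)); rewrite -[leRHS](p_sum s); apply: ler_sum => y _.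
  rewrite normrM (ger0_norm (p_ge0 s y)).
  have := p_ge0 s y; rewrite le_eqVlt => /orP[/eqP <-|py]; first by rewrite !mul0r.
  by rewrite ler_piMr ?Ni // ltW.
have Gc s : `|G s - g| <= c.
  by apply: (le_trans (ler_normB _ _)); rewrite /c lerD2r.
have eps0 : 0 < tau / (4 * (c * C + 1)).
  by rewrite divr_gt0 // mulr_gt0 // ltr_pwDr // mulr_ge0 //; lra.
have [m Hm] := Gm _ eps0.
set eps := tau / (4 * (c * C + 1)) in eps0 Hm.
have e0' : 0 <= eps by exact: ltW.
have c0 : 0 <= c by lra.
have epsC : eps * c * C <= tau / 4.
  have cC : 0 <= c * C by rewrite mulr_ge0 //; lra.
  rewrite /eps -mulrA mulrAC ler_pdivrMr; last nra.
  nra.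
pose W (k : nat) s := N s - k%:R * g.
have Wb k s : `|N s - N s0| <= k%:R -> `|W k s| <= k%:R * c.
  rewrite N0 subr0 /W => h; apply: (le_trans (ler_normB _ _)).
  by rewrite normrM normr_nat /c; lra.
have corr n : `|E n (fun s => W n s * (G s - g)) s0| <=
    m%:R * c ^+ 2 + n%:R * (eps * c * C).
  have [nm|nm] := ltnP n m.
    apply: (@le_trans _ _ (n%:R * c * c)).
      apply: (le_trans (markE_norm mv p_ge0 _ _ _)).
      rewrite -[leRHS](markE_cst mv p_sum n _ s0).
      apply: (markE_le_reach p_ge0 Ni) => s hs; rewrite normrM.
      by apply: ler_pM => //; exact: Wb.
    apply: (@le_trans _ _ (m%:R * c ^+ 2)).
      by rewrite expr2 -mulrA ler_wpM2r ?ler_nat ?(ltnW nm) // mulr_ge0.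
    by rewrite lerDl; repeat apply: mulr_ge0 => //.
  rewrite -{1}(subnK nm) markE_comp.
  set k := (n - m)%N.
  have kn : n = (k + m)%N by rewrite /k subnK.
  apply: (@le_trans _ _ (E k (fun s => m%:R * c ^+ 2 + n%:R * c * eps * V s) s0)); last first.
    rewrite markE_D ?(markE_cst mv p_sum) ?markE_Z lerD2l.
    apply: (@le_trans _ _ (n%:R * c * eps * C)); last by lra.
    by rewrite ler_wpM2l //; repeat apply: mulr_ge0 => //.
  apply: (le_trans (markE_norm mv p_ge0 _ _ _)).
  apply: (markE_le_reach p_ge0 Ni) => s hs.
  have -> : E m (fun s => W n s * (G s - g)) s =
    E m (fun s' => (W n s' - W k s) * (G s' - g)) s + W k s * (E m G s - g).
    rewrite -[X in W k s * (_ - X)](markE_cst mv p_sum m g s).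
    rewrite -markE_B -markE_Z -markE_D.
    by apply: markE_eq => s'; ring.
  apply: (le_trans (ler_normD _ _)); apply: lerD.
    apply: (le_trans (markE_norm mv p_ge0 _ _ _)).
    rewrite -[leRHS](markE_cst mv p_sum m _ s).
    apply: (markE_le_reach p_ge0 Ni) => s' hs'; rewrite normrM expr2 mulrA.
    apply: ler_pM => //.
    have -> : W n s' - W k s = (N s' - N s) - m%:R * g.
      by rewrite /W kn natrD; ring.
    apply: (le_trans (ler_normB _ _)).
    by rewrite normrM normr_nat /c; lra.
  rewrite normrM -mulrA; apply: ler_pM => //.
  apply: (le_trans (Wb _ _ hs)); by rewrite ler_wpM2r // ler_nat kn leq_addr.
have grow n : E n.+1 (fun s => W n.+1 s ^+ 2) s0 <= E n (fun s => W n s ^+ 2) s0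
    + 2 * (m%:R * c ^+ 2 + n%:R * (eps * c * C)) + c ^+ 2.
  rewrite markES.
  apply: (@le_trans _ _ (E n (fun s => W n s ^+ 2 + (2 * (W n s * (G s - g)) + c ^+ 2)) s0)).
    apply: (markE_le mv p_ge0) => s.
    have -> : W n s ^+ 2 + (2 * (W n s * (G s - g)) + c ^+ 2) =
       \sum_y p s y * (W n s ^+ 2 + 2 * W n s * (N (mv s y) - N s - g) + c ^+ 2).
      transitivity (\sum_y (p s y * (W n s ^+ 2 - 2 * W n s * g + c ^+ 2)
          + 2 * W n s * (p s y * (N (mv s y) - N s)))); last first.
        by apply: eq_bigr => y _; ring.
      by rewrite big_split /= -mulr_suml p_sum -mulr_sumr -/(G s); ring.
    rewrite /markov_op; apply: ler_sum => y _.
    have := p_ge0 s y; rewrite le_eqVlt => /orP[/eqP <-|py]; first by rewrite !mul0r.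
    rewrite ler_pM2l //.
    have -> : W n.+1 (mv s y) = W n s + (N (mv s y) - N s - g).
      by rewrite /W -natr1; ring.
    set D := N (mv s y) - N s - g.
    have Dc : `|D| <= c.
      by apply: (le_trans (ler_normB _ _)); rewrite /c lerD2r Ni.
    have : D ^+ 2 <= c ^+ 2.
      rewrite -real_normK ?num_real // lerXn2r ?nnegrE //; lra.
    move=> D2; rewrite (sqrrD (W n s) D); lra.
  rewrite markE_D -addrA lerD2l markE_D markE_Z (markE_cst mv p_sum).
  by rewrite lerD2r ler_wpM2l //; apply: le_trans (corr n); exact: ler_norm.
pose c2 := 2 * (m%:R * c ^+ 2) + c ^+ 2.
have tot n : E n (fun s => W n s ^+ 2) s0 <= n%:R * c2 + n%:R ^+ 2 * (2 * (eps * c * C)).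
  elim: n => [|n IH]; first by rewrite /= /W N0; lra.
  apply: (le_trans (grow n)).
  have e0 : 0 <= eps * c * C by repeat apply: mulr_ge0 => //.
  have n0 : 0 <= n%:R * (eps * c * C) by rewrite mulr_ge0.
  rewrite -natr1 /c2 in IH *.
  lra.
have [K0 [K0pos HK0]] := inv_small c2 (ltac:(lra) : 0 < tau / 4).
exists K0 => K hK; have := HK0 K hK.
have KR : 0 < K%:R :> R by rewrite ltr0n; exact: leq_trans hK.
rewrite subr0 ger0_norm; last by apply: (markE_ge0 mv p_ge0 p_sum) => s; exact: sqr_ge0.
have -> : E K (fun s => (N s / K%:R - g) ^+ 2) s0 =
   (K%:R ^+ 2)^-1 * E K (fun s => W K s ^+ 2) s0.
  rewrite -markE_Z; apply: markE_eq => s; rewrite /W.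
  by field; rewrite gt_eqF.
rewrite ler_pdivrMl ?exprn_gt0 // ler_pdivrMr // => h.
apply: (le_trans (tot K)).
have := ler_wpM2l (ltW KR) h.
have := ler_wpM2l (sqr_ge0 (K%:R : R)) epsC.
have := mulr_ge0 (sqr_ge0 (K%:R : R)) (ltW tau0).
rewrite !expr2; lra.
Qed.

End MarkovLimitTheorems.

(** * Chains with regeneration *)

Section PowerConvergence.
Variables (R : realType) (d : nat) (P : 'M[R]_d).
Hypothesis Pst : stochastic P.

Let app n (f : 'I_d -> R) x := \sum_y (P ^+ n) x y * f y.

Lemma stoch_app_contract (f : 'I_d -> R) (o dl : R) n :
  (forall x y, dl <= (P ^+ n) x y) -> 0 <= dl ->
  (forall x x', f x - f x' <= o) ->
  forall x x', app n f x - app n f x' <= (1 - dl) * o.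
Proof.
move=> Pdl dl0 fo x x'.
pose ym := [arg max_(y > x) f y]%O; pose yn := [arg min_(y < x) f y]%O.
have hm y : f y <= f ym by rewrite /ym; case: arg_maxP => // z _ /(_ y isT).
have hn y : f yn <= f y by rewrite /yn; case: arg_minP => // z _ /(_ y isT).
(* both rows dominate dl at the state x, and that part cancels *)
have up z (h : 'I_d -> R) b : (forall y, h y <= b) -> app n h z - dl * h x <= (1 - dl) * b.
  move=> hb; rewrite /app (bigD1 x) //= addrAC -mulrBl.
  have -> : (1 - dl) * b = ((P ^+ n) z x - dl) * b + \sum_(y | y != x) (P ^+ n) z y * b.
    have := stoch_pow_sum Pst n z; rewrite (bigD1 x) //= -mulr_suml => e.
    have -> : \sum_(i | i != x) (P ^+ n) z i = 1 - (P ^+ n) z x by lra.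
    ring.
  apply: lerD; first by rewrite ler_wpM2l // subr_ge0.
  by apply: ler_sum => y _; rewrite ler_wpM2l // stoch_pow_ge0.
have lo := up x' (fun y => - f y) (- f yn) (fun y => ltac:(by rewrite lerN2)).
have appN : app n (fun y => - f y) x' = - app n f x'.
  by rewrite /app -sumrN; apply: eq_bigr => y _; rewrite mulrN.
have dl1 : dl <= 1 by exact: le_trans (Pdl x x) (stoch_pow_le1 Pst n x x).
have d1 : 0 <= 1 - dl by lra.
by move: lo; have := up x f _ hm; have := ler_wpM2l d1 (fo ym yn); rewrite mulrBr appN; lra.
Qed.

(** Every N steps the oscillation of a column shrinks by the factor 1 - dl (Doeblin). A row of P^(m
    + n) is an average of rows of P^n, so small oscillation makes the powers a Cauchy sequence with
    a limit independent of the row. *)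
Lemma stoch_pow_cvg : (exists N, forall n, (N <= n)%N -> forall i j, 0 < (P ^+ n) i j) ->
  exists pi : 'I_d -> R, forall eps, 0 < eps -> exists N, forall n, (N <= n)%N ->
    forall x y, `|(P ^+ n) x y - pi y| <= eps.
Proof.
move=> [N HN].
have [x0 _|d0] := pickP (@predT 'I_d); last first.
  by exists (fun=> 0) => eps _; exists 0%N => n _ x; have := d0 x.
pose dl := \big[Num.min/1]_x \big[Num.min/1]_y (P ^+ N) x y.
have dl0 : 0 < dl.
  rewrite /dl; apply/bigmin_gtP; split => // x _; apply/bigmin_gtP; split => // y _.
  exact: HN.
have dlP x y : dl <= (P ^+ N) x y.
  apply: (@le_trans _ _ (\big[Num.min/1]_y (P ^+ N) x y)); last exact: bigmin_le.
  exact: (bigmin_le _ x).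
have dl1 : dl <= 1 by exact: bigmin_le_id.
have osc j n : (j * N <= n)%N -> forall y x x', (P ^+ n) x y - (P ^+ n) x' y <= (1 - dl) ^+ j.
  elim: j n => [|j IH] n jn y x x'.
    by rewrite expr0; have := stoch_pow_le1 Pst n x y; have := stoch_pow_ge0 Pst n x' y; lra.
  have nN : n = (N + (n - N))%N by rewrite subnKC //; lia.
  have pE z : (P ^+ n) z y = app N (fun z => (P ^+ (n - N)) z y) z.
    by rewrite {1}nN exprD -mulmxE mxE.
  rewrite !pE exprS; apply: stoch_app_contract => //; first exact: ltW.
  by move=> z z'; apply: IH; lia.
have oscn eps : 0 < eps -> exists n0, forall n, (n0 <= n)%N ->
    forall m x x' y, `|(P ^+ (m + n)) x y - (P ^+ n) x' y| <= eps.
  move=> e0.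
  have : (fun j => (1 - dl) ^+ j) @ \oo --> (0 : R).
    by apply: cvg_expr; rewrite ger0_norm; lra.
  move/cvg_epsP => /(_ eps e0)[j Hj]; exists (j * N)%N => n jn m x x' y.
  have h z z' : (P ^+ n) z y - (P ^+ n) z' y <= eps.
    apply: (le_trans (osc j n jn y z z')); have := Hj j (leqnn j).
    by rewrite subr0 ger0_norm // exprn_ge0; lra.
  have E : (P ^+ (m + n)) x y = \sum_z (P ^+ m) x z * (P ^+ n) z y.
    by rewrite exprD -mulmxE mxE.
  have E1 : (P ^+ (m + n)) x y - (P ^+ n) x' y = \sum_z (P ^+ m) x z * ((P ^+ n) z y - (P ^+ n) x' y).
    rewrite E; under [RHS]eq_bigr do rewrite mulrBr.
    by rewrite sumrB -mulr_suml stoch_pow_sum ?mul1r.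
  rewrite E1; apply: (le_trans (ler_norm_sum _ _ _)).
  rewrite -[leRHS]mul1r -[X in _ <= X * _](stoch_pow_sum Pst m x) mulr_suml.
  apply: ler_sum => z _; rewrite normrM ger0_norm ?stoch_pow_ge0 //.
  rewrite ler_wpM2l ?stoch_pow_ge0 // ler_norml h andbT lerNl opprB.
  exact: h.
have H y : exists c, forall eps, 0 < eps -> exists n0, forall n, (n0 <= n)%N ->
    `|(P ^+ n) x0 y - c| <= eps.
  apply: cauchy_eps => eps e0; have [n0 Hn0] := oscn (eps / 2) ltac:(lra).
  exists n0 => m n hm hn.
  have := Hn0 n0 (leqnn _) (m - n0)%N x0 x0 y; rewrite subnK // => h1.
  have := Hn0 n0 (leqnn _) (n - n0)%N x0 x0 y; rewrite subnK // => h2.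
  have := ler_distD ((P ^+ n0) x0 y) ((P ^+ m) x0 y) ((P ^+ n) x0 y).
  by rewrite [`|(P ^+ n0) x0 y - _|]distrC; lra.
have [pi Hpi] := choice H.
exists pi => eps e0; have [n1 H1] := oscn (eps / 2) ltac:(lra).
exists n1 => n hn x y.
have [n2 H2] := Hpi y (eps / 2) ltac:(lra).
have := H1 n hn n2 x0 x y; have := H2 (n2 + n)%N (leq_addr _ _) => h2 h1.
have := ler_distD ((P ^+ (n2 + n)) x0 y) ((P ^+ n) x y) (pi y).
by rewrite [`|(P ^+ n) x y - (P ^+ _) _ _|]distrC; lra.
Qed.

End PowerConvergence.

Section RegenerativeChain.
Variables (R : realType) (d : nat) (P : 'M[R]_d) (r : 'I_d -> 'I_d -> R).
Variables (S : Type) (pos : S -> 'I_d) (L : S -> 'I_d -> 'I_d -> R).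
Variables (mv : S -> 'I_d -> S) (ref : 'I_d -> S).
Hypothesis Pst : stochastic P.
Hypothesis Pprim : exists N, forall n, (N <= n)%N -> forall i j, 0 < (P ^+ n) i j.
Hypothesis pos_mv : forall s y, pos (mv s y) = y.
Hypothesis pos_ref : forall x, pos (ref x) = x.
Hypothesis L_mv : forall s y i j, 0 < P (pos s) y ->
  L (mv s y) i j = if y == j then (i == j)%:R else
                   if L s i j == 0 then (i == y)%:R else L s i j * r (pos s) y.
Variables (w : 'I_d -> R) (q0 : R).
Hypothesis w_ge1 : forall x, 1 <= w x.
Hypothesis q0_01 : 0 <= q0 < 1.
Hypothesis w_drift : forall x, \sum_y P x y * (r x y ^+ 2 * w y) <= q0 * w x.
Hypothesis killed_drift : forall j, exists v q, (forall x : 'I_d, 1 <= v x) /\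
  0 <= q < 1 /\ forall x, \sum_(y | y != j) P x y * v y <= q * v x.

(* [L s] stands for the matrix Lambda after step (a) of the recursion: visiting j
   resets column j, and otherwise the nonzero entries are multiplied by [r]. *)
Definition chain_p (s : S) (y : 'I_d) : R := P (pos s) y.
Local Notation T := (markov_op chain_p mv).
Local Notation E n := (iter n (markov_op chain_p mv)).

(** The 1 makes [chain_V] dominate constants, so that one weight function controls second moments,
    bounded functions and mixing errors alike. *)
Definition chain_V (s : S) : R := 1 + \sum_i \sum_j L s i j ^+ 2.
Local Notation V := chain_V.

Lemma chain_p_ge0 s y : 0 <= chain_p s y. Proof. by case: Pst => + _; exact. Qed.
Lemma chain_p_sum s : \sum_y chain_p s y = 1. Proof. by case: Pst => _ ->. Qed.
Local Notation p0 := chain_p_ge0.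
Local Notation p1 := chain_p_sum.

Let V1 s : 1 <= V s.
Proof. by rewrite lerDl sumr_ge0 // => i _; rewrite sumr_ge0 // => j _; rewrite sqr_ge0. Qed.

Let V0 s : 0 <= V s. Proof. by apply: le_trans (V1 s). Qed.

Let D2 : R := 1 + (d * d)%:R.

Let V_mv s y : 0 < P (pos s) y -> V (mv s y) <= r (pos s) y ^+ 2 * V s + D2.
Proof.
move=> Py; rewrite /V /D2.
have h : \sum_i \sum_j L (mv s y) i j ^+ 2 <=
   r (pos s) y ^+ 2 * (\sum_i \sum_j L s i j ^+ 2) + (d * d)%:R.
  have -> : (d * d)%:R = \sum_(i < d) \sum_(j < d) (1 : R).
    by rewrite !sumr_const !card_ord mulrnA.
  rewrite mulr_sumr -big_split; apply: ler_sum => i _ /=.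
  rewrite mulr_sumr -big_split; apply: ler_sum => j _ /=.
  have rL : 0 <= r (pos s) y ^+ 2 * L s i j ^+ 2 by rewrite mulr_ge0 ?sqr_ge0.
  rewrite L_mv //; case: eqP => _; last case: eqP => _.
  - case: (i == j); rewrite ?expr1n ?expr0n /=; lra.
  - case: (i == y); rewrite ?expr1n ?expr0n /=; lra.
  - by rewrite exprMn mulrC; lra.
have : 0 <= r (pos s) y ^+ 2 by exact: sqr_ge0.
lra.
Qed.

Let W : R := 1 + \sum_x w x.
Let w_leW x : w x <= W.
Proof.
have := le_term_sum x (fun y => le_trans ler01 (w_ge1 y)); rewrite /W; lra.
Qed.
Let W0 : 0 <= W.
Proof. by rewrite addr_ge0 // sumr_ge0 // => y _; exact: le_trans (w_ge1 y). Qed.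

(** Stated for a set of targets because it is used for all transitions and for those avoiding j. Old
    weights are multiplied by r, and the entries set to 0 or 1 add at most [D2] to V. *)
Let drift_w (pr : pred 'I_d) s : \sum_(y | pr y) P (pos s) y * (V (mv s y) * w y)
  <= q0 * (V s * w (pos s)) + D2 * W * \sum_(y | pr y) P (pos s) y.
Proof.
apply: (@le_trans _ _ (\sum_(y | pr y) (V s * (P (pos s) y * (r (pos s) y ^+ 2 * w y))
    + D2 * W * P (pos s) y))).
  apply: ler_sum => y _.
  have := p0 s y; rewrite /chain_p le_eqVlt => /orP[/eqP <-|Py]; first by rewrite !mul0r !mulr0 addr0.
  have w0 : 0 <= w y by exact: le_trans (w_ge1 y).
  rewrite (_ : _ + _ = P (pos s) y * (r (pos s) y ^+ 2 * V s * w y + D2 * W)); last by ring.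
  rewrite ler_pM2l //; apply: (le_trans (ler_wpM2r w0 (V_mv Py))).
  rewrite mulrDl lerD2l ler_wpM2l // /D2; exact: addr_ge0.
rewrite big_split /= -!mulr_sumr lerD2r mulrCA ler_wpM2l //.
apply: le_trans (w_drift (pos s)); rewrite [leRHS](bigID pr) /= lerDl.
apply: sumr_ge0 => y _; rewrite mulr_ge0 ?p0 // mulr_ge0 ?sqr_ge0 //.
exact: le_trans (w_ge1 y).
Qed.

Lemma chain_V_bnd : exists C, 0 <= C /\ forall n s, E n V s <= C * V s.
Proof.
have [q00 q01] := andP q0_01.
exists (W + D2 * W / (1 - q0)).
have D20 : 0 <= D2 by rewrite /D2 addr_ge0.
have c0 : 0 <= D2 * W / (1 - q0) by rewrite divr_ge0 ?mulr_ge0 //; lra.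
split; first exact: addr_ge0.
have h n s : E n (fun s => V s * w (pos s)) s <= V s * w (pos s) + D2 * W / (1 - q0).
  elim: n => [|n IH]; first by rewrite lerDl.
  (* c is the fixed point of c -> q0 c + D2 W, the map produced by one drift step. *)
  set c := D2 * W / (1 - q0) in c0 IH *.
  have cE : q0 * c + D2 * W = c by rewrite /c; field; rewrite subr_eq0; apply/eqP; lra.
  rewrite markES; apply: (@le_trans _ _ (E n (fun s => q0 * (V s * w (pos s)) + D2 * W) s)).
    apply: (markE_le mv p0) => s'; have := drift_w predT s'.
    rewrite (_ : \sum_(y | predT y) P (pos s') y = 1) ?mulr1; last by case: Pst.
    apply: le_trans; rewrite le_eqVlt; apply/orP; left; apply/eqP.
    by apply: eq_bigr => y _; rewrite pos_mv.
  rewrite markE_D (markE_cst mv p1) markE_Z.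
  have := ler_wpM2l q00 IH.
  have vw : 0 <= V s * w (pos s) by rewrite mulr_ge0 //; exact: le_trans (w_ge1 _).
  have := ler_wpM2r vw (ltW q01); lra.
move=> n s; apply: (@le_trans _ _ (E n (fun s => V s * w (pos s)) s)).
  apply: (markE_le mv p0) => s'; rewrite ler_peMr //.
apply: (le_trans (h n s)); rewrite [leRHS]mulrDl; apply: lerD.
  by rewrite mulrC ler_wpM2r.
by rewrite ler_peMr.
Qed.

(* Killing at j: the quadratic functional and the survival functional v decay
   together after weighting the latter by a large constant. *)
Lemma killed_V (j : 'I_d) : exists (Vj : S -> R) (q : R), 0 <= q < 1 /\
  (exists C, 0 <= C /\ forall s, Vj s <= C * V s) /\ (forall s, V s <= Vj s) /\
  forall s, \sum_(y | y != j) P (pos s) y * Vj (mv s y) <= q * Vj s.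
Proof.
have [q00 q01] := andP q0_01.
have [v [q [v1 [/andP[qq0 qq1] vd]]]] := killed_drift j.
have D20 : 0 <= D2 by rewrite /D2 addr_ge0.
have DW0 : 0 <= D2 * W by rewrite mulr_ge0.
(* Half of the gap 1 - q, multiplied by B, pays for the source term D2 W of the drift. *)
pose B := 2 * (D2 * W) / (1 - q).
have B0 : 0 <= B by rewrite divr_ge0 ?mulr_ge0 //; lra.
have Bq : (D2 * W + B) * q <= B * ((1 + q) / 2).
  have BE : B * (1 - q) = 2 * (D2 * W) by rewrite /B divfK // subr_eq0; apply/eqP; lra.
  have : 0 <= D2 * W * (1 - q) by rewrite mulr_ge0 //; lra.
  lra.
pose q' := Num.max q0 ((1 + q) / 2).
exists (fun s => V s * w (pos s) + B * v (pos s)), q'.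
have q'0 : q0 <= q' by rewrite le_max lexx.
have q'1 : (1 + q) / 2 <= q' by rewrite le_max lexx orbT.
split; first by apply/andP; split; [exact: le_trans q'0|rewrite gt_max q01 /=; lra].
split.
  exists (W + B * (1 + \sum_x v x)).
  have sv x : v x <= 1 + \sum_x v x.
    by have := le_term_sum x (fun y => le_trans ler01 (v1 y)); lra.
  have sv0 : 0 <= 1 + \sum_x v x by rewrite addr_ge0 // sumr_ge0 // => y _; exact: le_trans (v1 y).
  split; first by rewrite addr_ge0 // mulr_ge0.
  move=> s; rewrite [leRHS]mulrDl; apply: lerD; first by rewrite mulrC ler_wpM2r.
  apply: (@le_trans _ _ (B * (1 + \sum_x v x))); first by rewrite ler_wpM2l.
  by rewrite ler_peMr // mulr_ge0.
split.
  move=> s; apply: (@le_trans _ _ (V s * w (pos s))); first by rewrite ler_peMr.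
  by rewrite lerDl mulr_ge0 //; exact: le_trans (v1 _).
move=> s; under eq_bigr do rewrite mulrDr pos_mv.
rewrite big_split /=.
have h1 := drift_w (fun y => y != j) s; rewrite /= in h1.
have h2 : \sum_(y | y != j) P (pos s) y <= \sum_(y | y != j) P (pos s) y * v y.
  by apply: ler_sum => y _; rewrite ler_peMr // p0.
have h3 := vd (pos s).
have -> : \sum_(i | i != j) P (pos s) i * (B * v i) = B * \sum_(i | i != j) P (pos s) i * v i.
  by rewrite mulr_sumr; apply: eq_bigr => y _; ring.
have vw : 0 <= V s * w (pos s) by rewrite mulr_ge0 //; exact: le_trans (w_ge1 _).
have v0 : 0 <= v (pos s) by exact: le_trans (v1 _).
have := ler_wpM2l DW0 h2; have DB : 0 <= D2 * W + B by rewrite addr_ge0.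
have := ler_wpM2l DB h3; have := ler_wpM2r v0 Bq.
have := ler_wpM2r vw q'0; have := ler_wpM2r (mulr_ge0 B0 v0) q'1.
lra.
Qed.

Lemma chain_pos_law m (f : 'I_d -> R) s :
  E m (fun s' => f (pos s')) s = \sum_y (P ^+ m) (pos s) y * f y.
Proof.
elim: m s => [|m IH] s.
  rewrite expr0 -[LHS](sum_indicator f); apply: eq_bigr => y _.
  by rewrite mxE [pos s == y]eq_sym.
rewrite /= /markov_op exprS -mulmxE.
under [RHS]eq_bigr do rewrite mxE mulr_suml.
rewrite exchange_big /=; apply: eq_bigr => z _.
by rewrite IH pos_mv mulr_sumr; apply: eq_bigr => y _; rewrite mulrA.
Qed.

(** Functions of the position and of L alone, the part of the state that can forget its past;
    accumulated counters and sums are excluded. *)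
Definition chain_local (G : S -> R) :=
  forall s s', pos s = pos s' -> L s =2 L s' -> G s = G s'.

(* Two copies of the chain driven by the same transitions from the same state
   agree on column j of L as soon as j has been visited. *)
Lemma chain_merge : exists q C, 0 <= q < 1 /\ 0 <= C /\
  forall G : S -> R, chain_local G -> (forall s, `|G s| <= V s) ->
  forall n s s', pos s = pos s' -> `|E n G s - E n G s'| <= C * q ^+ n * (V s + V s').
Proof.
have [Vj HVj] := choice killed_V.
have [qj Hqj] := choice HVj.
have H0 j := let: conj a _ := Hqj j in a.
have H1 j := let: conj _ (conj a _) := Hqj j in a.
have H2 j s := (let: conj _ (conj _ (conj a _)) := Hqj j in a) s.
have H3 j s := (let: conj _ (conj _ (conj _ a)) := Hqj j in a) s.
have [Cj HCj] := choice H1.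
pose q := \big[Num.max/0]_j qj j.
have q01 : 0 <= q < 1.
  rewrite bigmax_ge_id /=; apply/bigmax_ltP; split => // j _; by case/andP: (H0 j).
have qjq j : qj j <= q by exact: le_bigmax.
have Vj0 j s : 0 <= Vj j s by apply: le_trans (H2 j s).
exists q, (\sum_j Cj j); split => //; split.
  by apply: sumr_ge0 => j _; case: (HCj j).
move=> G Gloc GV.
pose df s s' j := [exists i, L s i j != L s' i j].
pose D j s s' := if df s s' j then Vj j s + Vj j s' else 0.
(* D j charges column j only while the two copies disagree on it. That persists only through a
   transition avoiding j, where the killed drift contracts [Vj] by q. *)
have key n s s' : pos s = pos s' -> `|E n G s - E n G s'| <= q ^+ n * \sum_j D j s s'.
  elim: n s s' => [|n IH] s s' ss'.
    rewrite expr0 mul1r /=.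
    have D0 j : 0 <= D j s s' by rewrite /D; case: ifP => // _; rewrite addr_ge0.
    have [j dj|nd] := pickP (df s s').
      rewrite (bigD1 j) //= [D j s s']ifT //; apply: (@le_trans _ _ (V s + V s')).
        by apply: (le_trans (ler_normB _ _)); exact: lerD.
      apply: (@le_trans _ _ (Vj j s + Vj j s')); first exact: lerD.
      by rewrite lerDl; apply: sumr_ge0 => k _; exact: D0.
    rewrite (Gloc s s') // ?subrr ?normr0 ?sumr_ge0 // => i j.
    have := nd j; rewrite /df => /existsPn/(_ i); by rewrite negbK => /eqP.
  rewrite /= /markov_op -sumrB.
  apply: (le_trans (ler_norm_sum _ _ _)).
  apply: (@le_trans _ _ (\sum_y P (pos s) y * (q ^+ n * \sum_j D j (mv s y) (mv s' y)))).
    apply: ler_sum => y _; rewrite /chain_p -ss' -mulrBr normrM ger0_norm; last exact: p0.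
    by rewrite ler_wpM2l ?p0 // IH // !pos_mv.
  rewrite exprSr -mulrA mulr_sumr.
  under eq_bigr do rewrite mulrCA.
  rewrite -mulr_sumr -mulr_sumr ler_wpM2l ?exprn_ge0 //; first by case/andP: q01.
  under eq_bigr do rewrite mulr_sumr.
  rewrite exchange_big /= mulr_sumr; apply: ler_sum => j _.
  rewrite {2}/D; case: ifPn => [dj|ndj]; last first.
    rewrite mulr0; apply: sumr_le0 => y _.
    have := p0 s y; rewrite /chain_p le_eqVlt => /orP[/eqP <-|Py]; first by rewrite mul0r.
    rewrite /D ifN ?mulr0 //; apply/existsPn => i; rewrite negbK.
    have Li : L s i j = L s' i j.
      by move: ndj => /existsPn/(_ i); rewrite negbK => /eqP.
    by rewrite !L_mv -?ss' // Li.
  apply: (@le_trans _ _ (\sum_(y | y != j) P (pos s) y * (Vj j (mv s y) + Vj j (mv s' y)))).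
    rewrite [leRHS]big_mkcond /=; apply: ler_sum => y _.
    have := p0 s y; rewrite /chain_p le_eqVlt => /orP[/eqP <-|Py].
      by rewrite !mul0r; case: ifP.
    case: eqP => [yj|_] /=.
      rewrite /D ifN ?mulr0 //; apply/existsPn => i; rewrite negbK.
      by rewrite !L_mv -?ss' // yj eqxx.
    rewrite ler_pM2l // /D; case: ifP => // _; exact: addr_ge0.
  under eq_bigr do rewrite mulrDr.
  rewrite big_split mulrDr; apply: lerD.
    by apply: (le_trans (H3 j s)); rewrite ler_wpM2r.
  by rewrite ss'; apply: (le_trans (H3 j s')); rewrite ler_wpM2r.
move=> n s s' ss'; apply: (le_trans (key n s s' ss')).
rewrite mulrC [X in _ <= X * _]mulrC -mulrA mulrC.
rewrite ler_wpM2l ?exprn_ge0 //; first by case/andP: q01.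
rewrite mulr_suml; apply: ler_sum => j _; rewrite /D.
have [C0 HC] := HCj j.
case: ifP => _; first by rewrite mulrDr lerD.
by rewrite mulr_ge0 // addr_ge0.
Qed.

(* Up to a geometric error in n, the last n steps only see the state they
   start from. *)
Lemma chain_forget : exists q C, 0 <= q < 1 /\ 0 <= C /\
  forall G : S -> R, chain_local G -> (forall s, `|G s| <= V s) ->
  forall m n s, `|E (m + n) G s - \sum_y (P ^+ m) (pos s) y * E n G (ref y)|
     <= C * q ^+ n * V s.
Proof.
have [q [C [q01 [C0 H]]]] := chain_merge.
have [C1 [C10 HV]] := chain_V_bnd.
pose C2 := \sum_x V (ref x).
have C2V x : V (ref x) <= C2.
  exact: (le_term_sum (F := fun x => V (ref x))).
have C20 : 0 <= C2 by rewrite sumr_ge0.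
exists q, (C * (C1 + C2)); split => //; split; first by rewrite mulr_ge0 // addr_ge0.
have q0' : 0 <= q by case/andP: q01.
move=> G Gl GV m n s.
rewrite -(chain_pos_law m (fun y => E n G (ref y))) markE_comp -markE_B.
apply: (@le_trans _ _ (E m (fun s' => C * q ^+ n * C2 + C * q ^+ n * V s') s)).
  apply: (markE_norm_le mv p0) => s'.
  apply: (le_trans (H G Gl GV n s' (ref (pos s')) (esym (pos_ref _)))).
  rewrite -mulrDr ler_wpM2l ?mulr_ge0 ?exprn_ge0 // addrC lerD2r; exact: C2V.
rewrite markE_D (markE_cst mv p1) markE_Z.
have Cq : 0 <= C * q ^+ n by rewrite mulr_ge0 ?exprn_ge0.
have := ler_wpM2l Cq (HV m s).
have : C * q ^+ n * C2 <= C * q ^+ n * C2 * V s.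
  by rewrite ler_peMr // mulr_ge0.
lra.
Qed.

(** By [chain_forget], E m G s is close to the sum of P^(m - n) (pos s) y * E n G (ref y), and P^(m
    - n) converges to a limit independent of the starting state. So E m G s is eventually near a
    number [c n] that depends neither on s nor on m. *)
Lemma chain_mix (G : S -> R) : chain_local G -> (forall s, `|G s| <= V s) ->
  exists c, forall eps, 0 < eps -> exists m0, forall m, (m0 <= m)%N ->
    forall s, `|E m G s - c| <= eps * V s.
Proof.
move=> Gl GV.
have [q [C [/andP[q0' q1'] [C0 H]]]] := chain_forget.
have {}H := H G Gl GV.
have [pi Hpi] := stoch_pow_cvg Pst Pprim.
have [C1 [C10 HV]] := chain_V_bnd.
pose C2 := \sum_x V (ref x).
have C20 : 0 <= C2 by rewrite sumr_ge0.
pose c n := \sum_y pi y * E n G (ref y).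
have key eps : 0 < eps -> exists n m0, forall m, (m0 <= m)%N -> forall s,
    `|E m G s - c n| <= eps * V s.
  move=> e0.
  have : (fun n => C * q ^+ n) @ \oo --> C * 0.
    by apply: cvgM; [exact: cvg_cst|apply: cvg_expr; rewrite ger0_norm].
  rewrite mulr0 => /cvg_epsP/(_ (eps / 2) ltac:(lra))[n Hn].
  have d0 : 0 < eps / (2 * (C1 * C2 + 1)).
    by rewrite divr_gt0 // mulr_gt0 // ltr_pwDr // mulr_ge0.
  have [m1 Hm1] := Hpi _ d0.
  exists n, (m1 + n)%N => m hm s.
  have mE : m = ((m - n) + n)%N by rewrite subnK //; lia.
  have hm1 : (m1 <= m - n)%N by lia.
  have h1 := H (m - n)%N n s; rewrite -mE in h1.
  have h2 : `|\sum_y (P ^+ (m - n)) (pos s) y * E n G (ref y) - c n| <= eps / 2.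
    rewrite /c -sumrB; apply: (le_trans (ler_norm_sum _ _ _)).
    apply: (@le_trans _ _ (\sum_y eps / (2 * (C1 * C2 + 1)) * (C1 * V (ref y)))).
      apply: ler_sum => y _; rewrite -mulrBl normrM; apply: ler_pM => //; first exact: Hm1.
      by apply: (le_trans (markE_norm_le mv p0 _ _ GV)).
    rewrite -!mulr_sumr -/C2 mulrAC ler_pdivrMr; last first.
      by rewrite mulr_gt0 // ltr_pwDr // mulr_ge0.
    have : 0 <= C1 * C2 by rewrite mulr_ge0.
    nra.
  have := ler_distD (\sum_y (P ^+ (m - n)) (pos s) y * E n G (ref y)) (E m G s) (c n).
  have := Hn n (leqnn _); rewrite subr0 ger0_norm ?mulr_ge0 ?exprn_ge0 // => h3.
  have := ler_wpM2r (V0 s) h3; have := V1 s.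
  have : eps / 2 <= eps / 2 * V s by rewrite ler_peMr //; lra.
  lra.
have [x0 _|d0] := pickP (@predT 'I_d); last first.
  by exists 0 => eps _; exists 0%N => m _ s; have := d0 (pos s).
(* The limit is identified along one reference state; every other state is compared with it through
   [c n]. *)
have [l Hl] : exists l, forall eps, 0 < eps -> exists N, forall n, (N <= n)%N ->
    `|E n G (ref x0) - l| <= eps.
  apply: cauchy_eps => eps e0.
  have V00 : 0 < V (ref x0) by apply: lt_le_trans (V1 _).
  have [n [m0 Hm]] := key (eps / 2 / V (ref x0)) ltac:(rewrite divr_gt0 //; lra).
  exists m0 => k k' hk hk'.
  have := Hm k hk (ref x0); have := Hm k' hk' (ref x0).
  rewrite divfK ?gt_eqF // => h1 h2.
  have := ler_distD (c n) (E k G (ref x0)) (E k' G (ref x0)).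
  rewrite [`|c n - _|]distrC; lra.
exists l => eps e0.
have V00 : 0 < V (ref x0) by apply: lt_le_trans (V1 _).
have [n [m0 Hm]] := key (eps / 3 / V (ref x0)) ltac:(rewrite divr_gt0 //; lra).
have e3 : eps / 3 / V (ref x0) <= eps / 3.
  by rewrite ler_pdivrMr // ler_peMr //; lra.
exists m0 => m hm s.
have [m2 Hm2] := Hl (eps / 3) ltac:(lra).
have h1 := Hm2 (maxn m0 m2) (leq_maxr _ _).
have h2 := Hm (maxn m0 m2) (leq_maxl _ _) (ref x0).
rewrite divfK ?gt_eqF // in h2.
have h3 := Hm m hm s.
have h4 := ler_wpM2r (V0 s) e3.
have := ler_distD (c n) (E m G s) l.
have := ler_distD (E (maxn m0 m2) G (ref x0)) (c n) l.
rewrite [`|c n - E _ _ _|]distrC.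
have : eps / 3 <= eps / 3 * V s by rewrite ler_peMr //; lra.
lra.
Qed.

(** One transition raises V from at most b to at most [stp b], so within N steps of a reference
    state V stays below a deterministic B and the truncated function vanishes. For n > N,
    [chain_forget] lets only the last N steps count, up to an error C q^N C2 <= eta. *)
Lemma chain_ui eta : 0 < eta -> exists B, 0 <= B /\
  forall n x, E n (fun s => if B < V s then V s else 0) (ref x) <= eta.
Proof.
move=> eta0.
have [q [C [/andP[q0' q1'] [C0 H]]]] := chain_forget.
pose C2 := \sum_x V (ref x).
have C2V x : V (ref x) <= C2 by exact: (le_term_sum (F := fun x => V (ref x))).
have C20 : 0 <= C2 by rewrite sumr_ge0.
pose rho := 1 + \sum_(xy : 'I_d * 'I_d) r xy.1 xy.2 ^+ 2.
have rho1 : 1 <= rho by rewrite lerDl sumr_ge0 // => xy _; rewrite sqr_ge0.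
have rrho x y : r x y ^+ 2 <= rho.
  have := le_term_sum (F := fun xy => r xy.1 xy.2 ^+ 2) (x, y) (fun xy => sqr_ge0 _).
  by rewrite /rho /=; lra.
have D20 : 0 <= D2 by rewrite /D2 addr_ge0.
pose stp (b : R) := rho * b + D2.
have zero B n s b : 0 <= b -> V s <= b -> iter n stp b <= B ->
    E n (fun s => if B < V s then V s else 0) s = 0.
  elim: n s b => [|n IH] s b b0 Vb hB /=.
    by rewrite ltNge (le_trans Vb hB).
  rewrite /markov_op big1 // => y _.
  have := p0 s y; rewrite /chain_p le_eqVlt => /orP[/eqP <-|Py]; first by rewrite mul0r.
  rewrite (IH (mv s y) (stp b)) ?mulr0 //.
  - by rewrite /stp addr_ge0 // mulr_ge0 //; lra.
  - apply: (le_trans (V_mv Py)); rewrite /stp lerD2r; apply: ler_pM => //; exact: sqr_ge0.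
  - by rewrite -iterSr.
have : (fun n => C * q ^+ n * C2) @ \oo --> C * 0 * C2.
  apply: cvgM; last exact: cvg_cst.
  by apply: cvgM; [exact: cvg_cst|apply: cvg_expr; rewrite ger0_norm].
rewrite mulr0 mul0r => /cvg_epsP/(_ eta eta0)[N HN].
have {HN} := HN N (leqnn N).
rewrite subr0 ger0_norm ?mulr_ge0 ?exprn_ge0 // => HN.
have stpmono n b : 0 <= b -> b <= iter n stp b.
  move=> b0; elim: n => //= n IH; apply: (le_trans IH); rewrite /stp.
  have i0 : 0 <= iter n stp b by exact: le_trans IH.
  have := ler_wpM2r i0 rho1; lra.
have stple m n b : 0 <= b -> (m <= n)%N -> iter m stp b <= iter n stp b.
  move=> b0 mn; rewrite -(subnK mn) iterD; apply: (stpmono).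
  exact: le_trans (stpmono m b b0).
exists (iter N stp C2); split; first exact: le_trans (stpmono _ _ C20).
move=> n x.
have [nN|nN] := leqP n N.
  by rewrite (zero _ n _ C2) // ?(ltW eta0) //; exact: stple.
set GB := fun s => _.
have GBl : chain_local GB.
  move=> s s' _ ss'; rewrite /GB /V.
  by under eq_bigr do under eq_bigr do rewrite ss'.
have GBV s : `|GB s| <= V s.
  by rewrite /GB; case: ifP => _; rewrite ?normr0 // ger0_norm.
have := H GB GBl GBV (n - N)%N N (ref x).
rewrite subnK ?(ltnW nN) // big1 ?subr0 => [h|y _]; last first.
  by rewrite (zero _ N _ C2) ?mulr0.
apply: (le_trans (ler_norm _)); apply: (le_trans h).
by apply: le_trans HN; rewrite ler_wpM2l // mulr_ge0 // exprn_ge0.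
Qed.

End RegenerativeChain.

(** * Trigonometric approximation *)

Section FejerTypeKernel.
Variable R : realType.

(** Real form of the binomial expansion of (e^(iy) + e^(-iy))^n e^(iz). The free phase z lets the
    induction use 2 cos y cos z = cos (z + y) + cos (z - y) and Pascal's rule. *)
Lemma cos_pow_binomial (n : nat) (y z : R) :
  (2 * cos y) ^+ n * cos z =
  \sum_(j < n.+1) 'C(n, j)%:R * cos (z + (n%:R - j%:R *+ 2) * y).
Proof.
elim: n z => [|n IH] z.
  by rewrite expr0 mul1r big_ord1 bin0 mul1r mul0rn subrr mul0r addr0.
have -> : (2 * cos y) ^+ n.+1 * cos z =
    (2 * cos y) ^+ n * cos (z + y) + (2 * cos y) ^+ n * cos (z - y).
  by rewrite exprS cosD cosB; ring.
rewrite !IH [in RHS]big_ord_recl [X in _ = _ + X]big_ord_recr /= !bin0 !binn.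
pose F (j : nat) := cos (z + (n.+1%:R - j%:R *+ 2) * y).
have E0 : \sum_(i < n.+1) 'C(n, i)%:R * cos (z + y + (n%:R - i%:R *+ 2) * y) =
   F 0%N + \sum_(i < n) 'C(n, i.+1)%:R * F i.+1.
  rewrite big_ord_recl /= bin0 mul1r; congr (_ + _).
    by rewrite /F -natr1; congr cos; ring.
  apply: eq_bigr => i _; congr (_ * _); rewrite /F /bump /= add1n -natr1.
  by congr cos; ring.
have E1 : \sum_(i < n.+1) 'C(n, i)%:R * cos (z - y + (n%:R - i%:R *+ 2) * y) =
   \sum_(i < n) 'C(n, i)%:R * F i.+1 + F n.+1.
  rewrite big_ord_recr /= binn mul1r; congr (_ + _).
    apply: eq_bigr => i _; congr (_ * _); rewrite /F -!natr1.
    by congr cos; ring.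
  by rewrite /F -!natr1; congr cos; ring.
rewrite E0 E1 !mul1r -!addrA; congr (_ + _).
rewrite addrA -big_split /= -/(F n.+1); congr (_ + _).
apply: eq_bigr => i _.
by rewrite -mulrDl -natrD /bump /= add1n -binS.
Qed.

(** Multiplying by 2 sin (b / 2) makes the sum telescope over whole periods; 0 < k < M ensures that
    this sine is positive. *)
Lemma cos_shift_sum (M k : nat) (a : R) : (0 < k < M)%N ->
  \sum_(m < M) cos (a - m%:R * (2 * pi * k%:R / M%:R)) = 0.
Proof.
move=> /andP[k0 kM].
have M0 : 0 < M%:R :> R by rewrite ltr0n; exact: leq_trans kM.
set b := 2 * pi * k%:R / M%:R.
have s0 : 0 < sin (b / 2).
  have -> : b / 2 = pi * (k%:R / M%:R) by rewrite /b; field; rewrite gt_eqF.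
  apply: sin_gt0_pi; rewrite mulr_gt0 ?pi_gt0 ?divr_gt0 ?ltr0n ?(leq_trans _ kM) //=.
  by rewrite gtr_pMr ?pi_gt0 // ltr_pdivrMr // mul1r ltr_nat.
suff h : 2%:R * sin (b / 2) * (\sum_(m < M) cos (a - m%:R * b)) = 0.
  by move/eqP: h; rewrite !mulf_eq0 pnatr_eq0 (gt_eqF s0) /= => /eqP.
pose F m := sin (a - (m%:R - 2^-1) * b).
have -> : 2%:R * sin (b / 2) * (\sum_(m < M) cos (a - m%:R * b)) = F 0%N - F M.
  rewrite mulr_sumr; elim: (M) => [|m IH]; first by rewrite big_ord0 subrr.
  rewrite big_ord_recr IH /=.
  suff -> : 2 * sin (b / 2) * cos (a - m%:R * b) = F m - F m.+1 by ring.
  rewrite /F -[m.+1%:R]natr1.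
  have -> : a - (m%:R + 1 - 2^-1) * b = (a - m%:R * b) - b / 2 by field.
  have -> : a - (m%:R - 2^-1) * b = (a - m%:R * b) + b / 2 by field.
  rewrite sinB sinD; ring.
rewrite /F.
have -> : a - (M%:R - 2^-1) * b = a - (0 - 2^-1) * b - pi *+ 2 *+ k.
  by rewrite /b -[_ *+ k]mulr_natr -[pi *+ 2]mulr_natr; field; rewrite gt_eqF.
set u := a - (0 - 2^-1) * b.
by rewrite -(periodicn (@sinD2pi R) k (u - pi *+ 2 *+ k)) subrK subrr.
Qed.

Definition grid (M m : nat) : R := m%:R * (2 * pi / M%:R) - pi.

(** ((1 + cos u) / 2)^N = cos(u/2)^(2N) is a trigonometric polynomial of degree N. A grid of M > N
    points averages every nonconstant frequency to 0 and leaves the mean, given by the central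
    binomial coefficient. *)
Lemma kernel_sum (N M : nat) (x : R) : (N < M)%N ->
  \sum_(m < M) ((1 + cos (x - grid M m)) / 2) ^+ N =
  M%:R * ('C(N.*2, N)%:R / 4 ^+ N).
Proof.
move=> NM.
have M0 : 0 < M%:R :> R by rewrite ltr0n; exact: leq_trans NM.
have kE (u : R) : ((1 + cos u) / 2) ^+ N =
   (4 ^+ N)^-1 * \sum_(j < N.*2.+1) 'C(N.*2, j)%:R * cos ((N%:R - j%:R) * u).
  have -> : \sum_(j < N.*2.+1) 'C(N.*2, j)%:R * cos ((N%:R - j%:R) * u) =
     (2 * cos (u / 2)) ^+ N.*2.
    rewrite -[RHS]mulr1 -[X in _ = _ * X]cos0 cos_pow_binomial; apply: eq_bigr => j _.
    congr (_ * cos _); rewrite add0r.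
    by rewrite (_ : N.*2%:R = N%:R * 2 :> R); [field|rewrite -muln2 natrM].
  rewrite -mul2n exprM -exprVn -exprMn; congr (_ ^+ _).
  have -> : u = (u / 2) *+ 2 by rewrite -mulr_natr; field.
  rewrite cos_mulr2n.
  have -> : (u / 2) *+ 2 / 2 = u / 2 by rewrite -mulr_natr; field.
  by field.
under eq_bigr do rewrite kE.
rewrite -mulr_sumr exchange_big /=.
suff -> : \sum_(j < N.*2.+1) \sum_(m < M) 'C(N.*2, j)%:R * cos ((N%:R - j%:R) * (x - grid M m)) =
    M%:R * 'C(N.*2, N)%:R by rewrite mulrCA [X in _ * X]mulrC.
have Nlt : (N < N.*2.+1)%N by rewrite ltnS -addnn leq_addr.
rewrite (bigD1 (Ordinal Nlt)) //= -mulr_sumr.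
rewrite [X in _ * X](_ : _ = M%:R); last first.
  by under eq_bigr do rewrite subrr mul0r cos0; rewrite sumr_const card_ord.
rewrite mulrC big1 ?addr0 // => j jN.
rewrite -mulr_sumr.
have jN' : (j != N :> nat) by apply: contra jN => /eqP e; apply/eqP/val_inj.
have j2 : (j <= N.*2)%N by rewrite -ltnS.
suff -> : \sum_(m < M) cos ((N%:R - j%:R) * (x - grid M m)) = 0 by rewrite mulr0.
case: (ltngtP j N) jN' => // jN1 _.
  rewrite -[RHS](@cos_shift_sum M (N - j) ((N - j)%:R * (x + pi))); last by lia.
  apply: eq_bigr => m _; rewrite natrB ?(ltnW jN1) // /grid; congr cos; field.
  by rewrite gt_eqF.
rewrite -[RHS](@cos_shift_sum M (j - N) ((j - N)%:R * (x + pi))); last by lia.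
apply: eq_bigr => m _; rewrite natrB ?(ltnW jN1) // /grid -cosN; congr cos; field.
by rewrite gt_eqF.
Qed.

(** De la Vallee Poussin kernel centred at a grid point and normalized to sum to 1 over the grid;
    the discrete version turns the approximants into finite sums. *)
Definition kern (N M m : nat) (x : R) : R :=
  ((1 + cos (x - grid M m)) / 2) ^+ N / (M%:R * ('C(N.*2, N)%:R / 4 ^+ N)).

Lemma kern_norm_gt0 (N M : nat) : (0 < M)%N -> 0 < M%:R * ('C(N.*2, N)%:R / 4 ^+ N) :> R.
Proof.
move=> M0; rewrite mulr_gt0 ?ltr0n // divr_gt0 ?exprn_gt0 // ltr0n bin_gt0.
by rewrite -addnn leq_addr.
Qed.

Lemma half_cos_ge0 (u : R) : 0 <= (1 + cos u) / 2.
Proof. by have /andP[] := cos_bound u; have := cos_max u; rewrite ler_norml => /andP[]; lra. Qed.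

Lemma kern_ge0 N M m x : 0 <= kern N M m x.
Proof.
by rewrite divr_ge0 ?exprn_ge0 ?half_cos_ge0 //.
Qed.

Lemma kern_sum1 N M x : (N < M)%N -> \sum_(m < M) kern N M m x = 1.
Proof.
move=> NM; rewrite -mulr_suml kernel_sum // divff // gt_eqF // kern_norm_gt0 //.
exact: leq_trans NM.
Qed.

(** Since 1 - cos u = 2 - 2 (1 + cos u) / 2, this compares [kernel_sum] at N and N + 1. The ratio of
    the two central binomial terms is (2N + 1) / (2N + 2). It plays the role of a variance that
    tends to 0. *)
Lemma kern_spread N M x : (N.+1 < M)%N ->
  \sum_(m < M) kern N M m x * (1 - cos (x - grid M m)) = N.+1%:R^-1.
Proof.
move=> NM; have M0 : (0 < M)%N by exact: leq_trans NM.
have M0R : M%:R != 0 :> R by rewrite pnatr_eq0 -lt0n.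
have c0 := kern_norm_gt0 N M0.
have b0 : 'C(N.*2, N)%:R != 0 :> R by rewrite pnatr_eq0 -lt0n bin_gt0 -addnn leq_addr.
transitivity ((2 * \sum_(m < M) ((1 + cos (x - grid M m)) / 2) ^+ N
   - 2 * \sum_(m < M) ((1 + cos (x - grid M m)) / 2) ^+ N.+1) / (M%:R * ('C(N.*2, N)%:R / 4 ^+ N))).
  rewrite !mulr_sumr -sumrB mulr_suml; apply: eq_bigr => m _.
  by rewrite /kern exprS; field; rewrite M0R b0 /= expf_neq0.
rewrite !kernel_sum //; last exact: ltnW.
have binE : N.+1%:R * 'C(N.+1.*2, N.+1)%:R = 2 * (N.*2.+1%:R) * 'C(N.*2, N)%:R :> R.
  have e1 : (N.+1.*2 * 'C(N.*2.+1, N) = N.+1 * 'C(N.+1.*2, N.+1))%N.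
    by rewrite (mul_bin_diag N.+1.*2 N) doubleS.
  have e2 : (N.*2.+1 * 'C(N.*2, N) = N.+1 * 'C(N.*2.+1, N.+1))%N.
    exact: (mul_bin_diag N.*2.+1 N).
  have e3 : 'C(N.*2.+1, N.+1) = 'C(N.*2.+1, N).
    rewrite -bin_sub; last by lia.
    by congr 'C(_, _); lia.
  rewrite -!natrM; congr (_%:R); by rewrite -e1 -mulnA e2 e3 mulnA mul2n.
have N1 : N.+1%:R != 0 :> R by rewrite pnatr_eq0.
have -> : 'C(N.+1.*2, N.+1)%:R = 2 * (N.*2.+1%:R) * 'C(N.*2, N)%:R / N.+1%:R :> R.
  by rewrite -binE mulrC mulrA mulVf ?mul1r // .
have -> : N.*2.+1%:R = 2 * N.+1%:R - 1 :> R.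
  by rewrite -muln2 -!natr1 natrM; ring.
rewrite exprS; have q0 : 4 ^+ N != 0 :> R by rewrite expf_neq0.
set x1 := N.+1%:R in N1 *; set c := 'C(_, _)%:R in b0 *; set q := 4 ^+ N in q0 *.
clearbody x1 c q.
by field; rewrite ?M0R ?N1 ?b0 ?q0.
Qed.

(** In [trig_approx] a scaled coordinate lies in [-pi/2, pi/2] and a grid point in [-pi, pi], so
    their distance is at most 3 pi/2 and does not wrap around to a full period. *)
Lemma cos_away (dl u : R) : 0 < dl <= pi / 2 -> dl <= `|u| <= 3 * (pi / 2) -> cos u <= cos dl.
Proof.
move=> /andP[d0 d1] /andP[u1 u2].
have pi0 := pi_gt0 R.
rewrite -(_ : cos `|u| = cos u); last by case: (ger0P u) => _ //; rewrite cosN.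
have [h|h] := leP `|u| pi.
  rewrite leNgt ltr_cos ?in_itv /= -?leNgt //; apply/andP; split => //; lra.
apply: (@le_trans _ _ 0); last by apply: cos_ge0_pihalf; apply/andP; split; lra.
have -> : `|u| = (`|u| - pi) + pi by rewrite subrK.
by rewrite cosDpi oppr_le0; apply: cos_ge0_pihalf; apply/andP; split; lra.
Qed.

End FejerTypeKernel.

Section TrigonometricPolynomials.
Variables (R : realType) (n : nat).

Definition lin_form (t y : 'rV[R]_n) : R := (y *m t^T) 0 0.

Lemma lin_formD t t' y : lin_form (t + t') y = lin_form t y + lin_form t' y.
Proof. by rewrite /lin_form linearD /= mulmxDr mxE. Qed.

Lemma lin_formZ c t y : lin_form (c *: t) y = c * lin_form t y.
Proof. by rewrite /lin_form linearZ /= -scalemxAr mxE. Qed.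

Lemma lin_formN t y : lin_form (- t) y = - lin_form t y.
Proof. by rewrite -scaleN1r lin_formZ mulN1r. Qed.

Lemma lin_form_delta i y : lin_form (delta_mx 0 i) y = y 0 i.
Proof. by rewrite /lin_form trmx_delta -colE mxE. Qed.

Lemma lin_formE t y : lin_form t y = \sum_i y 0 i * t 0 i.
Proof. by rewrite /lin_form mxE; apply: eq_bigr => i _; rewrite mxE. Qed.

(** The phase [a] supplies the sines, so that everything stays real. *)
Inductive trig_poly : ('rV[R]_n -> R) -> Prop :=
| trig_cos t a : trig_poly (fun y => cos (lin_form t y + a))
| trig_comb a b f g : trig_poly f -> trig_poly g ->
    trig_poly (fun y => a * f y + b * g y).

Lemma trig_ext f g : f =1 g -> trig_poly f -> trig_poly g.
Proof. by move=> /funext ->. Qed.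

Lemma trig_cst c : trig_poly (fun=> c).
Proof.
apply: (trig_ext _ (trig_comb c 0 (trig_cos 0 0) (trig_cos 0 0))) => y.
by rewrite lin_formE big1 ?addr0 ?cos0 ?mulr1 ?mul0r ?addr0 // => i _; rewrite mxE mulr0.
Qed.

Lemma trig_add f g : trig_poly f -> trig_poly g -> trig_poly (fun y => f y + g y).
Proof.
by move=> tf tg; apply: (trig_ext _ (trig_comb 1 1 tf tg)) => y; rewrite !mul1r.
Qed.

Lemma trig_scale c f : trig_poly f -> trig_poly (fun y => c * f y).
Proof.
by move=> tf; apply: (trig_ext _ (trig_comb c 0 tf tf)) => y; rewrite mul0r addr0.
Qed.

Lemma trig_mul f g : trig_poly f -> trig_poly g -> trig_poly (fun y => f y * g y).
Proof.
elim=> [t a|a b f1 f2 _ IH1 _ IH2] tg; last first.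
  apply: (trig_ext _ (trig_comb a b (IH1 tg) (IH2 tg))) => y; ring.
elim: tg => [t' a'|a' b' g1 g2 _ IH1 _ IH2]; last first.
  apply: (trig_ext _ (trig_comb a' b' IH1 IH2)) => y; ring.
apply: (trig_ext _ (trig_comb (1/2) (1/2) (trig_cos (t + t') (a + a'))
   (trig_cos (t - t') (a - a')))) => y.
rewrite !lin_formD lin_formN.
have -> : lin_form t y + lin_form t' y + (a + a') = (lin_form t y + a) + (lin_form t' y + a') by ring.
have -> : lin_form t y - lin_form t' y + (a - a') = (lin_form t y + a) - (lin_form t' y + a') by ring.
by rewrite cosB cosD; field.
Qed.

Lemma trig_sum (I : Type) (r : seq I) (F : I -> 'rV[R]_n -> R) :
  (forall i, trig_poly (F i)) -> trig_poly (fun y => \sum_(i <- r) F i y).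
Proof.
move=> tF; elim: r => [|i r IH].
  by apply: (trig_ext _ (trig_cst 0)) => y; rewrite big_nil.
by apply: (trig_ext _ (trig_add (tF i) IH)) => y; rewrite big_cons.
Qed.

Lemma trig_prod (I : Type) (r : seq I) (F : I -> 'rV[R]_n -> R) :
  (forall i, trig_poly (F i)) -> trig_poly (fun y => \prod_(i <- r) F i y).
Proof.
move=> tF; elim: r => [|i r IH].
  by apply: (trig_ext _ (trig_cst 1)) => y; rewrite big_nil.
by apply: (trig_ext _ (trig_mul (tF i) IH)) => y; rewrite big_cons.
Qed.

Lemma trig_exp f k : trig_poly f -> trig_poly (fun y => f y ^+ k).
Proof.
move=> tf; elim: k => [|k IH]; first exact: (trig_ext _ (trig_cst 1)).
by apply: (trig_ext _ (trig_mul tf IH)) => y; rewrite exprS.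
Qed.

Lemma trig_kern (N M m : nat) (c : R) (i : 'I_n) :
  trig_poly (fun y => kern N M m (c * y 0 i)).
Proof.
pose z : R := (M%:R * ('C(N.*2, N)%:R / 4 ^+ N))^-1.
have t1 : trig_poly (fun y => (1/2) * cos (lin_form (c *: delta_mx 0 i) y - grid R M m) + (1/2) * 1).
  exact: trig_comb (trig_cos _ _) (trig_cst 1).
apply: (trig_ext _ (trig_scale z (trig_exp N t1))) => y.
rewrite /kern mulrC lin_formZ lin_form_delta; congr (_ ^+ _ * _); by field.
Qed.

(** Only y is confined to the cube: z will be a rescaled grid point, which may lie outside it. *)
Lemma unif_cont_cube (f : 'rV[R]_n -> R) (L eps : R) : continuous f -> 0 < eps ->
  exists dl, 0 < dl /\ forall y z : 'rV[R]_n, (forall i, `|y 0 i| <= L) ->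
    (forall i, `|y 0 i - z 0 i| < dl) -> `|f y - f z| <= eps.
Proof.
move=> fc e0.
have e20 : 0 < eps / 2 by lra.
have := @rV_compact R n (fun=> `[- L, L]%classic) (fun=> @segment_compact R (- L) L).
move=> /compact_near_coveringP.
move=> /(_ nat \oo (fun k (x : 'rV[R]_n) => forall z, ball x (k.+1%:R^-1 : R) z -> `|f x - f z| <= eps) _).
case.
  move=> x _; have /cvgrPdist_lt/(_ (eps / 2) e20) := fc x.
  move=> /nbhs_ballP[e /= egt0 he].
  have e2 : 0 < e / 2 by lra.
  exists (ball x (e / 2), [set k | (k.+1%:R^-1 : R) < e / 2]).
    split; first exact: nbhsx_ballx.
    have := @cvg_harmonic R => /cvgrPdist_lt/(_ _ e2)[k _ hk]; exists k => // j /= kj.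
    by have := hk j kj; rewrite /harmonic /= sub0r normrN ger0_norm.
  move=> [x' k] /= [xx' hk] z x'z.
  have xz : ball x e z.
    by apply: (@ball_splitr _ _ x' x z e); [exact: ball_sym|exact: le_ball (ltW hk) _ x'z].
  have h1 := he _ xz.
  have h2 : `|f x - f x'| < eps / 2.
    by apply: he; apply: le_ball xx'; lra.
  have := ler_distD (f x) (f x') (f z); rewrite [`|f x' - f x|]distrC; lra.
move=> k _ /(_ k (leqnn k)) hk.
exists (k.+1%:R^-1); split; first by rewrite invr_gt0.
move=> y z yL yz; apply: hk => [i /=|].
  by rewrite in_itv /= -ler_norml.
split; first by rewrite invr_gt0.
by move=> i j; rewrite ord1; exact: yz.
Qed.

(** As in Bernstein's proof of the Weierstrass theorem, the product kernels are probability weights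
    on a grid and p averages f over the grid; hence p is bounded by C everywhere. On the cube, grid
    points near y are handled by uniform continuity, and far ones by a Chebyshev inequality through
    [kern_spread]. *)
Lemma trig_approx (f : 'rV[R]_n -> R) (C L eps : R) :
  continuous f -> (forall y, `|f y| <= C) -> 0 < L -> 0 < eps ->
  exists p, [/\ trig_poly p, (forall y, `|f y - p y| <= 2 * C) &
    forall y : 'rV[R]_n, (forall i, `|y 0 i| <= L) -> `|f y - p y| <= eps].
Proof.
move=> fc fC L0 e0.
have pi0 := pi_gt0 R.
have C0 : 0 <= C by apply: le_trans (normr_ge0 _) (fC 0).
(* This scale sends [-L, L] to half a period, keeping y away from its periodic images. *)
pose s := pi / (2 * L).
have s0 : 0 < s by rewrite divr_gt0 // mulr_gt0.
have [dl [dl0 Hdl]] := @unif_cont_cube f L (eps / 2) fc ltac:(lra).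
pose dl' := Num.min (s * dl) (pi / 2).
have dl'0 : 0 < dl' by rewrite lt_min mulr_gt0 //=; lra.
have dl'pi : dl' <= pi / 2 by rewrite ge_min lexx orbT.
have dl's : dl' <= s * dl by rewrite ge_min lexx.
pose eta := 1 - cos dl'.
have eta0 : 0 < eta.
  have m0 : (0 : R) \in `[0, pi] by rewrite in_itv /= lexx ltW.
  have m1 : dl' \in `[0, pi] by rewrite in_itv /=; apply/andP; split; lra.
  by rewrite subr_gt0 -[ltRHS]cos0 ltr_cos.
have [N [_ HN]] := inv_small (2 * C * n%:R / eta) (ltac:(lra) : 0 < eps / 2).
have {}HN := HN N.+1 (leqnSn _).
pose M := N.+2.
pose yh (mu : {ffun 'I_n -> 'I_M}) : 'rV[R]_n := \row_i (grid R M (mu i) / s).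
pose K (mu : {ffun 'I_n -> 'I_M}) (y : 'rV[R]_n) := \prod_i kern N M (mu i) (s * y 0 i).
have K0 mu y : 0 <= K mu y by apply: prodr_ge0 => i _; exact: kern_ge0.
have K1 y : \sum_mu K mu y = 1.
  rewrite /K -(bigA_distr_bigA (fun i (m : 'I_M) => kern N M m (s * y 0 i))) /=.
  by rewrite big1 // => i _; rewrite kern_sum1.
exists (fun y => \sum_(mu : {ffun 'I_n -> 'I_M}) f (yh mu) * K mu y); split.
- apply: trig_sum => mu; apply: trig_scale; apply: trig_prod => i; exact: trig_kern.
- move=> y; apply: (le_trans (ler_normB _ _)).
  have : `|\sum_mu f (yh mu) * K mu y| <= C.
    apply: (le_trans (ler_norm_sum _ _ _)); rewrite -[leRHS]mulr1 -(K1 y) mulr_sumr.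
    by apply: ler_sum => mu _; rewrite normrM (ger0_norm (K0 _ _)) ler_wpM2r.
  have := fC y; lra.
move=> y yL.
have -> : f y - \sum_mu f (yh mu) * K mu y = \sum_mu (f y - f (yh mu)) * K mu y.
  rewrite -[f y in LHS]mulr1 -[X in f y * X](K1 y) mulr_sumr -sumrB.
  by apply: eq_bigr => mu _; rewrite mulrBl.
pose u (mu : {ffun 'I_n -> 'I_M}) i := s * y 0 i - grid R M (mu i).
have gridb (m : 'I_M) : - pi <= grid R M m <= pi.
  rewrite /grid lerBrDr addNr lerBlDr.
  have M0 : 0 < M%:R :> R by rewrite ltr0n.
  apply/andP; split; first by rewrite mulr_ge0 // divr_ge0 // ?mulr_ge0 // ltW.
  rewrite mulrA ler_pdivrMr // mulrC ler_pM ?mulr_ge0 ?(ltW pi0) //; first lra.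
  by rewrite ler_nat ltnW.
have pt mu : `|f y - f (yh mu)| <= eps / 2 + \sum_i 2 * C / eta * (1 - cos (u mu i)).
  have t0 i : 0 <= 2 * C / eta * (1 - cos (u mu i)).
    apply: mulr_ge0; first by rewrite divr_ge0 ?mulr_ge0 // ltW.
    by have /andP[] := cos_bound (u mu i).
  have [/forallP h|] := boolP [forall i, `|u mu i| < dl'].
    apply: (@le_trans _ _ (eps / 2)); last by rewrite lerDl sumr_ge0.
    apply: Hdl => // i; rewrite mxE.
    have -> : y 0 i - grid R M (mu i) / s = u mu i / s by rewrite /u; field; rewrite gt_eqF.
    rewrite normrM (gtr0_norm (_ : 0 < s^-1)) ?invr_gt0 // ltr_pdivrMr // mulrC.
    exact: lt_le_trans (h i) dl's.
  rewrite negb_forall => /existsP h; case: h => i; rewrite -leNgt => ui.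
  apply: (@le_trans _ _ (2 * C)).
    by apply: (le_trans (ler_normB _ _)); have := fC y; have := fC (yh mu); lra.
  rewrite (bigD1 i) //=.
  have : 2 * C <= 2 * C / eta * (1 - cos (u mu i)).
    rewrite -{1}[2 * C](divfK (lt0r_neq0 eta0)).
    rewrite ler_wpM2l // ?divr_ge0 ?mulr_ge0 // ?(ltW eta0) // /eta lerD2l lerN2.
    apply: cos_away; apply/andP; split => //.
    apply: (le_trans (ler_normB _ _)).
    have /andP[g1 g2] := gridb (mu i).
    have : `|grid R M (mu i)| <= pi by rewrite ler_norml g1.
    have : `|s * y 0 i| <= pi / 2.
      rewrite normrM gtr0_norm // /s.
      have -> : pi / 2 = pi / (2 * L) * L by field; rewrite gt_eqF.
      by rewrite ler_wpM2l // ltW.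
    lra.
  have : 0 <= \sum_(i0 < n | i0 != i) 2 * C / eta * (1 - cos (u mu i0)).
    by apply: sumr_ge0.
  lra.
apply: (le_trans (ler_norm_sum _ _ _)).
apply: (@le_trans _ _ (\sum_mu (eps / 2 + \sum_i 2 * C / eta * (1 - cos (u mu i))) * K mu y)).
  by apply: ler_sum => mu _; rewrite normrM (ger0_norm (K0 _ _)) ler_wpM2r.
under eq_bigr do rewrite mulrDl.
rewrite big_split /= -mulr_sumr K1 mulr1.
have -> : \sum_mu (\sum_i 2 * C / eta * (1 - cos (u mu i))) * K mu y =
   \sum_(i < n) 2 * C / eta * N.+1%:R^-1.
  under eq_bigr do rewrite mulr_suml.
  rewrite exchange_big /=; apply: eq_bigr => i _.
  under eq_bigr do rewrite -mulrA.
  rewrite -mulr_sumr; congr (_ * _).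
  rewrite -(@kern_spread R N M (s * y 0 i)) //.
  (* Absorbing 1 - cos into the i-th factor makes the sum over mu a product of one-dimensional sums,
     all equal to 1 except the i-th. *)
  pose F (i' : 'I_n) (m : 'I_M) := kern N M m (s * y 0 i') *
     (if i' == i then 1 - cos (s * y 0 i - grid R M m) else 1).
  transitivity (\sum_(mu : {ffun 'I_n -> 'I_M}) \prod_i' F i' (mu i')).
    apply: eq_bigr => mu _; rewrite /F big_split /= mulrC; congr (_ * _).
    by rewrite -big_mkcond /= big_pred1_eq.
  rewrite -(bigA_distr_bigA F) (bigD1 i) //= [X in _ * X]big1 ?mulr1 => [|i' ii'].
    by apply: eq_bigr => m _; rewrite /F eqxx.
  rewrite -[RHS](@kern_sum1 R N M (s * y 0 i')) //.
  by apply: eq_bigr => m _; rewrite /F (negbTE ii') mulr1.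
rewrite sumr_const card_ord -[_ *+ n]mulr_natr.
have -> : 2 * C / eta / N.+1%:R * n%:R = 2 * C * n%:R / eta / N.+1%:R.
  by field; rewrite !gt_eqF.
by apply: (le_trans (lerD (lexx _) HN)); lra.
Qed.

End TrigonometricPolynomials.

(** * Gaussian vectors *)

Section GaussianIntegral.
Variable R : realType.
Local Notation mu := (@lebesgue_measure R).

Let e (c x : R) := expR (- (x ^+ 2 / c)).

Let e_gt0 c x : 0 < e c x. Proof. exact: expR_gt0. Qed.

Lemma is_derive_gauss (c x : R) : is_derive x 1 (e c) (- (2 * x / c) * e c x).
Proof.
have h : is_derive x 1 (fun x => - (x ^+ 2 / c)) (- (2 * x / c)).
  have -> : (fun x : R => - (x ^+ 2 / c)) = (fun x => - c^-1 *: x ^+ 2).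
    by apply/funext => y; rewrite /GRing.scale /= mulNr mulrC.
  apply: is_derive_eq; rewrite /GRing.scale /=; ring.
apply: (is_derive_eq (is_derive1_comp (is_derive_expR _) h)).
by rewrite mulrC.
Qed.

Lemma is_derive_affine_comp (f df : R -> R) (t a x : R) :
  (forall y, is_derive y (1:R) f (df y)) ->
  is_derive x 1 (fun x => f (t * x + a)) (t * df (t * x + a)).
Proof.
move=> hf.
have h : is_derive x 1 (fun x => t * x + a) t.
  by apply: is_derive_eq; rewrite /GRing.scale /= mulr1 addr0.
by apply: (is_derive_eq (is_derive1_comp (hf _) h)); rewrite mulrC.
Qed.

Lemma affine_comp_continuous (f : R -> R) (t a : R) : continuous f ->
  continuous (fun x => f (t * x + a)).
Proof.
move=> fc x; apply: (@continuous_comp _ _ _ (fun x => t * x + a) f); last exact: fc.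
by apply: cvgD; [apply: cvgM; [exact: cvg_cst|exact: cvg_id]|exact: cvg_cst].
Qed.

Lemma affine_comp_measurable (f : R -> R) (t a : R) : continuous f ->
  measurable_fun setT (fun x => f (t * x + a)).
Proof. by move=> fc; apply: continuous_measurable_fun; exact: affine_comp_continuous. Qed.

(** A wider Gaussian dominates x e(x), which makes the integrands obtained by differentiation or by
    parts integrable. *)
Lemma gauss_moment_bound (c x : R) : 0 < c ->
  `|x| * e c x <= Num.sqrt c * e (2 * c) x.
Proof.
move=> c0; have s0 : 0 < Num.sqrt c by rewrite sqrtr_gt0.
have cE : Num.sqrt c ^+ 2 = c by rewrite sqr_sqrtr // ltW.
have eE : e (2 * c) x = e c x * expR (x ^+ 2 / (2 * c)).
  by rewrite /e -expRD; congr expR; field; rewrite gt_eqF.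
rewrite eE mulrCA mulrC ler_pM2l ?e_gt0 //.
apply: (@le_trans _ _ (Num.sqrt c * (1 + x ^+ 2 / (2 * c)))); last first.
  by rewrite ler_wpM2l ?(ltW s0) // expR_ge1Dx.
rewrite -[x ^+ 2]real_normK ?num_real //.
set s := Num.sqrt c in s0 cE *; rewrite -cE; set z := `|x|.
have -> : s * (1 + z ^+ 2 / (2 * s ^+ 2)) = z + ((s - z) ^+ 2 + s ^+ 2) / (2 * s).
  by field; rewrite gt_eqF.
by rewrite lerDl divr_ge0 // ?addr_ge0 ?sqr_ge0 // mulr_ge0 // ltW.
Qed.

Lemma measurable_gauss c : measurable_fun setT (e c).
Proof.
apply: continuous_measurable_fun => x.
apply: differentiable_continuous; apply/derivable1_diffP.
by have [] := is_derive_gauss c x.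
Qed.

Lemma gauss_normal_pdf (s x : R) : s != 0 ->
  normal_pdf 0 s x = normal_peak s * e (s ^+ 2 *+ 2) x.
Proof.
by move=> s0; rewrite /normal_pdf (negbTE s0) /normal_fun subr0 /e mulNr.
Qed.

Lemma integrable_gauss c : 0 < c -> mu.-integrable setT (EFin \o e c).
Proof.
move=> c0; pose s := Num.sqrt (c / 2).
have s0 : s != 0 by rewrite gt_eqF // sqrtr_gt0 divr_gt0.
have sE : s ^+ 2 *+ 2 = c by rewrite sqr_sqrtr ?divr_ge0 ?(ltW c0) // -mulr_natr; field.
have := integrableZl measurableT (normal_peak s)^-1 (integrable_normal_pdf 0 s).
apply: eq_integrable => // x _.
rewrite /= gauss_normal_pdf // sE -EFinM mulrA mulVf ?mul1r //.
by rewrite gt_eqF // normal_peak_gt0.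
Qed.

Lemma integrable_gauss_mul (c : R) (f : R -> R) : 0 < c ->
  measurable_fun setT f -> (forall x, `|f x| <= 1) ->
  mu.-integrable setT (EFin \o (fun x => f x * e c x)) /\
  mu.-integrable setT (EFin \o (fun x => x * (f x * e c x))).
Proof.
move=> c0 mf f1; split.
  apply: (le_integrable measurableT _ _ (integrable_gauss c0)).
    by apply/measurable_EFinP; apply: measurable_funM => //; exact: measurable_gauss.
  move=> x _ /=; rewrite lee_fin normrM ler_piMl //.
apply: (le_integrable measurableT _ _
  (integrableZl measurableT (Num.sqrt c) (integrable_gauss (mulr_gt0 (ltr0n _ 2) c0)))).
  apply/measurable_EFinP; apply: measurable_funM => //.
  by apply: measurable_funM => //; exact: measurable_gauss.
move=> x _ /=; rewrite lee_fin normrM.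
have h := gauss_moment_bound x c0.
rewrite [leRHS]ger0_norm ?mulr_ge0 ?sqrtr_ge0 ?(ltW (e_gt0 _ _)) //.
apply: le_trans h; rewrite ler_wpM2l // normrM (gtr0_norm (e_gt0 c x)).
by rewrite ler_piMl // ltW.
Qed.

Lemma cvg_integral_growing (f : R -> R) : mu.-integrable setT (EFin \o f) ->
  (\int[mu]_(x in `[(- n.+1%:R), n.+1%:R]) f x) @[n --> \oo] --> \int[mu]_x f x.
Proof.
move=> fi; have mf := measurable_int _ fi.
pose f_ (n : nat) := (EFin \o f) \_ `[(- n.+1%:R : R), n.+1%:R].
have mi n : measurable `[(- n.+1%:R : R), n.+1%:R] by [].
have := @dominated_convergence _ _ R mu setT measurableT f_ (EFin \o f) (fun x => `|(f x)%:E|%E).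
case.
- by move=> n; apply/(measurable_restrictT _ _).1 => //; exact: measurable_funTS.
- by [].
- apply: aeW => x _.
  apply: cvg_near_cst; exists (Num.truncn `|x|) => // n /= hn.
  rewrite /f_ patchE ifT // inE /= in_itv /= -ler_norml.
  have := truncnS_gt `|x| => h; apply: (le_trans (ltW h)); by rewrite ler_nat.
- exact: integrable_abse.
- apply: aeW => x n _; rewrite /f_ patchE; case: ifP => _ //; by rewrite abse0.
move=> _ _ H.
rewrite /Rintegral; apply: fine_cvg; rewrite fineK; last exact: integrable_fin_num.
rewrite [X in X @ _ --> _](_ : _ = (fun n => (\int[mu]_x f_ n x)%E)); last first.
  by apply/funext => n; rewrite integral_mkcond.
exact: H.
Qed.

(** The derivative of sin (t x + a) e(x) integrates to 0, since its primitive vanishes at both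
    infinities. *)
Lemma gauss_parts (c t a : R) : 0 < c ->
  \int[mu]_x (x * (sin (t * x + a) * e c x)) =
  c / 2 * t * \int[mu]_x (cos (t * x + a) * e c x).
Proof.
move=> c0.
pose h x := sin (t * x + a) * e c x.
pose k x := t * (cos (t * x + a) * e c x) - 2 / c * (x * (sin (t * x + a) * e c x)).
have hd (x : R) : is_derive x 1 h (k x).
  have d1 := is_derive_affine_comp t a x (@is_derive_sin R).
  have d2 := is_derive_gauss c x.
  apply: is_derive_eq; rewrite /k /GRing.scale /=; by field; rewrite gt_eqF.
have ms := affine_comp_measurable t a (@continuous_sin R).
have mc := affine_comp_measurable t a (@continuous_cos R).
have [si xsi] := integrable_gauss_mul c0 ms (fun x => sin_max _).
have [ci _] := integrable_gauss_mul c0 mc (fun x => cos_max _).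
have cont (f : R -> R) (df : R -> R) : (forall x, is_derive x (1:R) f (df x)) -> continuous f.
  move=> fd x; apply: differentiable_continuous; apply/derivable1_diffP.
  by have [] := fd x.
have hc : continuous h := cont _ _ hd.
have kc : continuous k.
  have ec : continuous (e c) := cont _ _ (is_derive_gauss c).
  move=> x; apply: cvgB; apply: cvgM; try exact: cvg_cst.
    by apply: cvgM (ec x); apply: affine_comp_continuous; exact: continuous_cos.
  apply: cvgM; first exact: cvg_id.
  by apply: cvgM (ec x); apply: affine_comp_continuous; exact: continuous_sin.
have ki : mu.-integrable setT (EFin \o k).
  have := integrableB measurableT (integrableZl measurableT t ci) (integrableZl measurableT (2 / c) xsi).
  by apply: eq_integrable => // x _; rewrite /= EFinB !EFinM.
have E1 : \int[mu]_x k x = 0.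
  have l1 := cvg_integral_growing ki.
  have l2 : (\int[mu]_(x in `[(- n.+1%:R), n.+1%:R]) k x) @[n --> \oo] --> (0 : R).
    have -> : (fun n : nat => \int[mu]_(x in `[(- n.+1%:R), n.+1%:R]) k x) =
       (fun n => h n.+1%:R - h (- n.+1%:R)).
      apply/funext => n.
      rewrite /Rintegral (@continuous_FTC2 _ k h) //.
      - by apply: (lt_trans (y := 0)); rewrite ?oppr_lt0.
      - exact: continuous_subspaceT.
      - split.
        + by move=> x _; have [] := hd x.
        + by apply: cvg_at_right_filter; exact: hc.
        + by apply: cvg_at_left_filter; exact: hc.
      - by move=> x _; rewrite derive1E; have [] := hd x.
    have e0 : (fun n : nat => e c n.+1%:R) @ \oo --> (0 : R).
      apply: (@squeeze_cvgr _ _ _ _ (fun=> 0) (fun n : nat => c * (n.+1%:R^-1 : R))).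
      - apply: nearW => n; rewrite (ltW (e_gt0 _ _)) /=.
        rewrite /e expRN -[leRHS]invrK lef_pV2 ?posrE ?expR_gt0 ?invr_gt0 ?mulr_gt0 ?invr_gt0 //.
        apply: le_trans (expR_ge1Dx _).
        rewrite invfM invrK.
        have n1 : 1 <= n.+1%:R :> R by rewrite ler1n.
        apply: (@le_trans _ _ (n.+1%:R ^+ 2 / c)); last by rewrite lerDr.
        by rewrite mulrC ler_pM2r ?invr_gt0 // expr2 ler_peMr //; lra.
      - exact: cvg_cst.
      - rewrite -[X in _ --> X](mulr0 c); apply: cvgM; first exact: cvg_cst.
        exact: cvg_harmonic.
    have hb x : `|h x| <= e c x.
      by rewrite /h normrM (gtr0_norm (e_gt0 c x)) ler_piMl ?sin_max // ltW.
    have h1 (u : nat -> R) : (forall n, u n ^+ 2 = n.+1%:R ^+ 2) -> h (u n) @[n --> \oo] --> (0 : R).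
      move=> uE; apply: norm_cvg0.
      apply: (@squeeze_cvgr _ _ _ _ (fun=> 0) (fun n : nat => e c n.+1%:R)) => //.
        apply: nearW => n; rewrite normr_ge0 /=; apply: (le_trans (hb _)).
        by rewrite /e uE.
      exact: cvg_cst.
    rewrite -[X in _ --> X](subr0 0); apply: cvgB; apply: h1 => n //.
    by rewrite sqrrN.
  exact: (cvg_unique _ l1 l2).
move: E1; rewrite /k.
rewrite RintegralB //=; last 2 first.
- by have := integrableZl measurableT t ci; apply: eq_integrable => // x _; rewrite /= EFinM.
- by have := integrableZl measurableT (2 / c) xsi; apply: eq_integrable => // x _; rewrite /= EFinM.
rewrite !RintegralZl // => /eqP; rewrite subr_eq0 => /eqP E.
have cn0 : c != 0 by rewrite gt_eqF.
by rewrite -[RHS]mulrA E; field.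
Qed.

(** As a function of t the integral solves g' = - (c / 2) t g, by differentiation under the integral
    and [gauss_parts]; so g(t) exp (c t^2 / 4) is constant. *)
Lemma gauss_charfun (c a t : R) : 0 < c ->
  \int[mu]_x (cos (t * x + a) * e c x) =
  expR (- (c / 4 * t ^+ 2)) * cos a * \int[mu]_x e c x.
Proof.
move=> c0.
pose f t x := cos (t * x + a) * e c x.
pose g t := \int[mu]_x f t x.
have fi s : mu.-integrable setT (EFin \o f s).
  by have [] := integrable_gauss_mul c0 (affine_comp_measurable s a (@continuous_cos R)) (fun x => cos_max _).
have fd s x : is_derive s (1:R) (f^~ x) (- (x * (sin (s * x + a) * e c x))).
  have -> : f^~ x = (fun s => e c x *: cos (x * s + a)).
    by apply/funext => s'; rewrite /f mulrC [s' * x]mulrC.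
  have d1 := is_derive_affine_comp x a s (@is_derive_cos R).
  apply: is_derive_eq; rewrite /GRing.scale /= [s * x]mulrC; ring.
have Gi : mu.-integrable setT (EFin \o (fun x => `|x| * e c x)).
  have [_ h] := integrable_gauss_mul c0 (measurable_cst (1:R)) (fun x => ltac:(by rewrite normr1)).
  have := integrable_norm h; apply: eq_integrable => // x _ /=.
  by rewrite mul1r normrM (gtr0_norm (e_gt0 c x)).
have G_ub s x : `|partial1of2 f s x| <= `|x| * e c x.
  rewrite /partial1of2 derive1E.
  have -> : 'D_1 (f^~ x) s = - (x * (sin (s * x + a) * e c x)).
    exact: (@derive_val _ _ _ _ _ _ _ (fd s x)).
  rewrite normrN !normrM ler_wpM2l // (gtr0_norm (e_gt0 c x)).
  by rewrite ler_piMl ?sin_max // ltW.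
have gd s : is_derive s (1:R) g (- (c / 2 * s * g s)).
  have Is : `](s - 1), (s + 1)[%classic s.
    by rewrite /= in_itv /=; apply/andP; split; lra.
  have der := @derivable_under_integral R _ _ mu f setT measurableT s (s - 1) (s + 1) Is
    (fun x _ => fi x) (fun x y _ _ => @ex_derive _ _ _ _ _ _ _ (fd x y))
    (fun x => `|x| * e c x) (fun x => mulr_ge0 (normr_ge0 x) (ltW (e_gt0 c x))) Gi
    (fun x y _ _ => G_ub x y).
  have val := @differentiation_under_integral R _ _ mu f setT measurableT s (s - 1) (s + 1) Is
    (fun x _ => fi x) (fun x y _ _ => @ex_derive _ _ _ _ _ _ _ (fd x y))
    (fun x => `|x| * e c x) (fun x => mulr_ge0 (normr_ge0 x) (ltW (e_gt0 c x))) Gi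
    (fun x y _ _ => G_ub x y).
  have -> : - (c / 2 * s * g s) = g^`()%classic s.
    rewrite val -gauss_parts // -mulN1r.
    have [_ xsi] := integrable_gauss_mul c0 (affine_comp_measurable s a (@continuous_sin R))
      (fun x => sin_max _).
    rewrite -RintegralZl //; apply: eq_Rintegral => x _.
    rewrite /partial1of2 derive1E mulN1r; apply/esym.
    exact: (@derive_val _ _ _ _ _ _ _ (fd s x)).
  by rewrite derive1E; apply: DeriveDef.
pose G s := g s * expR (c / 4 * s ^+ 2).
have Gd s : is_derive s (1:R) G 0.
  have d1 : is_derive s 1 (fun s => c / 4 * s ^+ 2) (c / 2 * s).
    have -> : (fun s : R => c / 4 * s ^+ 2) = (fun s => (c / 4) *: s ^+ 2) by [].
    apply: is_derive_eq; rewrite /GRing.scale /=; by field.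
  have d2 := is_derive1_comp (is_derive_expR _) d1.
  have := gd s => d3.
  have d4 : is_derive s (1:R) (g \* (expR \o (fun s => c / 4 * s ^+ 2))) 0.
    apply: is_derive_eq; rewrite /GRing.scale /=; ring.
  exact: d4.
have := @is_derive_0_is_cst R G t 0 Gd.
rewrite /G expr0n /= mulr0 expR0 mulr1.
have -> : g 0 = cos a * \int[mu]_x e c x.
  rewrite /g -RintegralZl //; last exact: integrable_gauss.
  by apply: eq_Rintegral => x _; rewrite /f mul0r add0r.
move=> E; rewrite -mulrA -E mulrCA -expRD addNr expR0 mulr1.
by apply: eq_Rintegral => x _.
Qed.

Lemma integral_normal_prob (s : R) (f : R -> R) : measurable_fun setT f ->
  (forall x, `|f x| <= 1) ->
  (\int[normal_prob 0 s]_x (f x)%:E = \int[mu]_x ((f x)%:E * (normal_pdf 0 s x)%:E))%E.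
Proof.
move=> mf f1.
have mf' : measurable_fun setT (EFin \o f) by exact/measurable_EFinP.
rewrite -(Radon_Nikodym_change_of_variables (normal_prob_dominates 0 s)) //=; last first.
  apply: measurable_bounded_integrable => //.
    by rewrite -ge0_fin_numE // fin_num_measure.
  exists 1; split; rewrite ?num_real // => x x1 y _; apply: le_trans (ltW x1); exact: f1.
apply: ae_eq_integral => //.
- apply: emeasurable_funM => //; apply: (measurable_int mu).
  by apply: Radon_Nikodym_integrable; exact: normal_prob_dominates.
- by apply: emeasurable_funM => //; apply/measurable_EFinP; exact: measurable_normal_pdf.
- apply: ae_eqe_mul2l => /=.
  rewrite Radon_NikodymE //=; first exact: normal_prob_dominates.
  move=> dom; case: cid => /= h [h1 h2 h3].
  apply: integral_ae_eq => //=.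
  + by apply/measurable_EFinP; exact: measurable_normal_pdf.
  + by move=> E _ mE; rewrite -h3.
Qed.

Lemma normal_charfun (s a t : R) : s != 0 ->
  (\int[normal_prob 0 s]_x (cos (t * x + a))%:E = (expR (- (s ^+ 2 / 2 * t ^+ 2)) * cos a)%:E)%E.
Proof.
move=> s0; pose c := s ^+ 2 *+ 2.
have c0 : 0 < c by rewrite pmulrn_lgt0 // exprn_even_gt0.
have mc := affine_comp_measurable t a (@continuous_cos R).
rewrite integral_normal_prob //; last by move=> x; exact: cos_max.
have [ci _] := integrable_gauss_mul c0 mc (fun x => cos_max _).
have ei := integrable_gauss c0.
have E : \int[mu]_x (cos (t * x + a) * normal_pdf 0 s x) = expR (- (s ^+ 2 / 2 * t ^+ 2)) * cos a.
  have -> : (fun x => cos (t * x + a) * normal_pdf 0 s x) =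
     (fun x => normal_peak s * (cos (t * x + a) * e c x)).
    by apply/funext => x; rewrite gauss_normal_pdf // mulrCA.
  rewrite RintegralZl // gauss_charfun // mulrCA -RintegralZl //.
  have -> : \int[mu]_x (normal_peak s * e c x) = 1.
    rewrite /Rintegral -[1]/(fine 1%:E) -(integral_normal_pdf 0 s); congr fine.
    by apply: eq_integral => x _; rewrite gauss_normal_pdf.
  have cE : c / 4 * t ^+ 2 = s ^+ 2 / 2 * t ^+ 2 by rewrite /c -mulr_natr; field.
  by rewrite mulr1 cE.
rewrite -E /Rintegral fineK; first by apply: eq_integral => x _; rewrite EFinM.
apply: integrable_fin_num => //.
have := integrableZl measurableT (normal_peak s) ci; apply: eq_integrable => // x _ /=.
by rewrite gauss_normal_pdf // -EFinM mulrCA.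
Qed.

End GaussianIntegral.

(** * Random vectors, and laws determined by characteristic functions *)

Section BorelVectors.
Variables (R : realType) (n : nat).

Lemma open_borel_rV (U : set 'rV[R]_n) : open U -> measurable (U : set (borel_rV R n)).
Proof. by move=> oU; apply: sub_sigma_algebra. Qed.

Lemma coord_measurable (i : 'I_n) :
  measurable_fun setT (fun y : borel_rV R n => (y : 'rV[R]_n) 0 i).
Proof.
apply: (measurability _ (RGenOpens.measurableE R)) => //.
move=> _ [_ [a [b ->] <-]]; rewrite setTI; apply: open_borel_rV.
by apply: open_comp; [move=> y _; exact: coord_continuous|exact: interval_open].
Qed.

Lemma continuous_borel_measurable (f : 'rV[R]_n -> R) : continuous f ->
  measurable_fun setT (f : borel_rV R n -> R).
Proof.
move=> fc; apply: (measurability _ (RGenOpens.measurableE R)) => //.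
move=> _ [_ [a [b ->] <-]]; rewrite setTI; apply: open_borel_rV.
by apply: open_comp; [move=> y _; exact: fc|exact: interval_open].
Qed.

(* An open set is the union of the countably many rational cubes inside it. *)
Lemma measurable_rV (d : measure_display) (T : measurableType d) (G : T -> 'rV[R]_n) :
  (forall i, measurable_fun setT (fun w => G w 0 i)) ->
  measurable_fun setT (G : T -> borel_rV R n).
Proof.
move=> mG; apply: (@measurability _ _ T (borel_rV R n) setT G (@open 'rV[R]_n)) => //.
move=> _ [U oU <-]; rewrite setTI.
pose cube (p : {ffun 'I_n -> rat} * nat) : set 'rV[R]_n :=
  [set y | forall i, `|y 0 i - ratr (p.1 i)| < p.2.+1%:R^-1].
pose F (p : {ffun 'I_n -> rat} * nat) : set T :=
  if pselect (cube p `<=` U) is left _ then G @^-1` cube p else set0.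
have -> : G @^-1` U = \bigcup_p F p.
  apply/seteqP; split=> [w Uw|w [p _]]; last first.
    by rewrite /F; case: pselect => // pU; exact: pU.
  have /nbhs_ballP[e /= e0 he] : nbhs (G w) U by exact: open_nbhs_nbhs.
  have [k [_ Hk]] := @inv_small R 1 (e / 2) ltac:(lra).
  have {}Hk : k.+1%:R^-1 <= e / 2 :> R by have := Hk k.+1 (leqnSn _); rewrite mul1r.
  have k0 : 0 < k.+1%:R^-1 :> R by rewrite invr_gt0.
  have H i : exists q : rat, `|G w 0 i - ratr q| < k.+1%:R^-1.
    move: (k.+1%:R^-1) k0 => z z0.
    have [q] := @rat_in_itvoo R (G w 0 i - z) (G w 0 i + z) ltac:(lra).
    rewrite in_itv /= => /andP[q1 q2]; exists q.
    by rewrite ltr_norml; apply/andP; split; lra.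
  have [q Hq] := choice H.
  exists (finfun q, k) => //; rewrite /F; case: pselect => [_ i|h] /=.
    by rewrite ffunE.
  exfalso; apply: h => y /= hy; apply: he; split => // i j; rewrite ord1.
  have := hy j; rewrite ffunE /= => h1; have h2 := Hq j.
  move: (k.+1%:R^-1) Hk h1 h2 => z Hk h1 h2.
  rewrite /ball /=; have := ler_distD (ratr (q j)) (G w 0 j) (y 0 j).
  by rewrite [`|ratr (q j) - _|]distrC; lra.
apply: countable_bigcupT_measurable; first exact: countableP.
move=> p; rewrite /F; case: pselect => // _.
have -> : G @^-1` cube p = \bigcap_(i in [set: 'I_n]) [set w | `|G w 0 i - ratr (p.1 i)| < p.2.+1%:R^-1].
  by apply/seteqP; split=> [w h i _|w h i]; exact: h.
apply: fin_bigcap_measurable => // i _.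
have -> : [set w | `|G w 0 i - ratr (p.1 i)| < p.2.+1%:R^-1] =
   (fun w => G w 0 i) @^-1` `](ratr (p.1 i) - p.2.+1%:R^-1), (ratr (p.1 i) + p.2.+1%:R^-1)[.
  move: (p.2.+1%:R^-1) => z.
  apply/seteqP; split=> w /=; rewrite in_itv /= ltr_norml => /andP[h1 h2]; apply/andP; split; lra.
by rewrite -[X in measurable X]setTI; apply: mG.
Qed.

End BorelVectors.

Section IntegralsOfRandomVectors.
Variables (R : realType) (n : nat).
Variables (d : measure_display) (T : measurableType d) (Q : probability T R).
Variables (G : T -> 'rV[R]_n).
Hypothesis mG : forall i, measurable_fun setT (fun w => G w 0 i).

Lemma cont_comp_measurable (f : 'rV[R]_n -> R) : continuous f ->
  measurable_fun setT (fun w => f (G w)).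
Proof.
move=> fc; apply: (@measurableT_comp _ _ _ _ _ _ (f : borel_rV R n -> R) _ (G : T -> borel_rV R n)).
  exact: continuous_borel_measurable.
exact: measurable_rV.
Qed.

Lemma bounded_prob_integrable (f : T -> R) (C : R) : measurable_fun setT f ->
  (forall w, `|f w| <= C) -> Q.-integrable setT (EFin \o f).
Proof.
move=> mf fC; apply: measurable_bounded_integrable => //.
  by rewrite -ge0_fin_numE // fin_num_measure.
by exists C; split; rewrite ?num_real // => x x1 y _; apply: le_trans (ltW x1); exact: fC.
Qed.

Lemma scale_integrable (f : T -> R) (c : R) : Q.-integrable setT (EFin \o f) ->
  Q.-integrable setT (EFin \o (fun w => c * f w)).
Proof. by move=> h; have := integrableZl measurableT c h; apply: eq_integrable. Qed.

Lemma lin_form_measurable t : measurable_fun setT (fun w => lin_form t (G w)).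
Proof.
have -> : (fun w => lin_form t (G w)) = (fun w => \sum_i G w 0 i * t 0 i).
  by apply/funext => w; rewrite lin_formE.
by apply: measurable_sum => i; apply: measurable_funM.
Qed.

Lemma cos_comp_measurable (f : T -> R) : measurable_fun setT f ->
  measurable_fun setT (fun w => cos (f w)).
Proof.
move=> mf; apply: (@measurableT_comp _ _ _ _ _ _ (@cos R)) => //.
by apply: continuous_measurable_fun; exact: continuous_cos.
Qed.

Lemma trig_measurable_bounded (p : 'rV[R]_n -> R) : trig_poly p ->
  measurable_fun setT (fun w => p (G w)) /\ exists C, forall y, `|p y| <= C.
Proof.
elim=> [t a|a b f g _ [mf [Cf hf]] _ [mg [Cg hg]]].
  split; last by exists 1 => y; exact: cos_max.
  by apply: cos_comp_measurable; apply: measurable_funD => //; exact: lin_form_measurable.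
split; first by apply: measurable_funD; apply: measurable_funM.
exists (`|a| * Cf + `|b| * Cg) => y; apply: (le_trans (ler_normD _ _)).
by rewrite !normrM; apply: lerD; rewrite ler_wpM2l.
Qed.

Let N w := \sum_i `|G w 0 i|.

Lemma norm1_measurable : measurable_fun setT N.
Proof.
by apply: measurable_sum => i; apply: measurableT_comp => //; exact: measurable_normr.
Qed.

Lemma tail_measurable L : measurable [set w | L < N w].
Proof.
have -> : [set w | L < N w] = setT `&` N @^-1` `]L, +oo[.
  by rewrite setTI; apply/seteqP; split => w /=; rewrite in_itv /= andbT.
by apply: norm1_measurable.
Qed.

Lemma tail_small eps : 0 < eps ->
  exists L0, 0 < L0 /\ forall L, L0 <= L -> fine (Q [set w | L < N w]) <= eps.
Proof.
move=> e0; pose F (k : nat) := [set w | k.+1%:R < N w].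
have mF k : measurable (F k) by exact: tail_measurable.
have F0 : \bigcap_k F k = set0.
  apply/seteqP; split => // w /(_ (Num.truncn (N w)) I); rewrite /F /= => h.
  by have := lt_trans h (truncnS_gt (N w)); rewrite ltxx.
have := @nonincreasing_cvg_mu _ _ _ Q F.
rewrite F0 measure0 => /(_ _ mF measurable0) H.
have {H} : (Q \o F) x @[x --> \oo] --> 0%E.
  apply: H => [|k m km].
    by rewrite -ge0_fin_numE // fin_num_measure.
  apply/subsetPset => w; rewrite /F /=; apply: le_lt_trans; by rewrite ler_nat.
move/fine_cvg => /cvg_epsP/(_ eps e0)[k Hk].
exists k.+1%:R; split => // L kL; apply: (@le_trans _ _ (fine (Q (F k)))).
  apply: fine_le; rewrite ?fin_num_measure //; try exact: tail_measurable.
  apply: le_measure; rewrite ?inE //; try exact: tail_measurable.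
  by move=> w /=; exact: le_lt_trans.
by have := Hk k (leqnn _); rewrite subr0; apply: le_trans; exact: ler_norm.
Qed.

Lemma integral_approx (f p : 'rV[R]_n -> R) (C L eps : R) :
  continuous f -> (forall y, `|f y| <= C) -> trig_poly p ->
  (forall y, `|f y - p y| <= 2 * C) ->
  (forall y : 'rV[R]_n, (forall i, `|y 0 i| <= L) -> `|f y - p y| <= eps) -> 0 <= eps ->
  `|\int[Q]_w f (G w) - \int[Q]_w p (G w)| <= eps + 2 * C * fine (Q [set w | L < N w]).
Proof.
move=> fc fC tp fp2 fpe e0.
have C0 : 0 <= C by apply: le_trans (normr_ge0 _) (fC 0).
have [mp [Cp hp]] := trig_measurable_bounded tp.
have fi := bounded_prob_integrable (cont_comp_measurable fc) (fun w => fC (G w)).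
have pi := bounded_prob_integrable mp (fun w => hp (G w)).
have mA := tail_measurable L; set A := [set w | L < N w] in mA *.
rewrite -RintegralB //.
have mfp : measurable_fun setT (fun w => f (G w) - p (G w)).
  by apply: measurable_funB => //; exact: cont_comp_measurable.
have fpi := bounded_prob_integrable mfp (fun w => fp2 (G w)).
apply: (le_trans (le_normr_Rintegral _ _)) => //.
have mI : measurable_fun setT (\1_A : T -> R) by exact: measurable_indic.
have i1 : Q.-integrable setT (EFin \o (fun w => 2 * C * (\1_A w : R))).
  apply: (@bounded_prob_integrable _ (2 * C)); first exact: measurable_funM.
  move=> w; rewrite normrM ger0_norm ?mulr_ge0 // indicE.
  by case: (w \in A); rewrite /= ?normr1 ?normr0 ?mulr1 ?mulr0 // mulr_ge0.
have i2 : Q.-integrable setT (EFin \o (fun w => eps + 2 * C * (\1_A w : R))).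
  apply: (@bounded_prob_integrable _ (eps + 2 * C)).
    by apply: measurable_funD => //; exact: measurable_funM.
  move=> w; rewrite indicE; case: (w \in A); rewrite /= ?mulr1 ?mulr0 ?addr0 ger0_norm //.
    by rewrite addr_ge0 // mulr_ge0.
  by rewrite lerDl mulr_ge0.
apply: (@le_trans _ _ (\int[Q]_w (eps + 2 * C * (\1_A w : R)))).
  apply: le_Rintegral => //; first exact: integrable_norm.
  move=> w _; rewrite indicE; case: (boolP (w \in A)) => [_|].
    by rewrite /= mulr1; apply: (le_trans (fp2 _)); rewrite lerDr.
  rewrite notin_setE /A /= => /negP; rewrite -leNgt => NL; rewrite mulr0 addr0.
  apply: fpe => i; apply: le_trans NL; exact: (le_term_sum (F := fun i => `|G w 0 i|)).
have ic : Q.-integrable setT (EFin \o (fun=> eps)).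
  by apply: (@bounded_prob_integrable _ eps) => // w; rewrite ger0_norm.
have E0 : \int[Q]_(w in setT) eps = eps.
  by rewrite Rintegral_cst // [X in fine X]probability_setT mulr1.
rewrite RintegralD // E0 lerD2l.
rewrite RintegralZl //; last first.
  by apply: (@bounded_prob_integrable _ 1) => // w; rewrite indicE; case: (w \in A); rewrite /= ?normr1 ?normr0.
by rewrite /Rintegral integral_indic // setIT.
Qed.

End IntegralsOfRandomVectors.

Section CharacteristicFunctions.
Variable R : realType.

Lemma eq_by_eps (x y : R) : (forall eps, 0 < eps -> `|x - y| <= eps) -> x = y.
Proof.
move=> h; apply/eqP; rewrite -subr_eq0 -normr_le0; apply/ler_addgt0Pr => e e0.
by rewrite add0r; exact: h.
Qed.

Section Vectors.
Variables (n : nat).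
Variables (d d' : measure_display) (T : measurableType d) (T' : measurableType d').
Variables (Q : probability T R) (Q' : probability T' R).
Variables (G : T -> 'rV[R]_n) (G' : T' -> 'rV[R]_n).
Hypothesis mG : forall i, measurable_fun setT (fun w => G w 0 i).
Hypothesis mG' : forall i, measurable_fun setT (fun w => G' w 0 i).
Hypothesis charE : forall t a,
  \int[Q]_w cos (lin_form t (G w) + a) = \int[Q']_w cos (lin_form t (G' w) + a).

Lemma trig_integral_eq (p : 'rV[R]_n -> R) : trig_poly p ->
  \int[Q]_w p (G w) = \int[Q']_w p (G' w).
Proof.
elim=> [t a|a b f g tf IHf tg IHg]; first exact: charE.
have [mf [Cf hf]] := trig_measurable_bounded mG tf.
have [mg [Cg hg]] := trig_measurable_bounded mG tg.
have [mf' _] := trig_measurable_bounded mG' tf.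
have [mg' _] := trig_measurable_bounded mG' tg.
have if1 := bounded_prob_integrable Q mf (fun w => hf (G w)).
have ig1 := bounded_prob_integrable Q mg (fun w => hg (G w)).
have if2 := bounded_prob_integrable Q' mf' (fun w => hf (G' w)).
have ig2 := bounded_prob_integrable Q' mg' (fun w => hg (G' w)).
rewrite !RintegralD ?RintegralZl //; try exact: scale_integrable.
by rewrite IHf IHg.
Qed.

Lemma cont_integral_eq (f : 'rV[R]_n -> R) (C : R) : continuous f ->
  (forall y, `|f y| <= C) -> \int[Q]_w f (G w) = \int[Q']_w f (G' w).
Proof.
move=> fc fC; apply: eq_by_eps => eps e0.
have C0 : 0 <= C by apply: le_trans (normr_ge0 _) (fC 0).
have dd0 : 0 < eps / (8 * (C + 1)) by rewrite divr_gt0 //; lra.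
have [L [L0 hL]] := tail_small Q mG dd0.
have [L' [L0' hL']] := tail_small Q' mG' dd0.
pose L2 := Num.max L L'.
have e4 : 0 < eps / 4 by lra.
have L20 : 0 < L2 by rewrite lt_max L0.
have [p [tp p2 pe]] := trig_approx fc fC L20 e4.
have h1 := integral_approx Q mG fc fC tp p2 pe (ltW e4).
have h2 := integral_approx Q' mG' fc fC tp p2 pe (ltW e4).
have CC x : x <= eps / (8 * (C + 1)) -> 2 * C * x <= eps / 4.
  move/(ler_wpM2l (mulr_ge0 (ler0n R 2) C0)) => /le_trans; apply.
  by rewrite mulrA ler_pdivrMr; [nra|lra].
have h3 := CC _ (hL L2 ltac:(by rewrite le_max lexx)).
have h4 := CC _ (hL' L2 ltac:(by rewrite le_max lexx orbT)).
have := trig_integral_eq tp => E; rewrite -E in h2.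
have := ler_distD (\int[Q]_w p (G w)) (\int[Q]_w f (G w)) (\int[Q']_w f (G' w)).
rewrite [`|\int[Q]_w p (G w) - _|]distrC; lra.
Qed.

End Vectors.

Section Scalars.
Variables (d d' : measure_display) (T : measurableType d) (T' : measurableType d').
Variables (Q : probability T R) (Q' : probability T' R).
Variables (X : T -> R) (X' : T' -> R).
Hypothesis mX : measurable_fun setT X.
Hypothesis mX' : measurable_fun setT X'.
Hypothesis charE : forall t a, \int[Q]_w cos (t * X w + a) = \int[Q']_w cos (t * X' w + a).

Lemma scalar_integral_eq (f : R -> R) (C : R) : continuous f ->
  (forall y, `|f y| <= C) -> \int[Q]_w f (X w) = \int[Q']_w f (X' w).
Proof.
move=> fc fC.
pose F (y : 'rV[R]_1) := f (y 0 0).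
have Fc : continuous F.
  move=> y; apply: (@continuous_comp _ _ _ (fun y : 'rV[R]_1 => y 0 0) f).
    exact: coord_continuous.
  exact: fc.
have FE (d0 : measure_display) (T0 : measurableType d0) (Q0 : probability T0 R) (Y : T0 -> R) :
    \int[Q0]_w f (Y w) = \int[Q0]_w F (const_mx (Y w)).
  by apply: eq_Rintegral => w _; rewrite /F mxE.
rewrite (FE _ _ Q X) (FE _ _ Q' X'); apply: (cont_integral_eq _ _ _ Fc (fun y => fC (y 0 0))).
- by move=> i; under eq_fun do rewrite mxE.
- by move=> i; under eq_fun do rewrite mxE.
move=> t a.
have lE x : lin_form t (const_mx x) = t 0 0 * x.
  by rewrite lin_formE big_ord1 mxE mulrC.
under eq_Rintegral do rewrite lE.
under [RHS]eq_Rintegral do rewrite lE.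
exact: charE.
Qed.

(** An inequality suffices, since the hypotheses are symmetric in the two laws. The ray is exhausted
    by the rays from c + 1/(k + 1), and a continuous ramp fits between the indicators of the two
    rays. *)
Lemma ray_measure_le (c : R) : (Q [set w | (c < X w)%R] <= Q' [set w | (c < X' w)%R])%E.
Proof.
have mray (d0 : measure_display) (T0 : measurableType d0) (Y : T0 -> R) (b : R) :
    measurable_fun setT Y -> measurable [set w | b < Y w].
  move=> mY; have -> : [set w | b < Y w] = setT `&` Y @^-1` `]b, +oo[.
    by rewrite setTI; apply/seteqP; split => w /=; rewrite in_itv /= andbT.
  exact: mY.
pose F (k : nat) := [set w | c + k.+1%:R^-1 < X w].
have mF k : measurable (F k) by exact: mray.
have FE : \bigcup_k F k = [set w | c < X w].
  apply/seteqP; split => [w [k _]|w /= cX].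
    by rewrite /F /=; apply: lt_trans; rewrite ltrDl invr_gt0.
  have e0 : 0 < (X w - c) / 2 by rewrite divr_gt0 // subr_gt0.
  have [k [_ Hk]] := inv_small 1 e0; exists k => //; rewrite /F /=.
  have := Hk k.+1 (leqnSn _); rewrite mul1r; move: (k.+1%:R^-1 : R) => z; lra.
have lim := @nondecreasing_cvg_mu _ _ _ Q F mF.
rewrite FE in lim.
have {}lim : (Q \o F) x @[x --> \oo] --> Q [set w | c < X w].
  apply: lim; first exact: mray.
  move=> k m km; apply/subsetPset => w; rewrite /F /=; apply: le_lt_trans.
  by rewrite lerD2l lef_pV2 ?posrE // ler_nat.
rewrite -(cvg_lim _ lim) //; apply: lime_le; first by apply/cvg_ex; exists (Q [set w | c < X w]).
apply: nearW => k /=.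
pose f (x : R) := Num.min 1 (Num.max 0 (k.+1%:R * (x - c))).
have fc : continuous f.
  move=> x; apply: (@continuous_min R R (fun=> 1) (fun x => Num.max 0 (k.+1%:R * (x - c))) x).
    exact: cvg_cst.
  apply: (@continuous_max R R (fun=> 0) (fun x => k.+1%:R * (x - c)) x); first exact: cvg_cst.
  apply: cvgM; first exact: cvg_cst.
  by apply: cvgB; [exact: cvg_id|exact: cvg_cst].
have f0 x : 0 <= f x by rewrite /f le_min ler01 le_max lexx.
have f1 x : f x <= 1 by rewrite /f ge_min lexx.
have fn x : `|f x| <= 1 by rewrite ger0_norm.
have mfc (d0 : measure_display) (T0 : measurableType d0) (Y : T0 -> R) : measurable_fun setT Y ->
    measurable_fun setT (fun w => f (Y w)).
  by move=> mY; apply: (@measurableT_comp _ _ _ _ _ _ f) => //; exact: continuous_measurable_fun.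
have k0 : 0 < k.+1%:R :> R by [].
have lo : (Q (F k) <= (\int[Q]_w f (X w))%:E)%E.
  rewrite /Rintegral fineK; last first.
    by apply: integrable_fin_num => //; exact: (bounded_prob_integrable Q (mfc _ _ _ mX) (fun w => fn _)).
  rewrite -[F k]setIT -integral_indic //.
  apply: ge0_le_integral => //; try (by move=> w _; rewrite lee_fin).
  - by apply/measurable_EFinP; exact: measurable_indic.
  - by apply/measurable_EFinP; exact: mfc.
  move=> w _; rewrite lee_fin indicE; case: (boolP (w \in F k)) => [|_]; last exact: f0.
  rewrite inE /F /= => h.
  rewrite /f le_min lexx le_max; apply/orP; right.
  rewrite mulrC -ler_pdivrMr // mul1r; move: h; move: (k.+1%:R^-1 : R) => z; lra.
have hi : ((\int[Q']_w f (X' w))%:E <= Q' [set w | (c < X' w)%R])%E.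
  rewrite /Rintegral fineK; last first.
    by apply: integrable_fin_num => //; exact: (bounded_prob_integrable Q' (mfc _ _ _ mX') (fun w => fn _)).
  rewrite -[X in Q' X]setIT -integral_indic //; last exact: mray.
  apply: ge0_le_integral => //; try (by move=> w _; rewrite lee_fin).
  - by apply/measurable_EFinP; exact: mfc.
  - by apply/measurable_EFinP; apply: measurable_indic; exact: mray.
  move=> w _; rewrite lee_fin indicE; case: (boolP (w \in _)) => [_|]; first exact: f1.
  rewrite notin_setE /= => /negP; rewrite -leNgt => h.
  rewrite /f ge_min; apply/orP; right; rewrite ge_max lexx /=.
  by rewrite pmulr_rle0 // subr_le0.
by apply: (le_trans lo); rewrite (scalar_integral_eq fc fn).
Qed.

End Scalars.

Lemma charfun_unique (d d' : measure_display) (T : measurableType d) (T' : measurableType d')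
    (Q : probability T R) (Q' : probability T' R) (X : T -> R) (X' : T' -> R) :
  measurable_fun setT X -> measurable_fun setT X' ->
  (forall t a, \int[Q]_w cos (t * X w + a) = \int[Q']_w cos (t * X' w + a)) ->
  forall B : set R, measurable B -> Q (X @^-1` B) = Q' (X' @^-1` B).
Proof.
move=> mX mX' charE B mB.
pose Y : {mfun T >-> R} := mfun_Sub (mem_set mX : X \in mfun).
pose Y' : {mfun T' >-> R} := mfun_Sub (mem_set mX' : X' \in mfun).
suff : distribution Q Y B = distribution Q' Y' B by [].
apply: (@g_sigma_algebra_measure_unique _ R _ (@RGenOInfty.G R) _ (fun k : nat => `](- k%:R), +oo[%classic)) => //.
- by move=> _ [x ->].
- by move=> k; exists (- k%:R).
- apply/seteqP; split => // x _; exists (Num.truncn `|x|).+1 => //=; rewrite in_itv /= andbT.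
  have := truncnS_gt `|x|; have := ler_norm (- x); rewrite normrN; lra.
- move=> _ _ [x ->] [y ->]; exists (Num.max x y); apply/seteqP; split => z /=;
    by rewrite !in_itv /= !andbT gt_max => /andP.
- move=> _ [x ->].
  suff : Q (X @^-1` `]x, +oo[) = Q' (X' @^-1` `]x, +oo[) by [].
  have H (T0 : Type) (Z : T0 -> R) : Z @^-1` `]x, +oo[ = [set w | x < Z w].
    by apply/seteqP; split => w /=; rewrite in_itv /= andbT.
  rewrite !H; apply/eqP; rewrite eq_le; apply/andP; split; first exact: ray_measure_le.
  by apply: ray_measure_le => // t a; rewrite charE.
- by move=> k; rewrite -ge0_fin_numE // fin_num_measure.
- by rewrite -[X in X B]RGenOInfty.measurableE.
Qed.

End CharacteristicFunctions.

Section GaussianVectors.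
Variables (R : realType) (n : nat).

(** The probability space is existential because each rank-one term of the covariance enlarges it by
    an independent factor. *)
Definition has_gaussian (M : 'M[R]_n) : Prop :=
  exists (d : measure_display) (T : measurableType d) (Q : probability T R) (G : T -> 'rV[R]_n),
    (forall i, measurable_fun setT (fun w => G w 0 i)) /\
    forall t a, \int[Q]_w cos (lin_form t (G w) + a) =
      expR (- ((t *m M *m t^T) 0 0 / 2)) * cos a.

Lemma has_gaussian0 : has_gaussian 0.
Proof.
exists _, _, (normal_prob (0:R) 1), (fun=> 0); split => [i|t a].
  exact: measurable_cst.
have -> : (t *m (0 : 'M[R]_n) *m t^T) 0 0 = 0 by rewrite mulmx0 mul0mx mxE.
rewrite mul0r oppr0 expR0 mul1r.
have -> : lin_form t 0 = 0 by rewrite lin_formE big1 // => i _; rewrite mxE mul0r.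
rewrite add0r Rintegral_cst // [X in fine X]probability_setT mulr1 //.
Qed.

(** G + xi v, with xi standard normal on the second factor of a product space; by Fubini, xi
    contributes exp (- <t, v>^2 / 2). *)
Lemma has_gaussian_rank1 (M : 'M[R]_n) (v : 'rV[R]_n) :
  has_gaussian M -> has_gaussian (v^T *m v + M).
Proof.
move=> [d [T [Q [G [mG GE]]]]].
pose N : probability (measurableTypeR R) R := normal_prob (0:R) 1.
pose G' (z : T * measurableTypeR R) : 'rV[R]_n := G z.1 + (z.2 : R) *: v.
have mz2 : measurable_fun setT (fun z : T * measurableTypeR R => z.2 : R) by exact: measurable_snd.
have mG' i : measurable_fun setT (fun z => G' z 0 i).
  have -> : (fun z => G' z 0 i) = (fun z => G z.1 0 i + z.2 * v 0 i).
    by apply/funext => z; rewrite /G' !mxE.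
  apply: measurable_funD.
    exact: (measurableT_comp (mG i) measurable_fst).
  exact: measurable_funM.
exists _, _, (Q \x N)%E, G'; split => // t a.
have mc : measurable_fun setT (fun z => cos (lin_form t (G' z) + a)).
  by apply: cos_comp_measurable; apply: measurable_funD => //; exact: lin_form_measurable.
have ci := bounded_prob_integrable (Q \x N)%E mc (fun z => cos_max _).
have lE z : lin_form t (G' z) + a = lin_form t v * z.2 + (lin_form t (G z.1) + a).
  have -> : lin_form t (G' z) = lin_form t (G z.1) + lin_form t v * z.2.
    rewrite /G' !lin_formE mulr_suml -big_split /=; apply: eq_bigr => i _.
    by rewrite !mxE; ring.
  by ring.
have qE : (t *m (v^T *m v + M) *m t^T) 0 0 = lin_form t v ^+ 2 + (t *m M *m t^T) 0 0.
  rewrite mulmxDr mulmxDl mxE; congr (_ + _).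
  rewrite mulmxA -mulmxA mxE big_ord1 expr2; congr (_ * _).
  by rewrite lin_formE mxE; apply: eq_bigr => i _; rewrite mxE mulrC.
rewrite /Rintegral -(integral12_prod_meas1 ci).
have inner w : fubini_F N (EFin \o (fun z => cos (lin_form t (G' z) + a))) w =
    (expR (- (lin_form t v ^+ 2 / 2)) * cos (lin_form t (G w) + a))%:E.
  rewrite /fubini_F /=.
  under eq_integral do rewrite lE /=.
  by rewrite normal_charfun ?oner_neq0 // expr1n; congr ((expR _ * _)%:E); ring.
under eq_integral do rewrite inner.
have mc1 : measurable_fun setT (fun w => cos (lin_form t (G w) + a)).
  by apply: cos_comp_measurable; apply: measurable_funD => //; exact: lin_form_measurable.
have ci1 := bounded_prob_integrable Q mc1 (fun z => cos_max _).
rewrite -[fine _]/(\int[Q]_w (expR (- (lin_form t v ^+ 2 / 2)) * cos (lin_form t (G w) + a))).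
rewrite RintegralZl // GE qE mulrA -expRD; congr (expR _ * _); ring.
Qed.

Lemma has_gaussian_psd (M : 'M[R]_n) : symmetric_psd M -> has_gaussian M.
Proof.
move=> /psd_sum_rank1[s ->]; elim: s => [|v s IH].
  by rewrite big_nil; exact: has_gaussian0.
by rewrite big_cons; exact: has_gaussian_rank1.
Qed.

Lemma gaussian_law_linear (M : 'M[R]_n) (d : measure_display) (T : measurableType d)
    (Q : probability T R) (G : T -> 'rV[R]_n) : symmetric_psd M ->
  (forall i, measurable_fun setT (fun w => G w 0 i)) ->
  (forall t a, \int[Q]_w cos (lin_form t (G w) + a) =
      expR (- ((t *m M *m t^T) 0 0 / 2)) * cos a) ->
  forall (u : 'rV[R]_n) (B : set R), measurable B ->
    Q [set w | B (lin_form u (G w))] = normal_law 0 ((u *m M *m u^T) 0 0) B.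
Proof.
move=> [_ Mpsd] mG GE u B mB.
set v := (u *m M *m u^T) 0 0.
have v0 : 0 <= v by exact: Mpsd.
have mX := lin_form_measurable mG u.
have XE t a : \int[Q]_w cos (t * lin_form u (G w) + a) = expR (- (t ^+ 2 * v / 2)) * cos a.
  under eq_Rintegral do rewrite -lin_formZ.
  rewrite GE; congr (expR (- (_ / 2)) * _).
  rewrite -!scalemxAl [(t *: u)^T]linearZ /= -scalemxAr [LHS]mxE [X in _ * X]mxE.
  by rewrite mulrA -expr2.
rewrite /normal_law; case: eqVneq => [vE|vn0].
  have := @charfun_unique R _ _ T _ Q (\d_(0:R) : probability _ R) (fun w => lin_form u (G w)) idfun mX (@measurable_id _ _ _) _ B mB.
  apply => t a; rewrite XE vE mulr0 mul0r oppr0 expR0 mul1r.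
  rewrite /Rintegral integral_dirac //=; last first.
    apply/measurable_EFinP; apply: cos_comp_measurable; apply: measurable_funD => //.
  by rewrite indicE in_setT mul1r mulr0 add0r.
have s0 : Num.sqrt v != 0 by rewrite sqrtr_eq0 -ltNge lt_neqAle eq_sym vn0.
pose N : probability (measurableTypeR R) R := normal_prob (0:R) (Num.sqrt v).
have mid : measurable_fun setT (idfun : measurableTypeR R -> R) by exact: measurable_id.
have := @charfun_unique R _ _ T _ Q N (fun w => lin_form u (G w)) idfun mX mid _ B mB.
apply => t a; rewrite XE /Rintegral.
rewrite [X in _ = fine X](normal_charfun a t s0) /= sqr_sqrtr //.
by congr (expR _ * _); ring.
Qed.

Lemma multivariate_normal_exists (M : 'M[R]_n) : symmetric_psd M ->
  exists mu : probability (borel_rV R n) R, multivariate_normal 0 M mu /\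
    forall t a, \int[mu]_y cos (lin_form t y + a) =
      expR (- ((t *m M *m t^T) 0 0 / 2)) * cos a.
Proof.
move=> Mpsd; have [d [T [Q [G [mG GE]]]]] := has_gaussian_psd Mpsd.
have mGb := measurable_rV mG.
pose Gm : {mfun T >-> borel_rV R n} := mfun_Sub (mem_set mGb : (G : T -> borel_rV R n) \in mfun).
exists (distribution Q Gm); split.
  move=> u B mB; rewrite mul0mx mxE.
  by rewrite -(gaussian_law_linear Mpsd mG GE u mB).
move=> t a; rewrite -GE /Rintegral; congr fine.
have mid i : measurable_fun setT (fun y : borel_rV R n => (y : 'rV[R]_n) 0 i).
  exact: coord_measurable.
have mc : measurable_fun setT (fun y : borel_rV R n => cos (lin_form t y + a)).
  apply: cos_comp_measurable; apply: measurable_funD => //.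
  exact: (@lin_form_measurable R n _ _ (fun y : borel_rV R n => (y : 'rV[R]_n)) mid).
rewrite integral_distribution //; first exact/measurable_EFinP.
apply: (@bounded_prob_integrable _ _ _ _ _ 1) => [|w]; last exact: cos_max.
by apply: cos_comp_measurable; apply: measurable_funD => //; exact: lin_form_measurable.
Qed.

End GaussianVectors.

(** * The martingale of the recursion *)

Section UvnChain.
Variables (R : realType) (d : nat) (A P : 'M[R]_d).
Hypothesis Pst : stochastic P.
Hypothesis P_support : forall i j, 0 < P i j <-> A i j != 0.
Hypothesis Pirr : irreducible_mx P.
Hypothesis Paper : aperiodic_mx P.
Hypothesis A_rho : spectral_radius A < 1.
Hypothesis H_rho : spectral_radius (Hhat A P) < 1.

Definition uvn_chain_state : Type := ('I_d * uvn_state R d)%type.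
Local Notation S := uvn_chain_state.
Definition uvn_pos (s : S) : 'I_d := s.1.
Definition uvn_mv (s : S) (y : 'I_d) : S := (y, uvn_step A P s.1 y s.2).
Definition uvn_ref (x : 'I_d) : S := (x, UvnState 0 0 (const_mx 0%N)).
Definition uvn_r (x y : 'I_d) : R := A x y / P x y.
(* Lambda after step (a). *)
Definition uvn_L (s : S) (i j : 'I_d) : R :=
  if (i == s.1) && (uvn_Lambda s.2 i j == 0) then 1 else uvn_Lambda s.2 i j.

Local Notation p := (chain_p P uvn_pos).
Local Notation V := (chain_V uvn_L).
Local Notation T := (markov_op p uvn_mv).
Local Notation E n := (iter n (markov_op p uvn_mv)).

Let P_ge0 x y : 0 <= P x y. Proof. by case: Pst => + _; exact. Qed.

Lemma support0 x y : P x y = 0 -> A x y = 0.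
Proof.
move=> h; apply/eqP/negPn/negP => /P_support; by rewrite h ltxx.
Qed.

Lemma P_r x y : P x y * uvn_r x y = A x y.
Proof.
rewrite /uvn_r; case: (eqVneq (P x y) 0) => [h|h]; last by rewrite mulrC divfK.
by rewrite h mul0r support0.
Qed.

Lemma r_neq0 x y : 0 < P x y -> uvn_r x y != 0.
Proof. by move=> h; rewrite mulf_neq0 ?invr_eq0 ?(gt_eqF h) //; apply/P_support. Qed.

Lemma HhatE x y : Hhat A P x y = P x y * uvn_r x y ^+ 2.
Proof.
rewrite mxE /uvn_r; case: eqVneq => [->|h]; first by rewrite mul0r.
by field.
Qed.

(** On possible transitions the ratio A / P is nonzero, so weights never vanish by multiplication: a
    zero entry means that no path is pending, and step (a) at the new state y fills exactly the
    zeros of row y. *)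
Lemma uvn_L_mv s y i j : 0 < P (uvn_pos s) y ->
  uvn_L (uvn_mv s y) i j = if y == j then (i == j)%:R else
                   if uvn_L s i j == 0 then (i == y)%:R else uvn_L s i j * uvn_r (uvn_pos s) y.
Proof.
move=> Py; have r0 := r_neq0 Py.
rewrite {1}/uvn_L /= !mxE -/(uvn_L s i j) -/(uvn_r s.1 y) [j == y]eq_sym.
case: (eqVneq y j) => [yj|yj].
  by rewrite eqxx andbT yj; case: (i == j).
rewrite mulf_eq0 (negbTE r0) /=.
case: (eqVneq (uvn_L s i j) 0) => [->|L0].
  by rewrite mulr0 andbT; case: (i == y).
by rewrite andbF mulrC.
Qed.

Lemma uvn_w : exists (w : 'I_d -> R) (q : R), (forall x, 1 <= w x) /\ 0 <= q < 1 /\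
  (forall x, \sum_y P x y * (uvn_r x y ^+ 2 * w y) <= q * w x).
Proof.
have H0 i j : 0 <= Hhat A P i j by rewrite HhatE mulr_ge0 ?sqr_ge0.
have [w [w1 wE]] := lyapunov_of_unitmx H0 (unitmx_of_spectral_radius H_rho).
have [q [q01 qw]] := lyapunov_contract w1 wE.
exists w, q; split => //; split => // x; apply: le_trans (qw x).
by apply: ler_sum => y _; rewrite HhatE mulrA.
Qed.

Lemma uvn_killed j : exists v q, (forall x : 'I_d, 1 <= v x) /\
  0 <= q < 1 /\ forall x, \sum_(y | y != j) P x y * v y <= q * v x.
Proof.
have H0 i k : 0 <= killed_mx P j i k by rewrite mxE; case: ifP.
have [w [w1 wE]] := lyapunov_of_unitmx H0 (fun t => @killed_unitmx _ _ _ Pst j Pirr t).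
have [q [q01 qw]] := lyapunov_contract w1 wE.
exists w, q; split => //; split => // x; apply: le_trans (qw x).
rewrite big_mkcond; apply: ler_sum => y _; rewrite mxE.
by case: (y == j) => //=; rewrite mul0r.
Qed.

Lemma uvn_pos_mv s y : uvn_pos (uvn_mv s y) = y. Proof. by []. Qed.
Lemma uvn_pos_ref x : uvn_pos (uvn_ref x) = x. Proof. by []. Qed.

Lemma uvn_prim : exists N, forall n, (N <= n)%N -> forall i j, 0 < (P ^+ n) i j.
Proof. exact: primitive_of_aperiodic. Qed.

Lemma uvn_V1 s : 1 <= V s.
Proof. by rewrite lerDl sumr_ge0 // => i _; apply: sumr_ge0 => j _; exact: sqr_ge0. Qed.
Lemma uvn_V0 s : 0 <= V s. Proof. by apply: le_trans (uvn_V1 s). Qed.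

Lemma uvn_L_V s i j : `|uvn_L s i j| <= Num.sqrt (V s).
Proof.
rewrite -sqrtr_sqr ler_wsqrtr // /chain_V pair_big /=.
have := le_term_sum (F := fun ij => uvn_L s ij.1 ij.2 ^+ 2) (i, j) (fun ij => sqr_ge0 _).
by rewrite /=; lra.
Qed.

Lemma uvn_V_bnd : exists C, 0 <= C /\ forall n s, E n V s <= C * V s.
Proof.
have [w [q [w1 [q01 wd]]]] := uvn_w.
exact: (chain_V_bnd Pst uvn_pos_mv uvn_L_mv w1 q01 wd).
Qed.

Lemma uvn_ui eta : 0 < eta -> exists B, 0 <= B /\
  forall n x, E n (fun s => if B < V s then V s else 0) (uvn_ref x) <= eta.
Proof.
have [w [q [w1 [q01 wd]]]] := uvn_w.
exact: (chain_ui Pst uvn_pos_mv uvn_pos_ref uvn_L_mv w1 q01 wd uvn_killed).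
Qed.

Definition mixes (G : S -> R) (c : R) := forall eps, 0 < eps -> exists m0, forall m, (m0 <= m)%N ->
    forall s, `|E m G s - c| <= eps * V s.

Lemma uvn_mix (G : S -> R) (B : R) : chain_local uvn_pos uvn_L G ->
  (forall s, `|G s| <= B * V s) -> exists c, mixes G c.
Proof.
move=> Gl GB.
have [w [q [w1 [q01 wd]]]] := uvn_w.
pose B' := 1 + `|B|.
have B'0 : 0 < B' by rewrite /B' ltr_pwDl.
have := @chain_mix R d P uvn_r S uvn_pos uvn_L uvn_mv uvn_ref Pst uvn_prim uvn_pos_mv uvn_pos_ref uvn_L_mv w q w1 q01 wd uvn_killed (fun s => B'^-1 * G s).
case.
- by move=> s s' h1 h2; rewrite (Gl s s').
- move=> s; rewrite normrM gtr0_norm ?invr_gt0 // ler_pdivrMl //.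
  apply: (le_trans (GB s)); rewrite ler_wpM2r ?uvn_V0 // /B'.
  by have := ler_norm B; lra.
move=> c Hc; exists (B' * c) => eps e0.
have [m0 Hm] := Hc (eps / B') (divr_gt0 e0 B'0); exists m0 => m hm s.
have := Hm m hm s; rewrite markE_Z => h.
have -> : E m G s - B' * c = B' * (B'^-1 * E m G s - c) by field; rewrite gt_eqF.
rewrite normrM (gtr0_norm B'0) -ler_pdivlMl // ; apply: (le_trans h).
by rewrite mulrAC mulrC.
Qed.

Lemma mixes_sum (I : Type) (r : seq I) (a c : I -> R) (G : I -> S -> R) :
  (forall i, mixes (G i) (c i)) ->
  mixes (fun s => \sum_(i <- r) a i * G i s) (\sum_(i <- r) a i * c i).
Proof.
move=> H; elim: r => [|i r IH] eps e0.
  exists 0%N => m _ s; under markE_eq do rewrite big_nil; rewrite big_nil.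
  rewrite (markE_cst uvn_mv (chain_p_sum _ Pst)) subrr normr0.
  by rewrite mulr_ge0 ?uvn_V0 // ltW.
have [m1 H1] := IH (eps / 2) ltac:(lra).
have a0 : 0 < 1 + `|a i| by rewrite ltr_pwDl.
have [m2 H2] := H i (eps / 2 / (1 + `|a i|)) ltac:(rewrite divr_gt0 //; lra).
exists (maxn m1 m2) => m; rewrite geq_max => /andP[hm1 hm2] s.
under markE_eq do rewrite big_cons; rewrite big_cons markE_D markE_Z.
have h1 := H1 m hm1 s; have h2 := H2 m hm2 s.
have -> : a i * E m (G i) s + E m (fun s => \sum_(j <- r) a j * G j s) s -
   (a i * c i + \sum_(j <- r) a j * c j) =
   a i * (E m (G i) s - c i) + (E m (fun s => \sum_(j <- r) a j * G j s) s - \sum_(j <- r) a j * c j) by ring.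
apply: (le_trans (ler_normD _ _)); rewrite normrM.
have : `|a i| * `|E m (G i) s - c i| <= eps / 2 * V s.
  apply: (@le_trans _ _ ((1 + `|a i|) * (eps / 2 / (1 + `|a i|) * V s))).
    by apply: ler_pM => //; lra.
  by rewrite mulrA mulrC [X in V s * X]mulrC divfK ?gt_eqF // mulrC.
lra.
Qed.

Lemma mixes_ge0 (G : S -> R) (c : R) (s : S) : (forall s, 0 <= G s) -> mixes G c -> 0 <= c.
Proof.
move=> G0 H; apply: (@le_of_forall_eps _ 0 c (V s)) => eps e0.
have [m Hm] := H eps e0; have := Hm m (leqnn m) s.
have : 0 <= E m G s by exact: (markE_ge0 uvn_mv (chain_p_ge0 _ Pst) (chain_p_sum _ Pst)).
rewrite ler_norml => h /andP[h1 h2]; lra.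
Qed.

Definition uvn_C : 'M[R]_d := invmx (1%:M - A).

Lemma uvn_CE : uvn_C = 1%:M + A *m uvn_C.
Proof.
have U : 1%:M - A \in unitmx.
  have := unitmx_of_spectral_radius A_rho (t := 1); rewrite scale1r; apply.
  by rewrite ler01 lexx.
have := mulmxV U; rewrite -/uvn_C mulmxBl mul1mx => /eqP; rewrite subr_eq => /eqP.
by [].
Qed.

(* If C j j = 0, the column v = C e_j satisfies v = A v off j and v j = 0, so
   v^2 <= Hhat v^2 by the Cauchy-Schwarz inequality, which forces v = 0. *)
Lemma uvn_Cjj j : uvn_C j j != 0.
Proof.
apply/eqP => Cj0.
have [w [q [w1 [q01 wd]]]] := uvn_w.
have H0 i k : 0 <= Hhat A P i k by rewrite HhatE mulr_ge0 ?sqr_ge0.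
have CE i k : uvn_C i k = (i == k)%:R + \sum_y A i y * uvn_C y k.
  by rewrite {1}uvn_CE mxE [X in X + _]mxE [X in _ + X]mxE.
have jensen x : (\sum_y A x y * uvn_C y j) ^+ 2 <= \sum_y Hhat A P x y * uvn_C y j ^+ 2.
  set b := \sum_y A x y * uvn_C y j.
  have : 0 <= \sum_y P x y * (uvn_r x y * uvn_C y j - b) ^+ 2.
    by apply: sumr_ge0 => y _; rewrite mulr_ge0 ?sqr_ge0.
  have -> : \sum_y P x y * (uvn_r x y * uvn_C y j - b) ^+ 2 =
     \sum_y (Hhat A P x y * uvn_C y j ^+ 2 - 2 * b * (A x y * uvn_C y j) + b ^+ 2 * P x y).
    by apply: eq_bigr => y _; rewrite HhatE -P_r; ring.
  rewrite big_split sumrB /= -!mulr_sumr -/b.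
  by case: Pst => _ ->; lra.
have v0 x : uvn_C x j ^+ 2 <= 0.
  apply: (@lyapunov_le0 _ _ (Hhat A P) w q H0 w1 q01 _ (fun x => uvn_C x j ^+ 2)) => [i|i].
    apply: le_trans (wd i); apply: ler_sum => y _; by rewrite HhatE mulrA.
  have [ij|ij] := eqVneq i j.
    by rewrite ij Cj0 expr0n /=; apply: sumr_ge0 => y _; rewrite mulr_ge0 ?sqr_ge0.
  apply: le_trans (jensen i); by rewrite {1}CE (negbTE ij) add0r.
have C0 x : uvn_C x j = 0.
  by apply/eqP; rewrite -sqrf_eq0 eq_le v0 sqr_ge0.
have := CE j j; rewrite Cj0 eqxx big1 ?addr0 => [/eqP|y _]; last by rewrite C0 mulr0.
by rewrite eq_sym oner_eq0.
Qed.

Definition uvn_G (y j : 'I_d) : R := uvn_C y j / uvn_C j j.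
Definition uvn_F (x j : 'I_d) : R := \sum_y A x y * uvn_G y j.

Lemma uvn_Gjj j : uvn_G j j = 1. Proof. by rewrite /uvn_G divff ?uvn_Cjj. Qed.

Lemma uvn_FE x j : uvn_F x j = uvn_G x j - (x == j)%:R / uvn_C j j.
Proof.
rewrite /uvn_F /uvn_G.
under eq_bigr do rewrite mulrA.
rewrite -mulr_suml -mulrBl; congr (_ / _).
have := uvn_CE => /matrixP/(_ x j); rewrite [in RHS]mxE [X in X + _]mxE [X in _ + X]mxE => ->.
by ring.
Qed.

Lemma uvn_FG y j : y != j -> uvn_F y j = uvn_G y j.
Proof. by move=> h; rewrite uvn_FE (negbTE h) mul0r subr0. Qed.

(* [uvn_M] is a martingale: while row i has a pending weight towards j, the
   correction adds the expected final contribution to [uvn_dev]. *)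
Definition uvn_corr (s : S) (i j : 'I_d) : R :=
  if uvn_L s i j == 0 then 0 else uvn_L s i j * uvn_F s.1 j - uvn_F i j.

Definition uvn_dev (s : S) (i j : 'I_d) : R :=
  uvn_Sigma s.2 i j - uvn_F i j * (uvn_Gamma s.2 i j)%:R.

Definition uvn_M (s : S) (i j : 'I_d) : R := uvn_dev s i j + uvn_corr s i j.

Definition uvn_k (j x y : 'I_d) : R := uvn_r x y * uvn_G y j - uvn_F x j.

Lemma uvn_Gamma_mv s y i j : 0 < P (uvn_pos s) y ->
  (uvn_Gamma (uvn_mv s y).2 i j)%:R - (uvn_Gamma s.2 i j)%:R =
  ((y == j) && (uvn_L s i j != 0))%:R :> R.
Proof.
move=> Py; have r0 := r_neq0 Py.
rewrite /= !mxE -/(uvn_L s i j) -/(uvn_r s.1 y) [j == y]eq_sym.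
rewrite mulf_eq0 (negbTE r0) /=.
by case: ifP => _; rewrite ?subrr // -natr1 addrC addKr.
Qed.

(** A path starting at y brings the correction 1 * F y j - F y j = 0, so starts are invisible. A
    path ending at j trades its pending L F for L r = L r G j j. A path continuing to y != j becomes
    L r F y j, where F y j = G y j. *)
Lemma uvn_M_mv s y i j : 0 < P (uvn_pos s) y ->
  uvn_M (uvn_mv s y) i j - uvn_M s i j = uvn_L s i j * uvn_k j (uvn_pos s) y.
Proof.
move=> Py; have hG := uvn_Gamma_mv i j Py.
have {}hG : (uvn_Gamma (uvn_mv s y).2 i j)%:R = (uvn_Gamma s.2 i j)%:R + ((y == j) && (uvn_L s i j != 0))%:R :> R.
  by rewrite -hG addrC subrK.
rewrite /uvn_M /uvn_dev hG /uvn_corr uvn_L_mv // /= !mxE -/(uvn_L s i j) -/(uvn_r s.1 y).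
rewrite /uvn_k /uvn_pos [j == y]eq_sym.
case: (eqVneq y j) => [->|yj] /=.
  have -> : (if (i == j)%:R == 0 :> R then 0 else (i == j)%:R * uvn_F j j - uvn_F i j) = 0.
    have [->|_] := eqVneq i j; first by rewrite oner_eq0 mul1r subrr.
    by rewrite eqxx.
  rewrite uvn_Gjj; case: eqVneq => [->|_] /=; ring.
rewrite (uvn_FG yj).
case: (eqVneq (uvn_L s i j) 0) => [->|L0].
  case: (eqVneq i y) => [->|_] /=; last by rewrite eqxx; ring.
  by rewrite oner_eq0 (uvn_FG yj); ring.
have r0 := r_neq0 Py.
rewrite mulf_eq0 (negbTE L0) (negbTE r0) /=; ring.
Qed.

Lemma uvn_M_ref x i j : uvn_M (uvn_ref x) i j = 0.
Proof.
rewrite /uvn_M /uvn_dev /uvn_corr /uvn_L /= !mxE eqxx andbT mulr0 subrr add0r.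
have [->|_] := eqVneq i x; last by rewrite eqxx.
by rewrite oner_eq0 mul1r subrr.
Qed.

Lemma uvn_k_mean j x : \sum_y P x y * uvn_k j x y = 0.
Proof.
under eq_bigr do rewrite mulrBr mulrA P_r.
by rewrite sumrB -mulr_suml; case: Pst => _ ->; rewrite mul1r subrr.
Qed.

Let I := ('I_d * 'I_d)%type.
Definition uvn_lin (t : I -> R) (s : S) : R := \sum_a t a * uvn_M s a.1 a.2.
Definition uvn_inc (s : S) (y : 'I_d) (a : I) : R := uvn_L s a.1 a.2 * uvn_k a.2 (uvn_pos s) y.
Definition uvn_cov (ab : I * I) (s : S) : R :=
  \sum_y P (uvn_pos s) y * (uvn_inc s y ab.1 * uvn_inc s y ab.2).

Let kmax : R := \sum_(a : 'I_d * 'I_d * 'I_d) `|uvn_k a.1.1 a.1.2 a.2|.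
Let kmaxP j x y : `|uvn_k j x y| <= kmax.
Proof. exact: (le_term_sum (F := fun a => `|uvn_k a.1.1 a.1.2 a.2|) (j, x, y)). Qed.
Let kmax0 : 0 <= kmax.
Proof. exact: sumr_ge0. Qed.

Lemma uvn_inc_le s y a : `|uvn_inc s y a| <= kmax * Num.sqrt (V s).
Proof. by rewrite normrM mulrC; apply: ler_pM => //; exact: uvn_L_V. Qed.

Lemma uvn_cov_mix ab : exists c, mixes (uvn_cov ab) c.
Proof.
apply: (@uvn_mix _ (kmax ^+ 2)) => [s s' ps Ls|s].
  rewrite /uvn_cov /uvn_inc -ps; apply: eq_bigr => y _; by rewrite !Ls.
apply: (le_trans (ler_norm_sum _ _ _)).
have -> : kmax ^+ 2 * V s = \sum_y P (uvn_pos s) y * (kmax ^+ 2 * V s).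
  by rewrite -mulr_suml; case: Pst => _ ->; rewrite mul1r.
apply: ler_sum => y _; rewrite normrM ger0_norm // ler_wpM2l //.
have -> : kmax ^+ 2 * V s = (kmax * Num.sqrt (V s)) * (kmax * Num.sqrt (V s)).
  by rewrite mulrACA -!expr2 sqr_sqrtr // uvn_V0.
by rewrite normrM; apply: ler_pM => //; exact: uvn_inc_le.
Qed.

Definition uvn_c (a b : I) : R := get (mixes (uvn_cov (a, b))).

Lemma uvn_cP a b : mixes (uvn_cov (a, b)) (uvn_c a b).
Proof.
have [c hc] := uvn_cov_mix (a, b).
exact: (@getPex _ (mixes (uvn_cov (a, b))) (ex_intro _ c hc)).
Qed.

(** Both sides apply [get] to the same predicate, since [uvn_cov] is symmetric in its pair. *)
Lemma uvn_c_sym a b : uvn_c a b = uvn_c b a.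
Proof.
rewrite /uvn_c; have -> // : uvn_cov (a, b) = uvn_cov (b, a).
by apply/funext => s; apply: eq_bigr => y _ /=; rewrite [X in _ * X]mulrC.
Qed.

Definition uvn_var (t : I -> R) : R := \sum_a \sum_b t a * t b * uvn_c a b.

Lemma uvn_lin_mv t s y : 0 < P (uvn_pos s) y ->
  uvn_lin t (uvn_mv s y) - uvn_lin t s = \sum_a t a * uvn_inc s y a.
Proof.
move=> Py; rewrite /uvn_lin -sumrB; apply: eq_bigr => a _.
by rewrite -mulrBr uvn_M_mv.
Qed.

Lemma uvn_lin_sqr t s :
  \sum_y p s y * (uvn_lin t (uvn_mv s y) - uvn_lin t s) ^+ 2 =
  \sum_(ab : I * I) (t ab.1 * t ab.2) * uvn_cov ab s.
Proof.
under [RHS]eq_bigr do rewrite /uvn_cov mulr_sumr.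
rewrite exchange_big /=; apply: eq_bigr => y _.
have := chain_p_ge0 uvn_pos Pst s y; rewrite {1 2}/chain_p le_eqVlt => /orP[/eqP <-|Py].
  by rewrite mul0r big1 // => ab _; rewrite mul0r mulr0.
rewrite uvn_lin_mv // expr2 mulr_suml.
rewrite mulr_sumr -(pair_bigA _ (fun a b => t a * t b * (P (uvn_pos s) y * (uvn_inc s y a * uvn_inc s y b)))) /=.
apply: eq_bigr => a _; rewrite !mulr_sumr; apply: eq_bigr => b _.
rewrite /chain_p; ring.
Qed.

Lemma uvn_var_mix t : mixes (fun s => \sum_y p s y * (uvn_lin t (uvn_mv s y) - uvn_lin t s) ^+ 2) (uvn_var t).
Proof.
have := @mixes_sum _ (index_enum _) (fun ab : I * I => t ab.1 * t ab.2) (fun ab => uvn_c ab.1 ab.2) uvn_cov (fun ab => _).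
move=> /(_ (fun ab => ltac:(case: ab => a b; exact: uvn_cP))).
have -> : uvn_var t = \sum_(ab : I * I) (t ab.1 * t ab.2) * uvn_c ab.1 ab.2.
  by rewrite /uvn_var (pair_bigA _ (fun a b => t a * t b * uvn_c a b)).
have -> // : (fun s => \sum_y p s y * (uvn_lin t (uvn_mv s y) - uvn_lin t s) ^+ 2) =
  (fun s => \sum_(ab : I * I) (t ab.1 * t ab.2) * uvn_cov ab s).
by apply/funext => s; exact: uvn_lin_sqr.
Qed.

Lemma uvn_var_ge0 t (x : 'I_d) : 0 <= uvn_var t.
Proof.
apply: (mixes_ge0 (uvn_ref x) _ (uvn_var_mix t)) => s.
by apply: sumr_ge0 => y _; rewrite mulr_ge0 ?sqr_ge0 // /chain_p.
Qed.

Lemma uvn_lin_mart t s : \sum_y p s y * (uvn_lin t (uvn_mv s y) - uvn_lin t s) = 0.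
Proof.
transitivity (\sum_y \sum_a t a * uvn_L s a.1 a.2 * (P (uvn_pos s) y * uvn_k a.2 (uvn_pos s) y)).
  apply: eq_bigr => y _.
  have := chain_p_ge0 uvn_pos Pst s y; rewrite {1 2}/chain_p le_eqVlt => /orP[/eqP <-|Py].
    by rewrite mul0r big1 // => a _; rewrite mul0r mulr0.
  rewrite uvn_lin_mv // mulr_sumr; apply: eq_bigr => a _; rewrite /uvn_inc; ring.
rewrite exchange_big big1 //= => a _.
by rewrite -mulr_sumr uvn_k_mean mulr0.
Qed.

(** The 1 keeps [tB t] at least 1, even for t = 0, so that [tB t * V] both bounds the squared
    increments and dominates V in the mixing error. *)
Let tB (t : I -> R) : R := 1 + (kmax * \sum_a `|t a|) ^+ 2.

Lemma uvn_lin_inc t s y : 0 < p s y ->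
  (uvn_lin t (uvn_mv s y) - uvn_lin t s) ^+ 2 <= tB t * V s.
Proof.
move=> Py; rewrite uvn_lin_mv //.
have h : `|\sum_a t a * uvn_inc s y a| <= kmax * (\sum_a `|t a|) * Num.sqrt (V s).
  apply: (le_trans (ler_norm_sum _ _ _)); rewrite mulrAC mulrC mulr_suml.
  by apply: ler_sum => a _; rewrite normrM ler_wpM2l // uvn_inc_le.
rewrite -real_normK ?num_real //.
apply: (@le_trans _ _ ((kmax * (\sum_a `|t a|)) ^+ 2 * V s)).
  rewrite -[X in _ <= _ * X]sqr_sqrtr ?uvn_V0 // -exprMn.
  rewrite lerXn2r ?nnegrE // mulr_ge0 ?sqrtr_ge0 // mulr_ge0 //; exact: sumr_ge0.
by rewrite ler_wpM2r ?uvn_V0 // /tB lerDr.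
Qed.

Let tB1 t : 1 <= tB t. Proof. by rewrite lerDl sqr_ge0. Qed.

Lemma uvn_clt t x a :
  E K (fun s => cos ((Num.sqrt K%:R)^-1 * uvn_lin t s + a)) (uvn_ref x) @[K --> \oo]
    --> expR (- (uvn_var t / 2)) * cos a.
Proof.
have [C [C0 HC]] := uvn_V_bnd.
have tB0 : 0 < tB t by apply: lt_le_trans (tB1 t).
apply: (markov_clt (chain_p_ge0 _ Pst) (chain_p_sum _ Pst) (U := fun s => tB t * V s)
  (V := fun s => tB t * V s) (C := tB t * (C * V (uvn_ref x)))).
- exact: uvn_lin_mart.
- exact: uvn_lin_inc.
- by move=> s; rewrite lexx andbT mulr_ge0 ?uvn_V0 // ltW.
- by move=> n; rewrite markE_Z ler_wpM2l // ltW.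
- move=> eps e0; have [m Hm] := uvn_var_mix t e0; exists m => s.
  apply: (le_trans (Hm m (leqnn m) s)); rewrite ler_wpM2l ?(ltW e0) //.
  by rewrite ler_peMl ?uvn_V0.
- move=> eta eta0; have [B [B0 HB]] := uvn_ui (divr_gt0 eta0 tB0).
  exists (tB t * B); split => [|n]; first by rewrite mulr_ge0 // ltW.
  have -> : (fun s => if tB t * B < tB t * V s then tB t * V s else 0) =
    (fun s => tB t * (if B < V s then V s else 0)).
    by apply/funext => s; rewrite ltr_pM2l //; case: ifP => // _; rewrite mulr0.
  by rewrite markE_Z -ler_pdivlMl // mulrC; exact: HB.
- exact: uvn_var_ge0.
- by rewrite /uvn_lin big1 // => b _; rewrite uvn_M_ref mulr0.
Qed.

Lemma uvn_M_var : exists C, forall K x i j,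
  E K (fun s => uvn_M s i j ^+ 2) (uvn_ref x) <= K%:R * C.
Proof.
have [C [C0 HC]] := uvn_V_bnd.
pose t i j (a : I) : R := (a == (i, j))%:R.
have linE i j s : uvn_lin (t i j) s = uvn_M s i j.
  exact: (sum_indicator (fun a => uvn_M s a.1 a.2)).
pose F (a : 'I_d * 'I_d * 'I_d) := tB (t a.1.1 a.1.2) * (C * V (uvn_ref a.2)).
have F0 a : 0 <= F a by rewrite mulr_ge0 ?mulr_ge0 ?uvn_V0 //; exact: le_trans (tB1 _).
exists (\sum_a F a) => K x i j.
apply: (@le_trans _ _ (K%:R * F (i, j, x))); last by rewrite ler_wpM2l // le_term_sum.
have := @mart_var_le R d S p uvn_mv (chain_p_ge0 _ Pst) (chain_p_sum _ Pst) (uvn_lin (t i j))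
   (fun s => tB (t i j) * V s) (fun s => tB (t i j) * V s) (uvn_ref x) (tB (t i j) * (C * V (uvn_ref x))).
have -> : (fun s => (uvn_lin (t i j) s - uvn_lin (t i j) (uvn_ref x)) ^+ 2) = (fun s => uvn_M s i j ^+ 2).
  by apply/funext => s; rewrite !linE uvn_M_ref subr0.
apply.
- exact: uvn_lin_mart.
- exact: uvn_lin_inc.
- by move=> s; rewrite lexx andbT mulr_ge0 ?uvn_V0 //; exact: le_trans (tB1 _).
- by move=> n; rewrite markE_Z ler_wpM2l //; exact: le_trans (tB1 _).
Qed.

(** The correction stays bounded in mean square, so after division by sqrt K the deviation and the
    martingale are interchangeable. *)
Lemma uvn_corr_var : exists C, forall K x i j,
  E K (fun s => uvn_corr s i j ^+ 2) (uvn_ref x) <= C.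
Proof.
have [C [C0 HC]] := uvn_V_bnd.
pose f := \sum_a `|uvn_F a.1 a.2|.
have fP x j : `|uvn_F x j| <= f by exact: (le_term_sum (F := fun a => `|uvn_F a.1 a.2|) (x, j)).
have f0 : 0 <= f by apply: sumr_ge0.
exists ((2 * f) ^+ 2 * (C * \sum_x V (uvn_ref x))) => K x i j.
apply: (@le_trans _ _ (E K (fun s => (2 * f) ^+ 2 * V s) (uvn_ref x))).
  apply: (markE_le _ (chain_p_ge0 _ Pst)) => s.
  rewrite -[X in _ <= _ * X]sqr_sqrtr ?uvn_V0 // -exprMn -real_normK ?num_real //.
  rewrite lerXn2r ?nnegrE // ?mulr_ge0 ?sqrtr_ge0 //.
  have V1 : 1 <= Num.sqrt (V s) by rewrite -[leLHS]sqrtr1 ler_wsqrtr // uvn_V1.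
  rewrite /uvn_corr; case: ifP => _; first by rewrite normr0 !mulr_ge0 ?sqrtr_ge0.
  apply: (le_trans (ler_normB _ _)); rewrite normrM.
  have : `|uvn_L s i j| * `|uvn_F s.1 j| <= Num.sqrt (V s) * f.
    by apply: ler_pM => //; exact: uvn_L_V.
  have : `|uvn_F i j| <= Num.sqrt (V s) * f.
    by apply: (le_trans (fP i j)); rewrite ler_peMl.
  lra.
rewrite markE_Z ler_wpM2l ?sqr_ge0 //; apply: (le_trans (HC K _)); rewrite ler_wpM2l //.
exact: (le_term_sum (F := fun x => V (uvn_ref x)) x (fun _ => uvn_V0 _)).
Qed.

Definition uvn_hit (i j : 'I_d) (s : S) : R := P (uvn_pos s) j * (uvn_L s i j != 0)%:R.

Lemma uvn_hitE i j s :
  \sum_y p s y * ((uvn_Gamma (uvn_mv s y).2 i j)%:R - (uvn_Gamma s.2 i j)%:R) = uvn_hit i j s.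
Proof.
rewrite (bigD1 j) //= big1 ?addr0 => [|y yj].
  have := chain_p_ge0 uvn_pos Pst s j; rewrite /uvn_hit {1 2}/chain_p le_eqVlt => /orP[/eqP <-|Py].
    by rewrite !mul0r.
  by rewrite uvn_Gamma_mv // eqxx.
have := chain_p_ge0 uvn_pos Pst s y; rewrite {1 2}/chain_p le_eqVlt => /orP[/eqP <-|Py].
  by rewrite mul0r.
by rewrite uvn_Gamma_mv // (negbTE yj) mulr0.
Qed.

Lemma uvn_hit_mix i j : exists c, mixes (uvn_hit i j) c.
Proof.
apply: (@uvn_mix _ 1) => [s s' ps Ls|s]; first by rewrite /uvn_hit ps Ls.
rewrite mul1r; apply: le_trans (uvn_V1 s); rewrite /uvn_hit normrM normr_nat ger0_norm //.
rewrite mulr_ile1 // ?ler0n //; first by have := stoch_pow_le1 Pst 1 (uvn_pos s) j; rewrite expr1.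
by case: (_ != 0).
Qed.

Definition uvn_gam (i j : 'I_d) : R := get (mixes (uvn_hit i j)).

Lemma uvn_gamP i j : mixes (uvn_hit i j) (uvn_gam i j).
Proof.
have [c hc] := uvn_hit_mix i j.
exact: (@getPex _ (mixes (uvn_hit i j)) (ex_intro _ c hc)).
Qed.

Lemma uvn_lln i j x :
  E K (fun s => ((uvn_Gamma s.2 i j)%:R / K%:R - uvn_gam i j) ^+ 2) (uvn_ref x) @[K --> \oo] --> 0.
Proof.
have [C [C0 HC]] := uvn_V_bnd.
apply: (@markov_lln R d S p uvn_mv (chain_p_ge0 _ Pst) (chain_p_sum _ Pst)
   (fun s => (uvn_Gamma s.2 i j)%:R) V (uvn_ref x) (uvn_gam i j) (C * V (uvn_ref x))).
- by move=> s y Py; rewrite uvn_Gamma_mv // normr_nat; case: (_ && _).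
- exact: uvn_V0.
- by move=> n; exact: HC.
- move=> eps e0; have [m Hm] := uvn_gamP i j e0; exists m => s.
  have -> : (fun s => \sum_y p s y * ((uvn_Gamma (uvn_mv s y).2 i j)%:R - (uvn_Gamma s.2 i j)%:R)) = uvn_hit i j.
    by apply/funext => s'; exact: uvn_hitE.
  exact: Hm.
- by rewrite /= mxE.
Qed.

(* From any state, the chain visits i and then j within a bounded time with
   probability bounded below, and Gamma i j increases when it does. *)
Lemma uvn_gam_gt0 i j : 0 < uvn_gam i j.
Proof.
have [N HN] := uvn_prim.
have p0 := chain_p_ge0 uvn_pos Pst; have p1 := chain_p_sum uvn_pos Pst.
pose Gm (s : S) : R := (uvn_Gamma s.2 i j)%:R.
have Gm_mv s y : 0 < P (uvn_pos s) y -> Gm (uvn_mv s y) = Gm s + ((y == j) && (uvn_L s i j != 0))%:R.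
  by move=> Py; rewrite -(uvn_Gamma_mv i j Py) addrC subrK.
have mono n s : Gm s <= E n Gm s.
  elim: n s => // n IH s /=; rewrite /markov_op.
  have -> : Gm s = \sum_y p s y * Gm s by rewrite -mulr_suml p1 mul1r.
  apply: ler_sum => y _; have := p0 s y; rewrite {1 2 3}/chain_p le_eqVlt => /orP[/eqP <-|Py].
    by rewrite !mul0r.
  rewrite ler_pM2l //; apply: le_trans (IH _); by rewrite Gm_mv // lerDl ler0n.
(* If a path is pending and the chain is at j at time n + 1, that path has ended by then, there or
   at an earlier visit to j, and has been counted. *)
have hit n s : uvn_L s i j != 0 -> Gm s + (P ^+ n.+1) (uvn_pos s) j <= E n.+1 Gm s.
  elim: n s => [|n IH] s L0.
    rewrite expr1 /= /markov_op.
    have -> : Gm s + P (uvn_pos s) j = \sum_y p s y * (Gm s + (y == j)%:R).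
      under eq_bigr do rewrite mulrDr.
      rewrite big_split /= -mulr_suml p1 mul1r; congr (_ + _).
      by under eq_bigr do rewrite mulrC; rewrite (sum_indicator (p s)).
    apply: ler_sum => y _; have := p0 s y; rewrite {1 2 3}/chain_p le_eqVlt => /orP[/eqP <-|Py].
      by rewrite !mul0r.
    by rewrite ler_pM2l // Gm_mv // L0 andbT.
  rewrite exprS -mulmxE mxE iterS /markov_op.
  have -> : Gm s + \sum_k P (uvn_pos s) k * (P ^+ n.+1) k j =
     \sum_y p s y * (Gm s + (P ^+ n.+1) y j).
    under [RHS]eq_bigr do rewrite mulrDr.
    by rewrite big_split /= -mulr_suml p1 mul1r.
  apply: ler_sum => y _; have := p0 s y; rewrite {1 2 3}/chain_p le_eqVlt => /orP[/eqP <-|Py].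
    by rewrite !mul0r.
  rewrite ler_pM2l //; have [yj|yj] := eqVneq y j.
    apply: le_trans (mono _ _); rewrite Gm_mv // yj eqxx L0 lerD2l.
    exact: stoch_pow_le1.
  have L0' : uvn_L (uvn_mv s y) i j != 0.
    by rewrite uvn_L_mv // (negbTE yj) (negbTE L0) mulf_neq0 // r_neq0.
  apply: le_trans (IH (uvn_mv s y) L0'); rewrite Gm_mv // (negbTE yj) addr0 //.
pose n := N.+1.
have nN : (N <= n)%N by [].
(* A lower bound for the probability of being at i after n steps and at j after n more, whatever the
   starting state. *)
pose dl := (P ^+ n) i j * \big[Num.min/1]_x (P ^+ n) x i.
have dl0 : 0 < dl.
  rewrite mulr_gt0 ?HN //; apply/bigmin_gtP; split => // x _; exact: HN.
have gain s : Gm s + dl <= E (n + n) Gm s.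
  rewrite markE_comp.
  apply: (@le_trans _ _ (E n (fun s => Gm s + (P ^+ n) i j * (uvn_pos s == i)%:R) s)).
    rewrite markE_D markE_Z (chain_pos_law _ uvn_pos_mv _ (fun x => (x == i)%:R)); apply: lerD; first exact: mono.
    rewrite /dl ler_wpM2l ?stoch_pow_ge0 // [leRHS](bigD1 i) //= eqxx mulr1 big1 ?addr0 => [|y yi].
      exact: bigmin_le.
    by rewrite (negbTE yi) mulr0.
  apply: (markE_le _ p0) => s'; have [pi|pi] := eqVneq (uvn_pos s') i; last first.
    by rewrite mulr0 addr0; exact: mono.
  rewrite mulr1 -[X in (P ^+ n) X j]pi; apply: hit.
  have si : i == s'.1 by rewrite -pi.
  rewrite /uvn_L si /=; case: (eqVneq (uvn_Lambda s'.2 i j) 0) => [_|h]; [exact: oner_neq0|exact: h].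
have tele m s : E m Gm s = Gm s + \sum_(k < m) E k (uvn_hit i j) s.
  elim: m => [|m IH]; first by rewrite big_ord0 addr0.
  rewrite big_ord_recr /= addrA -IH -iterS markES -markE_D.
  apply: markE_eq => s'; rewrite -uvn_hitE /markov_op.
  under [X in _ = _ + X]eq_bigr do rewrite mulrBr.
  by rewrite sumrB -[X in _ - X]mulr_suml p1 mul1r addrC subrK.
have V0 : 0 < V (uvn_ref i) by apply: lt_le_trans (uvn_V1 _).
pose eps := dl / (2 * (n + n)%:R) / V (uvn_ref i).
have nn0 : 0 < (n + n)%:R :> R by rewrite ltr0n.
have eps0 : 0 < eps by rewrite !divr_gt0 // mulr_gt0.
have [m0 Hm] := uvn_gamP i j eps0.
(* A window of n + n steps opened at time [m0], from which each term is within dl / (2 (n + n)) of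
   [uvn_gam]: a total gain of at least dl then forces the limit to be positive. *)
have h1 : dl <= \sum_(k < n + n) E (m0 + k) (uvn_hit i j) (uvn_ref i).
  have -> : \sum_(k < n + n) E (m0 + k) (uvn_hit i j) (uvn_ref i) =
    E m0 (fun s => E (n + n) Gm s - Gm s) (uvn_ref i).
    have -> : (fun s => E (n + n) Gm s - Gm s) = (fun s => \sum_(k < n + n) E k (uvn_hit i j) s).
      by apply/funext => s; rewrite tele addrC addKr.
    by rewrite (markE_sum _ p1); apply: eq_bigr => k _; rewrite markE_comp.
  rewrite -[leLHS](markE_cst uvn_mv p1 m0 dl (uvn_ref i)); apply: (markE_le _ p0) => s.
  by rewrite lerBrDr addrC.
have h2 : \sum_(k < n + n) E (m0 + k) (uvn_hit i j) (uvn_ref i) <= (n + n)%:R * uvn_gam i j + dl / 2.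
  apply: (@le_trans _ _ (\sum_(k < n + n) (uvn_gam i j + dl / (2 * (n + n)%:R)))).
    apply: ler_sum => k _; have := Hm (m0 + k)%N (leq_addr _ _) (uvn_ref i).
    rewrite /eps divfK ?gt_eqF // ler_norml => /andP[_]; lra.
  rewrite sumr_const card_ord -[_ *+ (n + n)]mulr_natl mulrDr lerD2l.
  rewrite le_eqVlt; apply/orP; left; apply/eqP; field.
  by rewrite -natrD gt_eqF.
have : 0 < (n + n)%:R * uvn_gam i j by lra.
by rewrite pmulr_rgt0.
Qed.

End UvnChain.

(** * Convergence in probability and in distribution *)

(* [Phi K] is the expectation of a function of the state after K steps. For a
   finite-state driving chain it makes sense without any measurability. *)
Section Asymptotics.
Variables (R : realType) (S : Type) (Phi : nat -> (S -> R) -> R).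
Hypothesis Phi_le : forall K g h, (forall s, g s <= h s) -> Phi K g <= Phi K h.
Hypothesis Phi_lin : forall K a b g h,
  Phi K (fun s => a * g s + b * h s) = a * Phi K g + b * Phi K h.
Hypothesis Phi_cst : forall K c, Phi K (fun=> c) = c.

Lemma Phi_eq K g h : (forall s, g s = h s) -> Phi K g = Phi K h.
Proof. by move=> /funext ->. Qed.

Lemma Phi_scale K a g : Phi K (fun s => a * g s) = a * Phi K g.
Proof.
rewrite -[RHS]addr0 -(mul0r (Phi K g)) -Phi_lin.
by apply: Phi_eq => s; rewrite mul0r addr0.
Qed.

Lemma Phi_add K g h : Phi K (fun s => g s + h s) = Phi K g + Phi K h.
Proof.
rewrite -[Phi K g]mul1r -[Phi K h]mul1r -Phi_lin.
by apply: Phi_eq => s; rewrite !mul1r.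
Qed.

Lemma Phi_dist K g h e : (forall s, `|g s - h s| <= e s) ->
  `|Phi K g - Phi K h| <= Phi K e.
Proof.
move=> H; have ->: Phi K g - Phi K h = Phi K (fun s => g s - h s).
  rewrite -mulN1r -Phi_scale -Phi_add; by apply: Phi_eq => s; rewrite mulN1r.
rewrite ler_norml -mulN1r -Phi_scale; apply/andP; split; apply: Phi_le => s;
  have := H s; rewrite ler_norml => /andP[]; lra.
Qed.

Definition mass K (B : S -> bool) : R := Phi K (fun s => (B s)%:R).

Lemma mass_le K (B B' : S -> bool) : (forall s, B s -> B' s) -> mass K B <= mass K B'.
Proof.
move=> H; apply: Phi_le => s; have := H s; case: (B s) => [->|_] //=.
Qed.

Lemma Phi_dist_mass K g h (a b : R) (B : S -> bool) :
  (forall s, `|g s - h s| <= a + b * (B s)%:R) ->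
  `|Phi K g - Phi K h| <= a + b * mass K B.
Proof.
by move=> H; rewrite -[a](Phi_cst K) -[b * mass K B]Phi_scale -Phi_add; exact: Phi_dist.
Qed.

Lemma mass_or K (B B' : S -> bool) : mass K (fun s => B s || B' s) <= mass K B + mass K B'.
Proof.
rewrite -Phi_add; apply: Phi_le => s.
by case: (B s); case: (B' s) => /=; rewrite ?mulr1n ?mulr0n; lra.
Qed.

Lemma mass_sqr K (Z : S -> R) (e : R) : 0 < e ->
  mass K (fun s => e < `|Z s|) <= Phi K (fun s => Z s ^+ 2) / e ^+ 2.
Proof.
move=> e0; rewrite mulrC -Phi_scale; apply: Phi_le => s.
rewrite mulrC ler_pdivlMr ?exprn_gt0 //.
case: ltP => h /=; last by rewrite mul0r sqr_ge0.
rewrite mul1r -[leRHS]real_normK ?num_real // lerXn2r ?nnegrE //; exact: ltW.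
Qed.

Definition negligible_events (B : nat -> S -> bool) : Prop :=
  forall eps, 0 < eps -> exists K0, forall K, (K0 <= K)%N -> mass K (B K) <= eps.
(** Here [oP] and [OP] are the usual o_P(1) and O_P(1): convergence to 0, and boundedness, in
    probability. *)
Definition oP (Z : nat -> S -> R) : Prop :=
  forall e, 0 < e -> negligible_events (fun K s => e < `|Z K s|).
Definition OP (Z : nat -> S -> R) : Prop :=
  forall eps, 0 < eps -> exists L, 0 < L /\ exists K0, forall K, (K0 <= K)%N ->
    mass K (fun s => L < `|Z K s|) <= eps.

Lemma negl_or (B B' B'' : nat -> S -> bool) : negligible_events B -> negligible_events B' ->
  (exists K0, forall K, (K0 <= K)%N -> forall s, B'' K s -> B K s || B' K s) ->
  negligible_events B''.
Proof.
move=> H H' [K0 H0] eps e0; have e2 : 0 < eps / 2 by lra.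
have [K1 H1] := H _ e2; have [K2 H2] := H' _ e2.
exists (maxn K0 (maxn K1 K2)) => K; rewrite !geq_max => /and3P[h0 h1 h2].
apply: (le_trans (mass_le K (H0 K h0))); apply: (le_trans (mass_or _ _ _)).
by have := H1 K h1; have := H2 K h2; lra.
Qed.

(** Allows identities that fail where a denominator vanishes, with whatever value division takes
    there. *)
Lemma oP_eq B Z Z' : negligible_events B -> oP Z ->
  (exists K0, forall K, (K0 <= K)%N -> forall s, ~~ B K s -> Z' K s = Z K s) -> oP Z'.
Proof.
move=> HB HZ [K0 H0] e e0; apply: (negl_or HB (HZ e e0)); exists K0 => K h s.
by case Bs : (B K s) => //; rewrite (H0 K h s) // Bs.
Qed.

Lemma oP_ext Z Z' : oP Z -> (forall K s, Z' K s = Z K s) -> oP Z'.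
Proof. by move=> HZ H; have -> : Z' = Z by apply/funext => K; apply/funext. Qed.

Lemma OP_ext Z Z' : OP Z -> (forall K s, Z' K s = Z K s) -> OP Z'.
Proof. by move=> HZ H; have -> : Z' = Z by apply/funext => K; apply/funext. Qed.

Lemma oP_OP Z : oP Z -> OP Z.
Proof. by move=> H eps e0; exists 1; split=> //; exact: H. Qed.

Lemma OP_cst (c : R) : OP (fun _ _ => c).
Proof.
move=> eps e0; exists (`|c| + 1); split; first by rewrite ltr_wpDl.
exists 0%N => K _; rewrite /mass.
have -> : (`|c| + 1 < `|c|) = false by rewrite ltNge lerDl ler01.
by rewrite Phi_cst ltW.
Qed.

Lemma oP_add Z Z' : oP Z -> oP Z' -> oP (fun K s => Z K s + Z' K s).
Proof.
move=> H H' e e0; have e2 : 0 < e / 2 by lra.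
apply: (negl_or (H _ e2) (H' _ e2)); exists 0%N => K _ s h; apply/orP.
have := ler_normD (Z K s) (Z' K s).
case: (ltP (e / 2)) => h1; first by left.
by right; move: h; lra.
Qed.

Lemma OP_add Z Z' : OP Z -> OP Z' -> OP (fun K s => Z K s + Z' K s).
Proof.
move=> H H' eps e0; have e2 : 0 < eps / 2 by lra.
have [L [L0 [K1 H1]]] := H _ e2; have [L' [L0' [K2 H2]]] := H' _ e2.
exists (L + L'); split; first exact: addr_gt0.
exists (maxn K1 K2) => K; rewrite geq_max => /andP[h1 h2].
apply: (@le_trans _ _ (mass K (fun s => (L < `|Z K s|) || (L' < `|Z' K s|)))).
  apply: mass_le => s h; apply/orP; have := ler_normD (Z K s) (Z' K s).
  case: (ltP L) => h'; [by left|by right; lra].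
apply: (le_trans (mass_or _ _ _)); have := H1 K h1; have := H2 K h2; lra.
Qed.

Lemma OP_mul Z Z' : OP Z -> OP Z' -> OP (fun K s => Z K s * Z' K s).
Proof.
move=> H H' eps e0; have e2 : 0 < eps / 2 by lra.
have [L [L0 [K1 H1]]] := H _ e2; have [L' [L0' [K2 H2]]] := H' _ e2.
exists (L * L'); split; first exact: mulr_gt0.
exists (maxn K1 K2) => K; rewrite geq_max => /andP[h1 h2].
apply: (@le_trans _ _ (mass K (fun s => (L < `|Z K s|) || (L' < `|Z' K s|)))).
  apply: mass_le => s; rewrite normrM => h; apply/orP.
  case: (ltP L) => h'; [by left|right]; rewrite ltNge; apply/negP => h''.
  by have := ler_pM (normr_ge0 _) (normr_ge0 _) h' h''; rewrite leNgt h.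
apply: (le_trans (mass_or _ _ _)); have := H1 K h1; have := H2 K h2; lra.
Qed.

Lemma oP_mul Z Z' : oP Z -> OP Z' -> oP (fun K s => Z K s * Z' K s).
Proof.
move=> H H' e e0 eps eps0; have e2 : 0 < eps / 2 by lra.
have [L [L0 [K1 H1]]] := H' _ e2.
have [K2 H2] := H _ (divr_gt0 e0 L0) _ e2.
exists (maxn K1 K2) => K; rewrite geq_max => /andP[h1 h2].
apply: (@le_trans _ _ (mass K (fun s => (e / L < `|Z K s|) || (L < `|Z' K s|)))).
  apply: mass_le => s; rewrite normrM => h; apply/orP.
  case: (ltP (e / L)) => h'; [by left|right]; rewrite ltNge; apply/negP => h''.
  have := ler_pM (normr_ge0 _) (normr_ge0 _) h' h''.
  by rewrite divfK ?gt_eqF // leNgt h.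
apply: (le_trans (mass_or _ _ _)); have := H1 K h1; have := H2 K h2; lra.
Qed.

Lemma oP_scale (c : R) Z : oP Z -> oP (fun K s => c * Z K s).
Proof. by move=> H; apply: oP_ext (oP_mul H (OP_cst c)) _ => K s; rewrite mulrC. Qed.

Lemma oP0 : oP (fun _ _ => 0).
Proof.
move=> e e0 eps eps0; exists 0%N => K _; rewrite /mass normr0.
rewrite ltNge (ltW e0) /=.
by rewrite Phi_cst ltW.
Qed.

Lemma oP_sum (I : Type) (r : seq I) (Z : I -> nat -> S -> R) :
  (forall i, oP (Z i)) -> oP (fun K s => \sum_(i <- r) Z i K s).
Proof.
move=> H; elim: r => [|i r IH]; first by apply: oP_ext oP0 _ => K s; rewrite big_nil.
by apply: oP_ext (oP_add (H i) IH) _ => K s; rewrite big_cons.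
Qed.

Lemma OP_sum_norm (I : Type) (r : seq I) (Z : I -> nat -> S -> R) :
  (forall i, OP (Z i)) -> OP (fun K s => \sum_(i <- r) `|Z i K s|).
Proof.
move=> H; elim: r => [|i r IH]; first by apply: OP_ext (OP_cst 0) _ => K s; rewrite big_nil.
have Hi : OP (fun K s => `|Z i K s|).
  move=> eps e0; have [L [L0 [K0 H0]]] := H i eps e0; exists L; split => //.
  exists K0 => K h; rewrite (_ : mass _ _ = mass K (fun s => L < `|Z i K s|)) ?H0 //.
  by apply: Phi_eq => s; rewrite normr_id.
by apply: OP_ext (OP_add Hi IH) _ => K s; rewrite big_cons.
Qed.

Lemma oP_of_sqr Z (u : nat -> R) : u K @[K --> \oo] --> 0 ->
  (forall K, Phi K (fun s => Z K s ^+ 2) <= u K) -> oP Z.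
Proof.
move=> /cvg_epsP u0 H e e0 eps eps0.
have e2 : 0 < e ^+ 2 by rewrite exprn_gt0.
have [K0 H0] := u0 _ (mulr_gt0 eps0 e2); exists K0 => K h.
apply: (le_trans (mass_sqr _ _ e0)); rewrite ler_pdivrMr //.
apply: (le_trans (H K)); apply: le_trans (H0 K h); by rewrite subr0 ler_norm.
Qed.

Lemma OP_of_sqr Z (C : R) : (forall K, Phi K (fun s => Z K s ^+ 2) <= C) -> OP Z.
Proof.
move=> H eps e0; pose L := 1 + `|C| / eps.
have L1 : 1 <= L by rewrite lerDl divr_ge0 // ltW.
exists L; split; first by apply: lt_le_trans L1.
exists 0%N => K _; apply: (le_trans (mass_sqr _ _ (lt_le_trans ltr01 L1))).
rewrite ler_pdivrMr ?exprn_gt0 //; last by apply: lt_le_trans L1.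
apply: (le_trans (H K)); apply: (@le_trans _ _ (eps * L)).
  by rewrite /L mulrDr mulr1 mulrC divfK ?gt_eqF //; have := ler_norm C; lra.
by rewrite ler_wpM2l ?(ltW e0) // expr2 ler_peMl // (le_trans ler01).
Qed.

Definition simP (Z Z' : nat -> S -> R) : Prop := oP (fun K s => Z K s - Z' K s).

Lemma simP_refl Z : simP Z Z.
Proof. by apply: oP_ext oP0 _ => K s; rewrite subrr. Qed.

Lemma simP_add Z Z' Y Y' : simP Z Z' -> simP Y Y' ->
  simP (fun K s => Z K s + Y K s) (fun K s => Z' K s + Y' K s).
Proof. by move=> h h'; apply: oP_ext (oP_add h h') _ => K s; ring. Qed.

Lemma simP_OP Z Z' : simP Z Z' -> OP Z' -> OP Z.
Proof. by move=> h h'; apply: OP_ext (OP_add (oP_OP h) h') _ => K s; rewrite subrK. Qed.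

Lemma simP_mul Z Z' Y Y' : simP Z Z' -> simP Y Y' -> OP Z' -> OP Y' ->
  simP (fun K s => Z K s * Y K s) (fun K s => Z' K s * Y' K s).
Proof.
move=> h h' oz oy.
apply: oP_ext (oP_add (oP_mul h (simP_OP h' oy)) (oP_mul h' oz)) _ => K s; ring.
Qed.

Lemma simP_cst_neq0 Z (c : R) : c != 0 -> simP Z (fun _ _ => c) ->
  negligible_events (fun K s => Z K s == 0).
Proof.
move=> c0 H; have c2 : 0 < `|c| / 2 by rewrite divr_gt0 // normr_gt0.
apply: (negl_or (H _ c2) (H _ c2)); exists 0%N => K _ s /eqP ->.
by rewrite sub0r normrN orbb; have : 0 < `|c| by [rewrite normr_gt0]; lra.
Qed.

(** Off the event Z = 0, Z^-1 - c^-1 = - (Z - c) Z^-1 c^-1, and Z^-1 is at most 2 / |c| in modulus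
    whenever |Z - c| <= |c| / 2. *)
Lemma simP_inv Z (c : R) : c != 0 -> simP Z (fun _ _ => c) ->
  simP (fun K s => (Z K s)^-1) (fun _ _ => c^-1).
Proof.
move=> c0 H; have c2 : 0 < `|c| / 2 by rewrite divr_gt0 // normr_gt0.
have bnd : OP (fun K s => (Z K s)^-1 * c^-1).
  apply: OP_mul (OP_cst _) => eps e0; exists (2 / `|c|).
  split; first by rewrite divr_gt0 // normr_gt0.
  have [K0 H0] := H _ c2 _ e0; exists K0 => K h; apply: le_trans (H0 K h).
  apply: mass_le => s; rewrite normfV ltNge => h1; rewrite ltNge; apply: contra h1 => h1.
  have : `|c| / 2 <= `|Z K s|.
    have := ler_distD (Z K s) c 0; rewrite !subr0 distrC; lra.
  by rewrite -[2 / `|c|]invf_div => h2; rewrite lef_pV2 ?posrE //; exact: lt_le_trans h2.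
apply: (oP_eq (simP_cst_neq0 c0 H) (oP_scale (-1) (oP_mul H bnd))); exists 0%N => K _ s Z0.
by field; rewrite Z0 c0.
Qed.

Lemma simP_cos Z Z' (l a : R) : simP Z Z' ->
  Phi K (fun s => cos (Z' K s + a)) @[K --> \oo] --> l ->
  Phi K (fun s => cos (Z K s + a)) @[K --> \oo] --> l.
Proof.
move=> H /cvg_epsP Hl; apply/cvg_epsP => eps e0.
have e8 : 0 < eps / 8 by lra.
have [K1 H1] := H _ e8 _ e8; have [K2 H2] := Hl (eps / 2) ltac:(lra).
exists (maxn K1 K2) => K; rewrite geq_max => /andP[h1 h2].
have {}h1 := H1 K h1; have {}h2 := H2 K h2.
have h3 : `|Phi K (fun s => cos (Z K s + a)) - Phi K (fun s => cos (Z' K s + a))| <=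
    2 * (eps / 8) + 2 * mass K (fun s => eps / 8 < `|Z K s - Z' K s|).
  apply: Phi_dist_mass => s.
  have [h|h] := ltP (eps / 8) `|Z K s - Z' K s| => /=.
    apply: (le_trans (ler_normB _ _)).
    by have := cos_max (Z K s + a); have := cos_max (Z' K s + a); lra.
  have -> : Z K s + a = Z' K s + a + (Z K s - Z' K s) by ring.
  apply: (le_trans (cos_lip _ _)); rewrite mulr0 addr0; lra.
have := ler_distD (Phi K (fun s => cos (Z' K s + a))) (Phi K (fun s => cos (Z K s + a))) l.
lra.
Qed.

Lemma oP_inv_sqrt : oP (fun K _ => (Num.sqrt K%:R)^-1).
Proof.
move=> e e0 eps eps0; have [K0 [_ H0]] := inv_sqrt_small 1 e0; exists K0 => K /H0.
rewrite mul1r /mass ger0_norm ?invr_ge0 ?sqrtr_ge0 // leNgt => /negbTE ->.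
by rewrite Phi_cst ltW.
Qed.

(* Here [sd] and [sd'] are the fluctuations of numerators of order [sqrt K],
   and [g], [g'] are denominators of order [K], suitably normalized. *)
Lemma delta_method (Y sd sd' m m' g g' : nat -> S -> R) (gam gam' F c : R) :
  gam != 0 -> gam' != 0 ->
  simP sd m -> OP m -> simP sd' m' -> OP m' ->
  simP g (fun _ _ => gam) -> simP g' (fun _ _ => gam') ->
  (exists K0, forall K, (K0 <= K)%N -> forall s,
     let den := 1 - c * ((Num.sqrt K%:R)^-1 * (sd' K s * (g' K s)^-1)) in
     g K s != 0 -> g' K s != 0 -> den != 0 ->
     Y K s = c * (sd K s * (g K s)^-1 + c * F * (sd' K s * (g' K s)^-1)) * den^-1) ->
  let Z K s := c * (m K s * gam^-1 + c * F * (m' K s * gam'^-1)) in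
  simP Y Z /\ OP Z.
Proof.
move=> gam0 gam0' sdm om sdm' om' gE gE' [K0 YE] Z.
have r : simP (fun K s => sd K s * (g K s)^-1) (fun K s => m K s * gam^-1).
  exact: simP_mul sdm (simP_inv gam0 gE) om (OP_cst _).
have r' : simP (fun K s => sd' K s * (g' K s)^-1) (fun K s => m' K s * gam'^-1).
  exact: simP_mul sdm' (simP_inv gam0' gE') om' (OP_cst _).
have or : OP (fun K s => m K s * gam^-1) by exact: OP_mul om (OP_cst _).
have or' : OP (fun K s => m' K s * gam'^-1) by exact: OP_mul om' (OP_cst _).
have oZ : OP Z by exact: OP_mul (OP_cst c) (OP_add or (OP_mul (OP_cst (c * F)) or')).
pose den K s := 1 - c * ((Num.sqrt K%:R)^-1 * (sd' K s * (g' K s)^-1)).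
have den1 : simP den (fun _ _ => 1).
  apply: oP_ext (oP_scale (- c) (oP_mul oP_inv_sqrt (simP_OP r' or'))) _ => K s.
  by rewrite /den; ring.
have one0 : (1 : R) != 0 by exact: oner_neq0.
have U : simP (fun K s => c * (sd K s * (g K s)^-1 + c * F * (sd' K s * (g' K s)^-1))
     * (den K s)^-1) (fun K s => Z K s * 1^-1).
  apply: simP_mul (simP_inv one0 den1) oZ (OP_cst _).
  apply: simP_mul (simP_refl _) _ (OP_cst _) (OP_add or (OP_mul (OP_cst (c * F)) or')).
  apply: simP_add r _; exact: simP_mul (simP_refl _) r' (OP_cst _) or'.
split => //.
(* Each of the three denominators tends in probability to a nonzero constant, so it vanishes only on
   negligible events. *)
pose B K s := [|| g K s == 0, g' K s == 0 | den K s == 0].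
have nB : negligible_events B.
  apply: (negl_or (simP_cst_neq0 gam0 gE) (B' := fun K s => (g' K s == 0) || (den K s == 0))).
    apply: (negl_or (simP_cst_neq0 gam0' gE') (simP_cst_neq0 one0 den1)).
    by exists 0%N.
  by exists 0%N.
apply: (oP_eq nB U); exists K0 => K hK s; rewrite !negb_or => /and3P[h1 h2 h3].
by rewrite (YE K hK s h1 h2 h3) /Z invr1 mulr1.
Qed.

Section Levy.
Variables (n : nat) (mu : probability (borel_rV R n) R) (Y : nat -> S -> 'rV[R]_n).
Hypothesis Y_char : forall t a, Phi K (fun s => cos (lin_form t (Y K s) + a)) @[K --> \oo]
  --> \int[mu]_y cos (lin_form t y + a).
Hypothesis Y_tight : forall i, OP (fun K s => Y K s 0 i).

Let mid i : measurable_fun setT (fun w : borel_rV R n => (idfun w : 'rV[R]_n) 0 i).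
Proof. exact: coord_measurable. Qed.

Lemma levy_trig p : trig_poly p ->
  Phi K (fun s => p (Y K s)) @[K --> \oo] --> \int[mu]_y p y.
Proof.
elim=> [t a|a b f g tf IHf tg IHg]; first exact: Y_char.
have [mf [Cf hf]] := trig_measurable_bounded mid tf.
have [mg [Cg hg]] := trig_measurable_bounded mid tg.
have If := bounded_prob_integrable mu mf (fun w => hf w).
have Ig := bounded_prob_integrable mu mg (fun w => hg w).
under eq_fun do rewrite Phi_lin.
have -> : \int[mu]_y (a * f y + b * g y) = a * \int[mu]_y f y + b * \int[mu]_y g y.
  by rewrite RintegralD ?RintegralZl //; exact: scale_integrable.
by apply: cvgD; apply: cvgM => //; exact: cvg_cst.
Qed.

Lemma levy_continuity (f : 'rV[R]_n -> R) (C : R) : continuous f -> (forall y, `|f y| <= C) ->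
  Phi K (fun s => f (Y K s)) @[K --> \oo] --> \int[mu]_y f y.
Proof.
move=> fc fC; have C0 : 0 <= C by apply: le_trans (fC 0).
apply/cvg_epsP => eps e0.
have e8 : 0 < eps / 8 by lra.
have C1 : 0 < 1 + C by lra.
have eC : 0 < eps / 8 / (2 * (1 + C)) by rewrite divr_gt0 // mulr_gt0.
have [L1 [L10 hL1]] := tail_small mu mid eC.
have [L2 [L20 [K2 hL2]]] := OP_sum_norm (index_enum 'I_n) Y_tight eC.
pose L := Num.max L1 L2.
have L0 : 0 < L by rewrite lt_max L10.
have [p [tp p2 pe]] := trig_approx fc fC L0 e8.
have /cvg_epsP Hp := levy_trig tp; have [K3 hK3] := Hp _ e8.
exists (maxn K2 K3) => K; rewrite geq_max => /andP[h2 h3].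
have {}h3 := hK3 K h3; have {}h2 := hL2 K h2.
have CC x : x <= eps / 8 / (2 * (1 + C)) -> 0 <= x -> 2 * C * x <= eps / 8.
  move=> hx x0; have -> : eps / 8 = (2 * (1 + C)) * (eps / 8 / (2 * (1 + C))).
    by field; rewrite gt_eqF.
  apply: ler_pM => //; [by rewrite mulr_ge0|lra].
have a1 : `|Phi K (fun s => f (Y K s)) - Phi K (fun s => p (Y K s))| <=
    eps / 8 + 2 * C * mass K (fun s => L2 < `| \sum_i `|Y K s 0 i| |).
  apply: Phi_dist_mass => s.
  have [h|h] := ltP L2 `| \sum_i `|Y K s 0 i| | => /=; first by have := p2 (Y K s); lra.
  rewrite mulr0 addr0; apply: pe => i; rewrite le_max; apply/orP; right.
  apply: le_trans h; apply: le_trans (ler_norm _).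
  exact: (le_term_sum (F := fun i => `|Y K s 0 i|)).
have a2 : 2 * C * mass K (fun s => L2 < `| \sum_i `|Y K s 0 i| |) <= eps / 8.
  apply: CC => //; rewrite -(Phi_cst K 0); apply: Phi_le => s; exact: ler0n.
have := @integral_approx R n _ _ mu idfun mid f p C L (eps / 8) fc fC tp p2 pe (ltW e8) => a3.
have a4 := CC _ (hL1 L ltac:(by rewrite le_max lexx)) (fine_ge0 (measure_ge0 _ _)).
have := ler_distD (Phi K (fun s => p (Y K s))) (Phi K (fun s => f (Y K s))) (\int[mu]_y f y).
have := ler_distD (\int[mu]_y p y) (Phi K (fun s => p (Y K s))) (\int[mu]_y f y).
rewrite [`| \int[mu]_y p y - _|]distrC.
move: a1 a2 a3 a4 h3 => /=; lra.
Qed.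

End Levy.

Lemma levy_simP (n : nat) (mu : probability (borel_rV R n) R) (Y : nat -> S -> 'rV[R]_n)
    (Z : 'I_n -> nat -> S -> R) (f : 'rV[R]_n -> R) (C : R) :
  (forall i, simP (fun K s => Y K s 0 i) (Z i)) -> (forall i, OP (Z i)) ->
  (forall (t : 'rV[R]_n) a, Phi K (fun s => cos (\sum_i Z i K s * t 0 i + a)) @[K --> \oo]
    --> \int[mu]_y cos (lin_form t y + a)) ->
  continuous f -> (forall y, `|f y| <= C) ->
  Phi K (fun s => f (Y K s)) @[K --> \oo] --> \int[mu]_y f y.
Proof.
move=> YZ oZ Zc; apply: levy_continuity => [t a|i]; last exact: simP_OP (YZ i) (oZ i).
have h : simP (fun K s => lin_form t (Y K s)) (fun K s => \sum_i Z i K s * t 0 i).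
  apply: (oP_ext (oP_sum (index_enum 'I_n) (fun i => oP_scale (t 0 i) (YZ i)))) => K s.
  by rewrite lin_formE -sumrB; apply: eq_bigr => i _; ring.
exact: simP_cos h (Zc t a).
Qed.

End Asymptotics.

(** * The law of the recursion *)

Section FinitelyValued.
Variables (R : realType) (disp : measure_display) (T : measurableType disp).
Variables (Pr : probability T R) (I : finType) (idx : T -> I).
Hypothesis midx : forall i, measurable (idx @^-1` [set i]).

Definition fin_law (i : I) : R := fine (Pr (idx @^-1` [set i])).

Lemma fin_lawE i : Pr (idx @^-1` [set i]) = (fin_law i)%:E.
Proof. by rewrite /fin_law fineK // fin_num_measure. Qed.

Lemma fin_law_ge0 i : 0 <= fin_law i.
Proof. by rewrite fine_ge0. Qed.

Lemma finite_measurable (disp' : measure_display) (T' : measurableType disp') (c : I -> T') :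
  measurable_fun setT (fun w => c (idx w)).
Proof.
move=> _ B mB; rewrite setTI.
have -> : (fun w => c (idx w)) @^-1` B = \bigcup_(i in [set i | B (c i)]) (idx @^-1` [set i]).
  apply/seteqP; split => [w Bw|w [i Bi wi]]; first by exists (idx w).
  by rewrite /preimage /= wi.
by apply: fin_bigcup_measurable => // i _; exact: midx.
Qed.

Lemma finite_integral (c : I -> R) :
  (\int[Pr]_w (c (idx w))%:E = (\sum_i c i * fin_law i)%:E)%E.
Proof.
have cE w : c (idx w) = \sum_i c i * \1_(idx @^-1` [set i]) w.
  rewrite (bigD1 (idx w)) //= big1 ?addr0 => [|i iw].
    by rewrite indicE mem_set // mulr1.
  by rewrite indicE memNset ?mulr0 // => /= h; rewrite h eqxx in iw.
under eq_integral do rewrite cE -sumEFin.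
rewrite integral_sum // => [|i].
  rewrite -sumEFin; apply: eq_bigr => i _; under eq_integral do rewrite EFinM.
  rewrite integralZl //; last exact: integrable_indic.
  rewrite integral_indic // setIT EFinM; congr (_ * _)%E; exact: fin_lawE.
under [X in _.-integrable _ X]eq_fun do rewrite EFinM.
by apply: integrableZl => //; exact: integrable_indic.
Qed.

Lemma fin_law_sum : \sum_i fin_law i = 1.
Proof.
have := finite_integral (fun=> 1); rewrite integral_cst // mul1e => h.
apply/EFin_inj; apply: (@etrans _ _ (Pr setT)); last exact: probability_setT.
by rewrite [RHS]h; congr (_%:E); apply: eq_bigr => i _; rewrite mul1r.
Qed.

End FinitelyValued.

Section ChainLaw.
Variables (R : realType) (d : nat) (A P : 'M[R]_d).
Variables (disp : measure_display) (T : measurableType disp) (Pr : probability T R).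
Variables (X : nat -> T -> 'I_d).
Hypothesis X_markov : markov_chain Pr P X.
Local Notation S := (uvn_chain_state R d).
Local Notation E n := (iter n (markov_op (chain_p P (@uvn_pos R d)) (uvn_mv A P))).

(** The state after K steps is a function of the first K + 1 positions, a finitely valued variable;
    measurability and integrals thus reduce to finite sums. *)
Definition prefix_of (K : nat) (w : T) : {ffun 'I_K.+1 -> 'I_d} := [ffun m : 'I_K.+1 => X m w].
(** Extended by a default beyond K because [uvn] expects an infinite path; by [uvn_ext] the values
    past K are not read. *)
Definition path_of (K : nat) (z : {ffun 'I_K.+1 -> 'I_d}) (m : nat) : 'I_d := z (inord m).

Lemma path_of_prefix K w m : (m <= K)%N -> path_of (prefix_of K w) m = X m w.
Proof. by move=> h; rewrite /path_of ffunE inordK. Qed.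

Lemma prefix_preim K z :
  prefix_of K @^-1` [set z] = [set w | forall m, (m <= K)%N -> X m w = path_of z m].
Proof.
apply/seteqP; split => w /=; first by move=> <- m h; rewrite path_of_prefix.
move=> h; apply/ffunP => m; rewrite ffunE h; last by rewrite -ltnS.
by rewrite /path_of inord_val.
Qed.

Lemma uvn_ext (x x' : nat -> 'I_d) K : (forall m, (m <= K)%N -> x m = x' m) ->
  uvn A P x K = uvn A P x' K.
Proof.
elim: K => //= K IH h; rewrite IH ?h // => m hm; apply: h; exact: leqW.
Qed.

Lemma X_measurable n i : measurable (X n @^-1` [set i]).
Proof. by case: X_markov => + _; exact. Qed.

Lemma prefix_measurable K z : measurable (prefix_of K @^-1` [set z]).
Proof.
have -> : prefix_of K @^-1` [set z] = \bigcap_(m : 'I_K.+1) (X m @^-1` [set z m]).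
  apply/seteqP; split => w /=; first by move=> <- m _ /=; rewrite ffunE.
  by move=> h; apply/ffunP => m; rewrite ffunE; exact: (h m I).
apply: fin_bigcap_measurable => // m _; exact: X_measurable.
Qed.

Lemma pair_measurable K zy :
  measurable ((fun w => (prefix_of K w, X K.+1 w)) @^-1` [set zy]).
Proof.
case: zy => z y.
have -> : (fun w => (prefix_of K w, X K.+1 w)) @^-1` [set (z, y)] =
   prefix_of K @^-1` [set z] `&` X K.+1 @^-1` [set y].
  by apply/seteqP; split => w /=; [case=> -> -> | case=> -> ->].
by apply: measurableI; [exact: prefix_measurable|exact: X_measurable].
Qed.

Lemma pair_law K z y :
  fin_law Pr (fun w => (prefix_of K w, X K.+1 w)) (z, y) =
  fin_law Pr (prefix_of K) z * P (path_of z K) y.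
Proof.
apply/EFin_inj; rewrite -fin_lawE; last exact: pair_measurable.
pose x m := if (m <= K)%N then path_of z m else y.
rewrite EFinM -fin_lawE; last exact: prefix_measurable.
case: X_markov => _ /(_ K x).
rewrite {3 4}/x leqnn ltnn prefix_preim => e.
rewrite (_ : [set w | forall m, (m <= K)%N -> X m w = path_of z m] =
  [set w | forall m, (m <= K)%N -> X m w = x m]).
  rewrite -e; congr (Pr _); apply/seteqP; split => w /=.
    move=> [zw yw] m; rewrite /x -zw -yw leq_eqVlt => /orP[/eqP->|].
      by rewrite ltnn.
    by rewrite ltnS => h; rewrite h path_of_prefix.
  move=> h; have <- : X K.+1 w = y by rewrite h // /x ltnn.
  congr (_, _); apply/ffunP => m; rewrite ffunE h; last by apply: ltnW; exact: ltn_ord.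
  by rewrite /x -ltnS ltn_ord /path_of inord_val.
by apply/seteqP; split => w /= h m hm; rewrite h // /x hm.
Qed.

Definition chain_at (K : nat) (w : T) : S := (X K w, uvn A P (X ^~ w) K).
Definition chain_of (K : nat) (z : {ffun 'I_K.+1 -> 'I_d}) : S :=
  (path_of z K, uvn A P (path_of z) K).

Lemma chain_atE K w : chain_at K w = chain_of (prefix_of K w).
Proof.
rewrite /chain_at /chain_of path_of_prefix //; congr (_, _).
by apply: uvn_ext => m h; rewrite path_of_prefix.
Qed.

(** The bridge from the given probability space to the averaging operator. The induction peels off
    the last transition: by [pair_law], given the prefix the next position is drawn from P, which is
    one application of the operator. *)
Lemma chain_expectation K (g : S -> R) :
  (\int[Pr]_w (g (chain_at K w))%:E =
   (\sum_x fin_law Pr (X 0) x * E K g (uvn_ref R x))%:E)%E.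
Proof.
elim: K g => [|K IH] g.
  rewrite (finite_integral Pr (X_measurable 0) (fun x => g (uvn_ref R x))).
  by congr (_%:E); apply: eq_bigr => x _; rewrite mulrC.
rewrite iterSr -IH.
have -> : (\int[Pr]_w (markov_op (chain_p P (@uvn_pos R d)) (uvn_mv A P) g (chain_at K w))%:E =
  \int[Pr]_w (markov_op (chain_p P (@uvn_pos R d)) (uvn_mv A P) g (chain_of (prefix_of K w)))%:E)%E.
  by apply: eq_integral => w _; rewrite chain_atE.
rewrite (finite_integral Pr (@prefix_measurable K)
  (fun z => markov_op (chain_p P (@uvn_pos R d)) (uvn_mv A P) g (chain_of z))).
have -> : (\int[Pr]_w (g (chain_at K.+1 w))%:E =
  \int[Pr]_w (g (uvn_mv A P (chain_of (prefix_of K w)) (X K.+1 w)))%:E)%E.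
  by apply: eq_integral => w _; rewrite -chain_atE.
rewrite (finite_integral Pr (@pair_measurable K)
  (fun zy => g (uvn_mv A P (chain_of zy.1) zy.2))).
congr (_%:E); transitivity (\sum_z \sum_y g (uvn_mv A P (chain_of z) y) *
  fin_law Pr (fun w => (prefix_of K w, X K.+1 w)) (z, y)).
  by rewrite pair_bigA; apply: eq_bigr => -[].
apply: eq_bigr => z _; rewrite /markov_op mulr_suml; apply: eq_bigr => y _.
by rewrite pair_law /chain_p /=; ring.
Qed.

End ChainLaw.

(** An exact identity rather than a first-order expansion: with Sigma = F Gamma + dev and F j j = 1
    - 1/c, the cross terms are confined to [den], which tends to 1. *)
Lemma estimator_expansion (R : realType) (r F c dev dev' g g' b : R) :
  r != 0 -> c != 0 -> g != 0 -> g' != 0 ->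
  let den := 1 - c * (r^-1 * (r^-1 * dev' * (g' / r ^+ 2)^-1)) in den != 0 ->
  r * ((F * g + dev) / g * (g' / (g' - ((1 - c^-1) * g' + dev'))) + b - (c * F + b)) =
  c * (r^-1 * dev * (g / r ^+ 2)^-1 + c * F * (r^-1 * dev' * (g' / r ^+ 2)^-1)) * den^-1.
Proof.
move=> r0 c0 g0 g'0 den.
have denE : den = (g' - c * dev') / g' by rewrite /den; field; rewrite r0 g'0.
have -> : g' - ((1 - c^-1) * g' + dev') = (g' - c * dev') / c by field.
rewrite denE mulf_eq0 invr_eq0 (negbTE g'0) orbF => h.
by field; rewrite ?r0 ?c0 ?g0 ?g'0 ?h.
Qed.

Section UvnLimit.
Variables (R : realType) (d : nat) (A P : 'M[R]_d).
Hypothesis Pst : stochastic P.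
Hypothesis P_support : forall i j, 0 < P i j <-> A i j != 0.
Hypothesis Pirr : irreducible_mx P.
Hypothesis Paper : aperiodic_mx P.
Hypothesis A_rho : spectral_radius A < 1.
Hypothesis H_rho : spectral_radius (Hhat A P) < 1.
Variable nu : 'I_d -> R.
Hypothesis nu_ge0 : forall x, 0 <= nu x.
Hypothesis nu_sum : \sum_x nu x = 1.

Local Notation S := (uvn_chain_state R d).
Local Notation p := (chain_p P (@uvn_pos R d)).
Local Notation E n := (iter n (markov_op p (uvn_mv A P))).
Local Notation C := (uvn_C A).

Definition uvn_mean (K : nat) (g : S -> R) : R := \sum_x nu x * E K g (uvn_ref R x).

Lemma uvn_mean_le K g h : (forall s, g s <= h s) -> uvn_mean K g <= uvn_mean K h.
Proof.
move=> gh; apply: ler_sum => x _; rewrite ler_wpM2l //.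
exact: (markE_le _ (chain_p_ge0 _ Pst)).
Qed.

Lemma uvn_mean_lin K a b g h :
  uvn_mean K (fun s => a * g s + b * h s) = a * uvn_mean K g + b * uvn_mean K h.
Proof.
rewrite !mulr_sumr -big_split; apply: eq_bigr => x _ /=; rewrite markE_lin; ring.
Qed.

Lemma uvn_mean_cst K c : uvn_mean K (fun=> c) = c.
Proof.
under [LHS]eq_bigr do rewrite (markE_cst _ (chain_p_sum _ Pst)).
by rewrite -mulr_suml nu_sum mul1r.
Qed.

Lemma uvn_mean_bound K g c : (forall x, E K g (uvn_ref R x) <= c) -> uvn_mean K g <= c.
Proof.
move=> H; rewrite -[leRHS]mul1r -nu_sum mulr_suml.
by apply: ler_sum => x _; rewrite ler_wpM2l.
Qed.

Let scaleE (K : nat) (f : S -> R) (c : R) x :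
  E K (fun s => ((Num.sqrt K%:R)^-1 * f s) ^+ 2) (uvn_ref R x) = E K (fun s => f s ^+ 2) (uvn_ref R x) / K%:R.
Proof.
have -> : (fun s => ((Num.sqrt K%:R)^-1 * f s) ^+ 2) = (fun s => K%:R^-1 * f s ^+ 2) :> (S -> R).
  by apply/funext => s; rewrite exprMn exprVn sqr_sqrtr.
by rewrite markE_Z mulrC.
Qed.

Let mt (K : nat) (i j : 'I_d) (s : S) : R := (Num.sqrt K%:R)^-1 * uvn_M A s i j.
Let sd (K : nat) (i j : 'I_d) (s : S) : R := (Num.sqrt K%:R)^-1 * uvn_dev A s i j.

Let mt_OP i j : OP uvn_mean (fun K => mt K i j).
Proof.
have [c Hc] := uvn_M_var Pst P_support A_rho H_rho.
apply: (OP_of_sqr uvn_mean_le uvn_mean_lin (C := `|c|)) => K.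
apply: uvn_mean_bound => x; rewrite scaleE //.
have [->|K0] := posnP K; first by rewrite invr0 mulr0.
rewrite ler_pdivrMr ?ltr0n //; apply: (le_trans (Hc K x i j)).
by rewrite mulrC ler_wpM2r ?ler_norm.
Qed.

Let sd_simP i j : simP uvn_mean (fun K => sd K i j) (fun K => mt K i j).
Proof.
have [c Hc] := uvn_corr_var Pst P_support H_rho.
have h : oP uvn_mean (fun K s => (Num.sqrt K%:R)^-1 * uvn_corr A s i j).
  apply: (oP_of_sqr uvn_mean_le uvn_mean_lin (u := fun K => `|c| / K%:R)).
    apply/cvg_epsP => e e0; have [K0 [_ H0]] := inv_small `|c| e0; exists K0 => K /H0.
    have q : 0 <= `|c| / K%:R by apply: divr_ge0; rewrite ?ler0n.
    by rewrite subr0 (ger0_norm q).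
  move=> K; apply: uvn_mean_bound => x; rewrite scaleE //.
  rewrite ler_wpM2r ?invr_ge0 //; exact: le_trans (Hc K x i j) (ler_norm _).
apply: (oP_ext (oP_scale uvn_mean_le uvn_mean_lin uvn_mean_cst (-1) h)) => K s.
rewrite /sd /mt /uvn_M; ring.
Qed.

Let gam i j := uvn_gam A P i j.

Let Gamma_simP i j :
  simP uvn_mean (fun K s => (uvn_Gamma s.2 i j)%:R / K%:R) (fun _ _ => gam i j).
Proof.
apply: (oP_of_sqr uvn_mean_le uvn_mean_lin
  (u := fun K => uvn_mean K (fun s => ((uvn_Gamma s.2 i j)%:R / K%:R - gam i j) ^+ 2))) => //.
have -> : 0 = \sum_x nu x * 0 :> R by rewrite big1 // => x _; rewrite mulr0.
apply: cvg_bigsum => x _; apply: cvgM; first exact: cvg_cst.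
exact: (uvn_lln Pst P_support Pirr Paper H_rho i j x).
Qed.

(** Gradient of the estimator: to first order, entry (i, j) of the error is the linear form of the
    martingales with these coefficients. The two terms add up when i = j. *)
Definition uvn_weight (ij a : 'I_d * 'I_d) : R :=
  let: (i, j) := ij in
  (a == ij)%:R * (C j j / uvn_gam A P i j) +
  (a == (j, j))%:R * (C j j ^+ 2 * uvn_F A i j / uvn_gam A P j j).

Lemma uvn_lin_weight i j s : uvn_lin A (uvn_weight (i, j)) s =
  C j j * (uvn_M A s i j * (gam i j)^-1 +
    C j j * uvn_F A i j * (uvn_M A s j j * (gam j j)^-1)).
Proof.
have pick (b : 'I_d * 'I_d) (c : R) :
    \sum_a (a == b)%:R * c * uvn_M A s a.1 a.2 = c * uvn_M A s b.1 b.2.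
  under eq_bigr do rewrite -mulrA.
  by rewrite (sum_indicator (fun a => c * uvn_M A s a.1 a.2)).
rewrite /uvn_lin; under eq_bigr do rewrite mulrDl.
rewrite big_split /= !pick /= /gam; ring.
Qed.

Definition uvn_error (K : nat) (s : S) : 'M[R]_d :=
  Num.sqrt K%:R *: (uvn_estimator (uvn_Sigma s.2) (uvn_Gamma s.2) - C).

Lemma uvn_error_simP i j :
  let Z K s := (Num.sqrt K%:R)^-1 * uvn_lin A (uvn_weight (i, j)) s in
  simP uvn_mean (fun K s => uvn_error K s i j) Z /\ OP uvn_mean Z.
Proof.
move=> Z.
have gam0 k l : gam k l != 0 by rewrite gt_eqF // uvn_gam_gt0.
have Cj := uvn_Cjj Pst P_support A_rho H_rho j.
have -> : Z = fun K s => C j j * (mt K i j s * (gam i j)^-1 +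
    C j j * uvn_F A i j * (mt K j j s * (gam j j)^-1)).
  by apply/funext => K; apply/funext => s; rewrite /Z uvn_lin_weight /mt; ring.
apply: (delta_method uvn_mean_le uvn_mean_lin uvn_mean_cst (gam0 i j) (gam0 j j)
  (sd_simP i j) (mt_OP i j) (sd_simP j j) (mt_OP j j) (Gamma_simP i j) (Gamma_simP j j)).
(* From K = 1 on, sqrt K is invertible. *)
exists 1%N => K K1 s den g0 g0' den0.
have K0 : 0 < K%:R :> R by rewrite ltr0n.
have r0 : Num.sqrt K%:R != 0 :> R by rewrite gt_eqF // sqrtr_gt0.
have KE : K%:R = Num.sqrt K%:R ^+ 2 :> R by rewrite sqr_sqrtr // ltW.
move: g0 g0'; rewrite !mulf_eq0 !invr_eq0 (gt_eqF K0) !orbF => g0 g0'.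
have := @estimator_expansion R (Num.sqrt K%:R) (uvn_F A i j) (C j j) (uvn_dev A s i j)
  (uvn_dev A s j j) (uvn_Gamma s.2 i j)%:R (uvn_Gamma s.2 j j)%:R (i == j)%:R r0 Cj g0 g0'.
rewrite -KE => /(_ den0) <-; rewrite !mxE.
have -> : C i j = C j j * uvn_F A i j + (i == j)%:R.
  by rewrite uvn_FE // /uvn_G; field.
have SE k l : uvn_Sigma s.2 k l = uvn_F A k l * (uvn_Gamma s.2 k l)%:R + uvn_dev A s k l.
  by rewrite /uvn_dev addrC subrK.
have Fjj : 1 - (C j j)^-1 = uvn_F A j j.
  by rewrite uvn_FE // (uvn_Gjj Pst P_support A_rho H_rho) eqxx mul1r.
by rewrite Fjj -!SE.
Qed.

Lemma uvn_error_clt (t : 'I_d * 'I_d -> R) a :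
  uvn_mean K (fun s => cos ((Num.sqrt K%:R)^-1 * uvn_lin A t s + a)) @[K --> \oo]
    --> expR (- (uvn_var A P t / 2)) * cos a.
Proof.
have -> : expR (- (uvn_var A P t / 2)) * cos a =
    \sum_x nu x * (expR (- (uvn_var A P t / 2)) * cos a) by rewrite -mulr_suml nu_sum mul1r.
apply: cvg_bigsum => x _; apply: cvgM; first exact: cvg_cst.
exact: (uvn_clt Pst P_support Pirr Paper A_rho H_rho (t := t) x (a := a)).
Qed.

End UvnLimit.

Theorem theorem4p3 (R : realType) (d : nat) (A P : 'M[R]_d)
    (A_unit : A \in unitmx)
    (A_rho : spectral_radius A < 1)
    (P_stochastic : stochastic P)
    (P_support : forall i j, 0 < P i j <-> A i j != 0)
    (P_irreducible : irreducible_mx P)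
    (P_aperiodic : aperiodic_mx P)
    (Hhat_rho : spectral_radius (Hhat A P) < 1)
    (disp : measure_display) (T : measurableType disp)
    (Pr : probability T R) (X : nat -> T -> 'I_d)
    (X_markov : markov_chain Pr P X) :
  exists M_C : 'M[R]_(d * d),
    symmetric_psd M_C /\
    exists mu : probability (borel_rV R (d * d)) R,
      multivariate_normal 0 M_C mu /\
      cvg_in_distribution Pr
        (fun (K : nat) (w : T) =>
           mxvec (Num.sqrt K%:R *:
                  (Chat A P (fun n => X n w) K - invmx (1%:M - A))))
        mu.
Proof.
case: (X_markov) => mX _.
(* A probability space is nonempty, which yields a state; the nonnegativity of the limit variance in
   [uvn_var_ge0] is read off from one. *)
have w0 : exists w : T, True.
  apply: contrapT => h; have := probability_setT Pr; rewrite (_ : setT = set0) ?measure0.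
    by move=> /eqP; rewrite eq_sym onee_eq0.
  by apply/seteqP; split => // w _; case: h; exists w.
have x0 : 'I_d by case/cid: w0 => w _; exact: X 0%N w.
have mX0 := mX 0%N.
pose nu := fin_law Pr (X 0%N).
have nu0 x : 0 <= nu x by exact: fin_law_ge0.
have nu1 : \sum_x nu x = 1 by exact: fin_law_sum.
pose pos (k : 'I_(d * d)) : 'I_d * 'I_d := enum_val (cast_ord (esym (mxvec_cast d d)) k).
have mxvecK (B : 'M[R]_d) k : mxvec B 0 k = B (pos k).1 (pos k).2.
  by rewrite /mxvec castmxE mxE.
pose tau (u : 'rV[R]_(d * d)) a := \sum_k u 0 k * uvn_weight A P (pos k) a.
(* The limit covariance [uvn_c] of the martingales, transported by the gradient on both sides. *)
pose M : 'M[R]_(d * d) := \matrix_(k, l)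
  \sum_a \sum_b uvn_weight A P (pos k) a * uvn_weight A P (pos l) b * uvn_c A P a b.
have ME (u : 'rV[R]_(d * d)) : (u *m M *m u^T) 0 0 = uvn_var A P (tau u).
  have lin (g : 'I_d * 'I_d -> R) : \sum_a tau u a * g a =
      \sum_k u 0 k * \sum_a uvn_weight A P (pos k) a * g a.
    under eq_bigr do rewrite mulr_suml.
    rewrite exchange_big; apply: eq_bigr => k _; rewrite mulr_sumr.
    by apply: eq_bigr => a _; rewrite mulrA.
  have -> : uvn_var A P (tau u) = \sum_a tau u a * \sum_b tau u b * uvn_c A P a b.
    by apply: eq_bigr => a _; rewrite mulr_sumr; apply: eq_bigr => b _; rewrite mulrA.
  rewrite lin mxE; under eq_bigr do rewrite mxE mulr_suml.
  rewrite exchange_big; apply: eq_bigr => k _ /=.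
  under [in RHS]eq_bigr do rewrite lin mulr_sumr.
  rewrite exchange_big mulr_sumr; apply: eq_bigr => l _.
  rewrite !mxE -mulrA; congr (_ * _); rewrite mulr_suml; apply: eq_bigr => a _.
  rewrite mulr_suml !mulr_sumr; apply: eq_bigr => b _; ring.
have Mpsd : symmetric_psd M.
  split; last by move=> u; rewrite ME; exact: uvn_var_ge0.
  apply/matrixP => k l; rewrite !mxE exchange_big; apply: eq_bigr => a _.
  by apply: eq_bigr => b _; rewrite uvn_c_sym; ring.
have [mu [mu_normal mu_char]] := multivariate_normal_exists Mpsd.
exists M; split => //; exists mu; split => //.
pose Y K s := mxvec (uvn_error A K s).
have YE K w : mxvec (Num.sqrt K%:R *: (Chat A P (fun n => X n w) K - invmx (1%:M - A))) =
    Y K (chain_at A P X K w) by [].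
split => [K|f fc [c fC]].
  have -> : (fun w => mxvec (Num.sqrt K%:R *: (Chat A P (fun n => X n w) K - invmx (1%:M - A)))) =
    (fun w => Y K (chain_of A P (prefix_of X K w))).
    by apply/funext => w; rewrite YE chain_atE.
  exact: (finite_measurable (prefix_measurable X_markov (K := K))
    (fun z => Y K (chain_of A P z) : borel_rV R (d * d))).
have EE K : ('E_Pr[f \o (fun w => mxvec (Num.sqrt K%:R *:
      (Chat A P (fun n => X n w) K - invmx (1%:M - A))))] =
    (uvn_mean A P nu K (fun s => f (Y K s)))%:E)%E.
  rewrite unlock; exact: (chain_expectation A X_markov K (fun s => f (Y K s))).
under eq_fun do rewrite EE.
have mf := continuous_borel_measurable fc.
have If := bounded_prob_integrable mu mf fC.
have -> : (\int[mu]_y (f y)%:E = (\int[mu]_y f y)%:E)%E.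
  by rewrite /Rintegral fineK //; exact: integrable_fin_num.
apply: cvg_EFin; first exact: nearW.
have L := levy_simP (uvn_mean_le A P_stochastic nu0) (@uvn_mean_lin _ _ A P nu) (uvn_mean_cst A P_stochastic nu1)
  (mu := mu) (Y := Y)
  (Z := fun k K s => (Num.sqrt K%:R)^-1 * uvn_lin A (uvn_weight A P (pos k)) s) _ _ _ fc fC.
apply: L => [k|k|t a].
- have [h _] := uvn_error_simP P_stochastic P_support P_irreducible P_aperiodic A_rho Hhat_rho
    nu0 nu1 (pos k).1 (pos k).2.
  by rewrite -surjective_pairing in h; apply: oP_ext h _ => K s; rewrite mxvecK.
- have [_ h] := uvn_error_simP P_stochastic P_support P_irreducible P_aperiodic A_rho Hhat_rho
    nu0 nu1 (pos k).1 (pos k).2.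
  by rewrite -surjective_pairing in h.
have -> : \int[mu]_y cos (lin_form t y + a) = expR (- (uvn_var A P (tau t) / 2)) * cos a.
  by rewrite mu_char ME.
(* Cramer-Wold: a linear combination of the entries of the error is a single linear form of the
   martingales, with coefficients [tau t]. *)
have -> : (fun K => uvn_mean A P nu K (fun s => cos (\sum_i (Num.sqrt K%:R)^-1 *
     uvn_lin A (uvn_weight A P (pos i)) s * t 0 i + a))) =
  (fun K => uvn_mean A P nu K (fun s => cos ((Num.sqrt K%:R)^-1 * uvn_lin A (tau t) s + a))).
  apply/funext => K; congr (uvn_mean _ _ _ _ _); apply/funext => s; congr (cos (_ + _)).
  rewrite /uvn_lin /tau mulr_sumr; under eq_bigr do rewrite mulr_sumr mulr_suml.
  rewrite exchange_big; apply: eq_bigr => b _; rewrite mulr_suml mulr_sumr.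
  by apply: eq_bigr => k _; ring.
exact: uvn_error_clt.
Qed.
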